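(* Let $(M,h)$ be a Riemannian manifold of dimension $n\ge 3$ and let $N\in\mathbb N$, with $2N\le n$ if $n$ is even. Let $g_+$ be an even Poincaré metric in normal form relative to $h$. Then, as polynomials in $\lambda\in\mathbb C$ with values in operators $C^\infty(M_+)\to C^\infty(M)$, $$(-2N)_N\left(\lambda+\frac{n+1}{2}-2N\right)_N D_{2N}^{res}(h;\lambda)=\iota^*S_{2N}(g_+;\lambda+n-2N).$$ Similarly, for the odd-order residue families, $$2(-2N-1)_{N+1}\left(\lambda+\frac n2-2N-\frac12\right)_{N+1}D_{2N+1}^{res}(h;\lambda)=\iota^*S_{2N+1}(g_+;\lambda+n-2N-1).$$
   Context: Setting. $M_+=[0,\varepsilon)\times M$ with coordinate $r$ on the first factor, $M_+^\circ=(0,\varepsilon)\times M$, $\iota:M\to M_+$, $\iota(m)=(0,m)$. An even Poincaré metric in normal form relative to $h$ is a metric $g_+=r^{-2}(dr^2+h_r)$ on $M_+^\circ$, where $h_r$ is a one-parameter family of metrics on $M$, smooth up to $r=0$, with $h_0=h$ and with only even powers of $r$ in its Taylor series at $r=0$, such that: for odd $n$, $\operatorname{Ric}(g_+)+ng_+=O(r^\infty)$; for even $n$, $\operatorname{Ric}(g_+)+ng_+=O(r^{n-2})$ and $\operatorname{tr}_h(\iota^*(r^{-n+2}(\operatorname{Ric}(g_+)+ng_+)))=0$. Put $\bar g=r^2g_+=dr^2+h_r$. Laplacians are non-positive: $\Delta=-\delta d$. $\mathbb N=\{1,2,\dots\}$; $(a)_N=a(a+1)\cdots(a+N-1)$,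 $(a)_0=1$. Shift operators. $S(g_+;\lambda)=r\Delta_{\bar g}-(2\lambda-n+1)\partial_r-\frac12(\lambda-n+1)\operatorname{tr}(h_r^{-1}\dot h_r)$ (dot $=\partial/\partial r$), acting on $C^\infty(M_+)$, and $S_N(g_+;\lambda)=S(g_+;\lambda)\circ S(g_+;\lambda+1)\circ\cdots\circ S(g_+;\lambda+N-1)$. Volume coefficients. $dvol(h_r)=v(r)\,dvol(h)$, $v(r)=\sum_{j}v_jr^j$ (Taylor expansion at $r=0$), $v_0=1$, and $v_j=0$ for odd $j$. Solution operators. $\mathcal T_{2j}(h;\lambda)$ are the meromorphic (in $\lambda$) families of differential operators on $C^\infty(M)$, $\mathcal T_0=\mathrm{Id}$, determined recursively by the requirement that for all $f\in C^\infty(M)$ the formal series $\sum_{j\ge0}r^{\lambda+2j}\mathcal T_{2j}(h;\lambda)f$ solves $(\Delta_{g_+}+\lambda(n-\lambda))u=0$ (coefficient by coefficient in powers of $r$). For odd $n$ all of them are determined by $h$; for even $n$ only those with $2j\le n$ are used, and these are determined by $h$. Put $\mathcal T_j=0$ for odd $j$. $\mathcal T_j^*(h;\nu)$ is the formal adjoint of $\mathcal T_j(h;\nu)$ with respect to the scalar product on $C^\infty(M)$ defined by $h$. Residue families. $\delta_N(h;\nu)=\sum_{j=0}^N\frac1{(N-j)!}\big[\mathcal T_j^*(h;\nu)v_0+\mathcal T_{j-1}^*(h;\nu)v_1+\cdots+\mathcal T_0^*(h;\nu)v_j\big]\iota^*\partial_r^{N-j}$ (the $v_i$ act by multiplication),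 and $$D_{2N}^{res}(h;\nu)=2^{2N}N!\left(-\tfrac n2-\nu+N\right)_N\delta_{2N}(h;\nu+n-2N),$$ $$D_{2N+1}^{res}(h;\nu)=2^{2N}N!\left(-\tfrac n2-\nu+N+1\right)_N\delta_{2N+1}(h;\nu+n-2N-1).$$ These are polynomial in $\nu$. *)

(* Defs.v *)
From mathcomp Require Import all_boot all_order all_algebra.
From mathcomp Require Import all_classical all_reals all_analysis.
From mathcomp Require Import complex.

Set Implicit Arguments.
Unset Strict Implicit.
Unset Printing Implicit Defensive.

Import Order.TTheory GRing.Theory Num.Theory.
Import numFieldNormedType.Exports.

Local Open Scope classical_set_scope.
Local Open Scope ring_scope.
Local Open Scope complex_scope.

Section Calculus.
Variable R : realType.

Definition evec m (i : 'I_m) : 'rV[R]_m := delta_mx 0 i.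

Fixpoint Ck m (k : nat) (W : set 'rV[R]_m) (F : 'rV[R]_m -> R) : Prop :=
  (forall y, W y -> {for y, continuous F}) /\
  match k with
  | 0 => True
  | k'.+1 => forall i, (forall y, W y -> derivable F y (evec i)) /\
                       Ck k' W (fun y => 'D_(evec i) F y)
  end.

(* Smoothness on a set that need not be open: local smooth extendability.
   On an open set this is the usual C^oo; on [0, eps) x (open set) it is
   smoothness up to the boundary. *)
Definition smooth_on m (A : set 'rV[R]_m) (F : 'rV[R]_m -> R) : Prop :=
  forall y, A y -> exists (W : set 'rV[R]_m) (G : 'rV[R]_m -> R),
    [/\ open W, W y, forall k, Ck k W G & forall z, A z -> W z -> G z = F z].

(* Derivatives are taken from the right, so that the same formulas apply on
   the boundary r = 0 of M_+; wherever F is differentiable in the ordinary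
   sense, pder i F agrees with 'D_(evec i) F. *)
Definition rder (w : R -> R) (r : R) : R :=
  lim ((fun t : R => t^-1 * (w (r + t) - w r)) @ 0^'+).

Definition pder m (i : 'I_m) (F : 'rV[R]_m -> R) (y : 'rV[R]_m) : R :=
  rder (fun t => F (y + t *: evec i)) 0.

(* Complex-linear extension of an operator on real-valued functions. *)
Definition cx (T U : Type) (D : (T -> R) -> U -> R) (u : T -> R[i]) (y : U)
  : R[i] := D (fun z => complex.Re (u z)) y +i* D (fun z => complex.Im (u z)) y.

(* Lebesgue integral over R^m, as an iterated integral; it is applied to
   continuous compactly supported functions only. *)
Fixpoint rvint m : ('rV[R]_m -> R) -> R :=
  match m with
  | 0 => fun F => F 0
  | m'.+1 => fun F =>
      \int[lebesgue_measure]_(t in [set: R])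
         rvint (fun y : 'rV[R]_m' => F (row_mx t%:M y : 'rV[R]_(1 + m')))
  end.

(* r ^ z for r > 0 *)
Definition cpow (r : R) (z : R[i]) : R[i] :=
  (r `^ complex.Re z)%:C *
  (cos (complex.Im z * ln r) +i* sin (complex.Im z * ln r)).

Definition rising (a : R[i]) (N : nat) : R[i] := \prod_(i < N) (a + i%:R).

(* The polynomial that coincides with F on A: the polynomial continuation of F
   when A is cofinite and F is polynomial there. *)
Definition poly_ext (A : set R[i]) (F : R[i] -> R[i]) : {poly R[i]} :=
  xget 0 [set p : {poly R[i]} | forall z, A z -> p.[z] = F z].

End Calculus.

(* Metrics in a coordinate patch of R^m, given by their matrix G y of
   components. *)
Section LocalGeometry.
Variables (R : realType) (m : nat).
Implicit Types G : 'rV[R]_m -> 'M[R]_m.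

Definition laplacian G (u : 'rV[R]_m -> R) (y : 'rV[R]_m) : R :=
  (Num.sqrt (\det (G y)))^-1 *
  \sum_i pder i (fun z => Num.sqrt (\det (G z)) *
                   \sum_j invmx (G z) i j * pder j u z) y.

Definition christoffel G (c a b : 'I_m) (y : 'rV[R]_m) : R :=
  2^-1 * \sum_d invmx (G y) c d *
    (pder a (fun z => G z d b) y + pder b (fun z => G z d a) y
     - pder d (fun z => G z a b) y).

(* Sign convention: the round sphere has positive Ricci curvature. *)
Definition ricci G (y : 'rV[R]_m) : 'M[R]_m := \matrix_(a, b)
  (\sum_c pder c (christoffel G c a b) y
   - \sum_c pder b (christoffel G c a c) y
   + \sum_c \sum_d (christoffel G c c d y * christoffel G d a b y
                    - christoffel G c b d y * christoffel G d a c y)).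

End LocalGeometry.

Section Manifold.
Variables (R : realType) (n : nat).

Record chart (X : topologicalType) := Chart {
  dom : set X;
  chart_map : X -> 'rV[R]_n;
  param : 'rV[R]_n -> X }.

Definition img X (c : chart X) : set 'rV[R]_n := chart_map c @` dom c.

Definition is_chart X (c : chart X) : Prop :=
  [/\ open (dom c), open (img c),
      forall p, dom c p -> param c (chart_map c p) = p,
      forall p, dom c p -> {for p, continuous (chart_map c)} &
      forall x, img c x -> {for x, continuous (param c)}].

Record manifold := Manifold {
  point_of :> topologicalType;
  atlas : set (chart point_of);
  manifold_hausdorff : hausdorff_space point_of;
  manifold_second_countable : @second_countable point_of;
  atlas_chart : forall c, atlas c -> is_chart c;
  atlas_cover : forall p, exists2 c, atlas c & dom c p;
  atlas_smooth : forall c c', atlas c -> atlas c' -> forall i,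
    smooth_on (img c `&` param c @^-1` dom c')
      (fun x => chart_map c' (param c x) 0 i) }.

Variable M : manifold.

Definition smoothM (f : M -> R[i]) : Prop := forall c, atlas c ->
  smooth_on (img c) (fun x => complex.Re (f (param c x))) /\
  smooth_on (img c) (fun x => complex.Im (f (param c x))).

(* A symmetric 2-tensor on M is given by its components in each chart of the
   atlas; values at other charts or outside the image of a chart are
   irrelevant. *)
Definition tensor2 := chart M -> 'rV[R]_n -> 'M[R]_n.

Definition riemannian (g : tensor2) : Prop :=
  (forall c, atlas c ->
     (forall i j, smooth_on (img c) (fun x => g c x i j)) /\
     (forall x, img c x -> (g c x)^T = g c x /\
        forall w : 'rV[R]_n, w != 0 -> 0 < (w *m g c x *m w^T) 0 0)) /\
  (forall c c', atlas c -> atlas c' ->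
     forall x, img c x -> dom c' (param c x) ->
     let J := 'J (fun y => chart_map c' (param c y)) x in
     g c x = J *m g c' (chart_map c' (param c x)) *m J^T).

(* Coordinates of M_+ : the point (r, param c x) has coordinates
   row_mx r x in 'rV_(1 + n), with index 0 for r. *)
Definition pt (r : R) (x : 'rV[R]_n) : 'rV[R]_(1 + n) := row_mx r%:M x.
Definition rcoord (y : 'rV[R]_(1 + n)) : R := lsubmx y 0 0.
Definition xcoord (y : 'rV[R]_(1 + n)) : 'rV[R]_n := rsubmx y.
Definition i_r : 'I_(1 + n) := lshift n ord0.

Definition collar (eps : R) (c : chart M) : set 'rV[R]_(1 + n) :=
  [set y | 0 <= rcoord y < eps /\ img c (xcoord y)].

(* Functions on M_+ are maps R -> M -> R[i] of which only the values at
   0 <= r < eps matter. *)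
Definition in_chart (c : chart M) (u : R -> M -> R[i])
    (y : 'rV[R]_(1 + n)) : R[i] :=
  u (rcoord y) (param c (xcoord y)).

Definition smoothMplus (eps : R) (u : R -> M -> R[i]) : Prop :=
  forall c, atlas c ->
  smooth_on (collar eps c) (fun y => complex.Re (in_chart c u y)) /\
  smooth_on (collar eps c) (fun y => complex.Im (in_chart c u y)).

Section Poincare.
Variable hr : R -> tensor2.

Definition hmx (c : chart M) (y : 'rV[R]_(1 + n)) : 'M[R]_n :=
  hr (rcoord y) c (xcoord y).

Definition gbar (c : chart M) (y : 'rV[R]_(1 + n)) : 'M[R]_(1 + n) :=
  block_mx 1%:M 0 0 (hmx c y).

Definition gplus (c : chart M) (y : 'rV[R]_(1 + n)) : 'M[R]_(1 + n) :=
  (rcoord y) ^- 2 *: gbar c y.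

Definition einstein (c : chart M) (y : 'rV[R]_(1 + n)) : 'M[R]_(1 + n) :=
  ricci (gplus c) y + n%:R *: gplus c y.

(* einstein = O(r^k): the components in the frame d/dr, d/dx_i, locally
   uniformly up to the boundary *)
Definition einstein_O (k : nat) : Prop :=
  forall c, atlas c -> forall x, img c x -> forall a b, exists K : R,
  \forall y \near within [set y | 0 < rcoord y] (nbhs (pt 0 x)),
    `|einstein c y a b| <= K * rcoord y ^+ k.

(* iota^* (r ^ (- k) (Ric (g_+) + n g_+)) *)
Definition einstein_bdry (k : nat) (c : chart M) (x : 'rV[R]_n) : 'M[R]_n :=
  \matrix_(i, j) lim ((fun r : R => r ^- k *
     drsubmx (einstein c (pt r x)) i j) @ 0^'+).

Definition poincare (eps : R) (h : tensor2) : Prop :=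
  [/\ 0 < eps,
      forall r, 0 <= r < eps -> riemannian (hr r),
      forall c, atlas c -> forall i j,
        smooth_on (collar eps c) (fun y => hmx c y i j),
      forall c, atlas c -> forall x, img c x -> hr 0 c x = h c x &
      (forall c, atlas c -> forall x, img c x -> forall i j k, odd k ->
         iter k (@rder R) (fun r => hr r c x i j) 0 = 0) /\
      if odd n then forall k, einstein_O k
      else einstein_O (n - 2) /\
        forall c, atlas c -> forall x, img c x ->
          \tr (invmx (h c x) *m einstein_bdry (n - 2) c x) = 0].

(* The differential operators S and S_N read in the chart c: they act on
   functions of the coordinates (r, x), so that (S_N u) o chart^-1 is
   shift_opN applied to u o chart^-1. *)
Definition shift_op (c : chart M) (lam : R[i]) (u : 'rV[R]_(1 + n) -> R[i])
    (y : 'rV[R]_(1 + n)) : R[i] :=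
  (rcoord y)%:C * cx (laplacian (gbar c)) u y
  - (2 * lam - n%:R + 1) * cx (pder i_r) u y
  - 2^-1 * (lam - n%:R + 1) *
    (\tr (invmx (hmx c y) *m
          \matrix_(i, j) pder i_r (fun z => hmx c z i j) y))%:C * u y.

Fixpoint shift_opN (c : chart M) (N : nat) (lam : R[i])
    (u : 'rV[R]_(1 + n) -> R[i]) : 'rV[R]_(1 + n) -> R[i] :=
  if N is N'.+1 then shift_op c lam (shift_opN c N' (lam + 1) u) else u.

(* T_j, j <= J, has its poles among the zeros n/2 - i, 1 <= i <= J/2, of the
   coefficients (lam + 2i)(lam + 2i - n) - lam (lam - n) = 2i (2 lam + 2i - n)
   by which the recursion divides. *)
Definition regular (J : nat) (lam : R[i]) : Prop :=
  forall i, (0 < i)%N -> (i.*2 <= J)%N -> 2 * lam <> n%:R - i.*2%:R.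

(* For even n only the T_j with j <= n are determined by h (and used); T_j = 0
   for odd j in any case. *)
Definition admissible (j : nat) : bool := [|| odd n, odd j | (j <= n)%N].

Definition operators := nat -> R[i] -> (M -> R[i]) -> M -> R[i].

Definition partial_sum (T : operators) (lam : R[i]) (f : M -> R[i]) (J : nat)
    (r : R) (p : M) : R[i] :=
  \sum_(j < J.+1) cpow r (lam + j.*2%:R) * T j.*2 lam f p.

(* T is the family of solution operators.  Truncating the formal series after
   r ^ (lam + 2J) does not affect the coefficients of r ^ (lam + k), k <= 2J,
   in (Delta_{g_+} + lam (n - lam)) u, so their vanishing says that the
   truncation solves the equation up to o(r ^ (Re lam + 2J)). *)
Definition solution_operators (T : operators) : Prop :=
  [/\ forall lam f, T 0 lam f = f,
      forall j lam f, odd j -> T j lam f = (fun=> 0),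
      forall j lam f, admissible j -> regular j lam -> smoothM f ->
        smoothM (T j lam f) &
      forall J lam f, admissible J.*2 -> regular J.*2 lam -> smoothM f ->
      forall c, atlas c -> forall x, img c x ->
      let u := in_chart c (partial_sum T lam f J) in
      (fun r : R => complex.Re `|cx (laplacian (gplus c)) u (pt r x)
                         + lam * (n%:R - lam) * u (pt r x)|
                / (r `^ (complex.Re lam + J.*2%:R))) @ 0^'+ --> (0 : R)].

(* dvol (h_r) = v (r) dvol (h) *)
Definition volume_ratio (eps : R) (h : tensor2) (v : R -> M -> R) : Prop :=
  forall c, atlas c -> forall x, img c x -> forall r, 0 <= r < eps ->
  Num.sqrt (\det (hr r c x)) =
  v r (param c x) * Num.sqrt (\det (h c x)).

End Poincare.

(* int F dvol (h) over the coordinate patch of c *)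
Definition patch_int (h : tensor2) (c : chart M) (F : M -> R) : R :=
  rvint ((fun x => F (param c x) * Num.sqrt (\det (h c x))) \_ (img c)).

(* Formal adjoint with respect to the complex-bilinear extension of the scalar
   product (f, g) |-> int f g dvol (h).  By a partition of unity it suffices to
   test on functions f supported in a coordinate patch, and since differential
   operators do not increase supports both integrals then live there. *)
Definition formal_adjoint (h : tensor2)
    (A B : (M -> R[i]) -> M -> R[i]) : Prop :=
  (forall g, smoothM g -> smoothM (B g)) /\
  forall c, atlas c -> forall f g, smoothM f -> smoothM g ->
  (exists K : set M,
     [/\ compact K, K `<=` dom c & forall p, ~ K p -> f p = 0]) ->
  cx (fun F (_ : unit) => patch_int h c F) (fun p => A f p * g p) tt =
  cx (fun F (_ : unit) => patch_int h c F) (fun p => f p * B g p) tt.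

Definition adjoint_operators (h : tensor2) (T Tstar : operators) : Prop :=
  forall j lam, admissible j -> regular j lam ->
  formal_adjoint h (T j lam) (Tstar j lam).

Section ResidueFamilies.
Variables (v : R -> M -> R) (Tstar : operators).

Definition vcoef (j : nat) (p : M) : R :=
  iter j (@rder R) (fun r => v r p) 0 / j`!%:R.

Definition bdry_der (k : nat) (u : R -> M -> R[i]) (p : M) : R[i] :=
  cx (iter k (@rder R)) (fun r => u r p) 0.

Definition delta_fam (N : nat) (nu : R[i]) (u : R -> M -> R[i]) (p : M) : R[i] :=
  \sum_(j < N.+1) (N - j)`!%:R^-1 *
    \sum_(i < j.+1)
      Tstar (j - i)%N nu (fun q => (vcoef i q)%:C * bdry_der (N - j)%N u q) p.

(* The explicit formulas make sense where no T_j involved has a pole; the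
   residue families are their continuations, polynomial in the spectral
   parameter, to all of C. *)
Definition Dres_even (N : nat) (lam : R[i]) (u : R -> M -> R[i]) (p : M)
  : R[i] :=
  (poly_ext [set nu | regular N.*2 (nu + n%:R - N.*2%:R)]
    (fun nu => 2 ^+ N.*2 * N`!%:R * rising (- (n%:R / 2) - nu + N%:R) N *
       delta_fam N.*2 (nu + n%:R - N.*2%:R) u p)).[lam].

Definition Dres_odd (N : nat) (lam : R[i]) (u : R -> M -> R[i]) (p : M)
  : R[i] :=
  (poly_ext [set nu | regular N.*2.+1 (nu + n%:R - N.*2.+1%:R)]
    (fun nu => 2 ^+ N.*2 * N`!%:R * rising (- (n%:R / 2) - nu + N%:R + 1) N *
       delta_fam N.*2.+1 (nu + n%:R - N.*2.+1%:R) u p)).[lam].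

End ResidueFamilies.

End Manifold.

(* Main.v *)
Require Import Defs.
From mathcomp Require Import all_boot all_order all_algebra.
From mathcomp Require Import all_classical all_reals all_analysis.
From mathcomp Require Import fingroup perm complex.
From mathcomp Require Import ring lra zify.

(** Let [f] have compact support in a chart, [W = \sum_j r^(2j) T_2j(nu) f] and
    let [s] be the Riemannian density of [h_r].  Both [s * S(mu)] and the
    equation satisfied by [W] are given by radial operators of the same shape
    [Op].  By Green's identity, [W * s * S(mu) psi - psi * Op W] is a combination
    of divergences along M, of [r d_r F - (mu - nu) F] for a Wronskian [F], and
    of [(mu + nu - n + 1) d_r (s W psi)].  Take [mu = nu + k], extract the
    coefficient of [r^k], where [r d_r F - k F] has none, and integrate over M:
    [P_k(psi) = \int_M [r^k] (s W psi)] satisfies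
      [P_k(S(nu + k) psi) = - (k + 1) (2 nu + k - n + 1) P_(k+1)(psi)].
    Iterating from [k = 0] gives
      [P_0(S_L(nu) phi) = \prod_(k < L) - (k + 1) (2 nu + k - n + 1) * P_L(phi)].
    Here [P_0] is the pairing with [f] of the restriction to [r = 0], and [P_L(phi)]
    is the pairing of [f] with [delta_L(nu) phi], by definition of the adjoints.
    Testing against bump functions [f] gives the identity at regular [nu].

    It extends to all [nu] since both sides are polynomial.  On the side of the
    residue families, the recursion for the [T_2j] shows that [W] times
    [\prod_(0 < i <= J) (2 nu - n + 2i)] is polynomial of degree at most [J] in
    [nu], and the rising factor in [D^res] is this product up to a constant. *)

Set Implicit Arguments.
Unset Strict Implicit.
Unset Printing Implicit Defensive.

Import Order.TTheory GRing.Theory Num.Theory.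
Import numFieldNormedType.Exports.

Local Open Scope classical_set_scope.
Local Open Scope ring_scope.
Local Open Scope complex_scope.

(** * Functions of class Ck *)

(** Three obstacles shape the argument. The adjoints [Tstar] are known only through integrals
    against test functions, so whatever concerns [delta_fam], its polynomial dependence on the
    parameter included, is first proved after integration and then made pointwise. The operators
    [T j] are not assumed to be local: that [W] vanishes away from the support of [f], without which
    the divergences would not integrate to zero, is extracted from the recursion, in the same
    induction that shows the polynomial dependence. Finally, the equation for the series truncated
    at [r^(2J)] controls only the coefficients of [Op W] of order below [2J], while the odd family
    [L = 2J + 1] needs order [2J] too. When [n] is even and [2J = n] there is no further term
    [T_(2J+2)] to add; the missing coefficient vanishes because [h_r] is even, which makes [Op W]
    odd in [r]. The boundary [r = 0] belongs to the domain, so all calculus is done with one-sided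
    derivatives, computed on local smooth extensions. *)

Section RealCalculus.
Variable R : realType.
Implicit Types (m k : nat).

Lemma dnbhs_at_right (x : R) (A : set R) : x^' A -> at_right x A.
Proof.
move=> /nbhs_ballP[e e0 xeA]; apply/nbhs_ballP; exists e => //= y xey xy.
by apply: xeA => //; rewrite gt_eqF.
Qed.

(** The two difference quotients coincide. This lets the one-variable mean value theorem and chain
    rule act along lines. *)
Lemma line_is_derive m (F : 'rV[R]_m -> R) (y e : 'rV[R]_m) (s : R) :
  derivable F (y + s *: e) e ->
  is_derive s 1 (fun t : R => F (y + t *: e)) ('D_e F (y + s *: e)).
Proof.
move=> dF.
have E : (fun h : R => h^-1 *: (((fun t : R => F (y + t *: e)) \o shift s) (h *: (1 : R))
            - F (y + s *: e)))
     = (fun h : R => h^-1 *: ((F \o shift (y + s *: e)) (h *: e) - F (y + s *: e))).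
  apply/funext => h /=; congr (_ *: (F _ - _)).
  by rewrite [h *: 1]mulr1 scalerDl addrCA.
apply: DeriveDef; first by rewrite /derivable E.
by rewrite /derive E.
Qed.

(** Only values on the positive side of [y] enter [pder], so a differentiable [G] agreeing with [F]
    there computes it, also at boundary points. *)
Lemma pder_derive m (i : 'I_m) (F G : 'rV[R]_m -> R) (y : 'rV[R]_m) :
  derivable G y (evec R i) ->
  (\forall t \near 0^'+, F (y + t *: evec R i) = G (y + t *: evec R i)) ->
  F y = G y -> pder i F y = 'D_(evec R i) G y.
Proof.
move=> dG FG FGy; rewrite /pder /rder; apply: cvg_lim => //.
rewrite /derive cvg_at_rightE; last exact: dG.
have {}dG : h^-1 *: ((G \o shift y) (h *: evec R i) - G y) @[h --> 0^'+] -->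
    lim (h^-1 *: ((G \o shift y) (h *: evec R i) - G y) @[h --> 0^'+]).
  apply/cvg_ex; exists ('D_(evec R i) G y).
  by move=> A /dG; exact: dnbhs_at_right.
apply: cvg_trans dG; apply: near_eq_cvg.
near=> t; rewrite add0r scale0r addr0 /= FGy.
by rewrite [t *: _ + y]addrC (near FG t).
Unshelve. all: by end_near. Qed.

Lemma Ck_ext m k (W : set 'rV[R]_m) (F G : 'rV[R]_m -> R) : open W ->
  (forall y, W y -> F y = G y) -> Ck k W F -> Ck k W G.
Proof.
move=> oW; elim: k F G => [|k IH] F G FG [cF dF].
all: have nFG y : W y -> \near y, F y = G y
  by move=> Wy; apply: filterS (open_nbhs_nbhs (conj oW Wy)); exact: FG.
all: have cG y : W y -> {for y, continuous G}
  by move=> Wy; rewrite /prop_for /continuous_at -(FG _ Wy);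
  apply: cvg_trans (cF _ Wy); exact: (@near_eq_cvg _ _ (nbhs y) _ F G (nFG _ Wy)).
all: split => // i; have [d1 d2] := dF i.
split=> [y Wy|]; first by apply: near_eq_derivable (d1 _ Wy); exact: nFG.
by apply: IH d2 => y Wy; apply: near_eq_derive; exact: nFG.
Qed.

Lemma Ck_subset m k (W W' : set 'rV[R]_m) (F : 'rV[R]_m -> R) :
  W' `<=` W -> Ck k W F -> Ck k W' F.
Proof.
move=> sW; elim: k F => [|k IH] F /= [cF dF]; split => //.
- by move=> y /sW; exact: cF.
- by move=> y /sW; exact: cF.
by move=> i; have [d1 d2] := dF i; split=> [y /sW|]; [exact: d1|exact: IH].
Qed.

Lemma CkS m k (W : set 'rV[R]_m) (F : 'rV[R]_m -> R) : Ck k.+1 W F -> Ck k W F.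
Proof.
elim: k F => [|k IH] F; first by case.
move=> [cF dF]; split => // i; have [d1 d2] := dF i.
by split => //; exact: IH.
Qed.

Lemma Ck_cst m k (W : set 'rV[R]_m) (a : R) : open W -> Ck k W (cst a).
Proof.
move=> oW; elim: k a => [|k IH] a; split.
- by move=> y _; exact: cst_continuous.
- by [].
- by move=> y _; exact: cst_continuous.
move=> i; split=> [y _|]; first exact: derivable_cst.
by apply: Ck_ext (IH 0) => // y _; rewrite derive_cst.
Qed.

Lemma CkD m k (W : set 'rV[R]_m) (F G : 'rV[R]_m -> R) : open W ->
  Ck k W F -> Ck k W G -> Ck k W (fun y => F y + G y).
Proof.
move=> oW; elim: k F G => [|k IH] F G HF HG; split.
- by move=> y Wy; apply: continuousD; [exact: HF.1|exact: HG.1].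
- by [].
- by move=> y Wy; apply: continuousD; [exact: HF.1|exact: HG.1].
move=> i; have [d1 d2] := HF.2 i; have [e1 e2] := HG.2 i.
split=> [y Wy|]; first by apply: derivableD; [exact: d1|exact: e1].
apply: Ck_ext (IH _ _ d2 e2) => // y Wy.
exact: (esym (deriveD (d1 _ Wy) (e1 _ Wy))).
Qed.

Lemma CkM m k (W : set 'rV[R]_m) (F G : 'rV[R]_m -> R) : open W ->
  Ck k W F -> Ck k W G -> Ck k W (fun y => F y * G y).
Proof.
move=> oW; elim: k F G => [|k IH] F G HF HG; split.
- by move=> y Wy; apply: continuousM; [exact: HF.1|exact: HG.1].
- by [].
- by move=> y Wy; apply: continuousM; [exact: HF.1|exact: HG.1].
move=> i; have [d1 d2] := HF.2 i; have [e1 e2] := HG.2 i.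
split=> [y Wy|]; first by apply: derivableM; [exact: d1|exact: e1].
apply: Ck_ext (CkD oW (IH _ _ (CkS HF) e2) (IH _ _ (CkS HG) d2)) => // y Wy.
exact: (esym (deriveM (d1 _ Wy) (e1 _ Wy))).
Qed.

Lemma is_derive_line_comp m (F : 'rV[R]_m -> R) (g : R -> R) (d : R)
    (y v : 'rV[R]_m) : derivable F y v -> is_derive (F y) 1 g d ->
  is_derive y v (fun y => g (F y)) (d * 'D_v F y).
Proof.
move=> dF dg.
have := line_is_derive (y := y) (s := 0) (e := v) (F := F).
rewrite scale0r addr0 => /(_ dF) dl.
pose l := (fun t : R => F (y + t *: v)).
have l0 : l 0 = F y by rewrite /l scale0r addr0.
have dc : is_derive (0 : R) 1 (g \o l) (d * 'D_v F y).
  apply: DeriveDef.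
    apply/derivable1_diffP; apply: differentiable_comp.
      by apply/derivable1_diffP; apply: ex_derive.
    by apply/derivable1_diffP; rewrite l0; apply: ex_derive.
  rewrite -derive1E derive1_comp; [|exact: ex_derive|by rewrite l0; apply: ex_derive].
  by rewrite !derive1E l0 !derive_val.
have E : (fun h : R => h^-1 *: (((fun y => g (F y)) \o shift y) (h *: v) - g (F y))) =
    (fun h : R => h^-1 *: (((g \o l) \o shift 0) (h *: (1 : R)) - (g \o l) 0)).
  by apply/funext => h /=; rewrite l0 addr0 [h *: 1]mulr1 /l [h *: v + y]addrC.
by case: dc => dc1 dc2; apply: DeriveDef; rewrite /derivable /derive E.
Qed.

(** Each [g j.+1] is the derivative of [g j], so the chain rule stays inside the family and the
    induction on [k] closes for all [j] at once. It serves real powers, complex powers and the flat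
    function. *)
Lemma Ck_comp m (W : set 'rV[R]_m) (F : 'rV[R]_m -> R)
    (A : set R) (g : nat -> R -> R) : open W ->
  (forall y, W y -> A (F y)) ->
  (forall j t, A t -> is_derive t 1 (g j) (g j.+1 t)) ->
  forall k j, Ck k W F -> Ck k W (fun y => g j (F y)).
Proof.
move=> oW WA dg k j HF.
have cg l y : W y -> {for y, continuous (fun y => g l (F y))}.
  move=> Wy; apply: continuous_comp; first by case: k HF => [[H _]|k [H _]]; exact: H.
  apply: differentiable_continuous; apply/derivable1_diffP.
  by apply: ex_derive; exact: dg (WA _ Wy).
elim: k j HF => [|k IH] j HF; first by split=> // y; exact: cg.
split=> [y|i]; first exact: cg.
have [d1 d2] := HF.2 i.
have H y (Wy : W y) := is_derive_line_comp (d1 y Wy) (dg j _ (WA _ Wy)).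
split=> [y Wy|]; first by have [] := H y Wy.
apply: Ck_ext (CkM oW (IH j.+1 (CkS HF)) d2) => // y Wy.
by have [_ ->] := H y Wy.
Qed.

Lemma evec_continuous m (v y : 'rV[R]_m) (s : R) :
  {for s, continuous (fun t : R => y + t *: v)}.
Proof.
apply: continuousD; first exact: cst_continuous.
by apply: continuousZr_tmp; exact: cvg_id.
Qed.

Lemma is_derive_powR (a t : R) : 0 < t ->
  is_derive t 1 (fun t => t `^ a) (a * t `^ (a - 1)).
Proof. by move=> t0; exact: is_derive1_powR. Qed.

Lemma Ck_powR m k (W : set 'rV[R]_m) (F : 'rV[R]_m -> R) (a : R) : open W ->
  (forall y, W y -> 0 < F y) -> Ck k W F -> Ck k W (fun y => F y `^ a).
Proof.
move=> oW F0 HF.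
pose g j (t : R) := (\prod_(i < j) (a - i%:R)) * t `^ (a - j%:R).
have -> : (fun y => F y `^ a) = (fun y => g 0%N (F y)).
  by apply/funext => y; rewrite /g big_ord0 mul1r subr0.
apply: (@Ck_comp m W F [set t | 0 < t] g) => // j t t0.
have := is_derive_powR (a - j%:R) t0.
rewrite /g big_ord_recr /= => H.
apply: is_derive_eq.
by rewrite -mulrA -natr1 opprD addrA.
Qed.

Lemma evec_norm m (i : 'I_m) : `|evec R i| <= 1.
Proof.
have -> : `|evec R i| = mx_norm (evec R i) by [].
rewrite mx_normrE; apply: bigmax_le => // -[a b] _ /=.
by rewrite !mxE; case: (_ && _); rewrite ?normr1 ?normr0.
Qed.

(** The mean value theorem in direction [i], then in direction [j]. The left side is a second
    difference over a square of side [s] and is symmetric in the two directions. *)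
Lemma mvt_mixed m (W : set 'rV[R]_m) (G : 'rV[R]_m -> R) (y : 'rV[R]_m) (i j : 'I_m)
   (s : R) : 0 < s -> Ck 2 W G ->
  (forall a b, 0 <= a <= s -> 0 <= b <= s -> W (y + a *: evec R i + b *: evec R j)) ->
  exists a b, [/\ 0 <= a <= s, 0 <= b <= s &
   (G (y + s *: evec R i + s *: evec R j) - G (y + s *: evec R i))
   - (G (y + s *: evec R j) - G y) =
   s * s * 'D_(evec R j) (fun z => 'D_(evec R i) G z) (y + a *: evec R i + b *: evec R j)].
Proof.
move=> s0 [_ HG] Wab; set e := evec R i; set f := evec R j.
have [dG1 [_ /(_ j) [dG2 _]]] := HG i.
have s01 : 0 <= s <= s by rewrite lexx ltW.
have s00 : 0 <= (0:R) <= s by rewrite lexx ltW.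
pose u (a : R) := G (y + s *: f + a *: e) - G (y + a *: e).
pose du (a : R) := 'D_e G (y + s *: f + a *: e) - 'D_e G (y + a *: e).
have ud a : a \in `[0, s] -> is_derive a 1 u (du a).
  rewrite in_itv /= => as0; apply: is_deriveB; apply: line_is_derive; apply: dG1.
    by rewrite addrAC; exact: Wab.
  by have := Wab a 0 as0 s00; rewrite scale0r addr0.
have cu : {within `[0, s], continuous u}.
  apply: derivable_within_continuous => z Hz; by case: (ud z Hz).
have [a] := MVT s0 (fun z Hz => ud z (subset_itv_oo_cc Hz)) cu.
move=> /subset_itv_oo_cc; rewrite in_itv /= => as0.
pose w b := 'D_e G (y + a *: e + b *: f).
pose dw b := 'D_f (fun z => 'D_e G z) (y + a *: e + b *: f).
have wd b : b \in `[0, s] -> is_derive b 1 w (dw b).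
  rewrite in_itv /= => bs0; apply: (@line_is_derive _ (fun z => 'D_e G z)).
  by apply: dG2; exact: Wab.
have cw : {within `[0, s], continuous w}.
  apply: derivable_within_continuous => z Hz; by case: (wd z Hz).
have [b] := MVT s0 (fun z Hz => wd z (subset_itv_oo_cc Hz)) cw.
move=> /subset_itv_oo_cc; rewrite in_itv /= => bs0.
rewrite /w /u /du !scale0r !addr0 !subr0 => Ew Eu; exists a, b; split => //.
rewrite -/(dw b) -mulrA [s * dw b]mulrC -Ew.
rewrite [y + a *: e + _]addrAC mulrC -Eu [y + s *: e + _]addrAC.
by rewrite !opprD !opprK addrA.
Qed.

(** The second difference of [mvt_mixed] can be evaluated in either order; on small squares both
    mixed derivatives are then close to their values at [y], by continuity. *)
Lemma derive_comm m (W : set 'rV[R]_m) (G : 'rV[R]_m -> R) (y : 'rV[R]_m) (i j : 'I_m) :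
  open W -> W y -> Ck 2 W G ->
  'D_(evec R j) (fun z => 'D_(evec R i) G z) y =
  'D_(evec R i) (fun z => 'D_(evec R j) G z) y.
Proof.
move=> oW Wy HG.
have c1 a b : {for y, continuous (fun z => 'D_(evec R b) (fun z => 'D_(evec R a) G z) z)}.
  by have [_ /(_ a) [_ [_ /(_ b) [_ [H _]]]]] := HG; exact: H.
set P := 'D_(evec R j) _ y; set Q := 'D_(evec R i) _ y.
apply/eqP; rewrite -subr_eq0 -normr_eq0 -[_ == _]negbK normr_eq0 -normr_gt0 -leNgt.
apply/ler_addgt0Pr => eps eps0; rewrite add0r.
have e20 : 0 < eps / 2 by rewrite divr_gt0.
pose U1 := [set z | `|P - 'D_(evec R j) (fun z => 'D_(evec R i) G z) z| < eps / 2].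
pose U2 := [set z | `|Q - 'D_(evec R i) (fun z => 'D_(evec R j) G z) z| < eps / 2].
have n1 : nbhs y U1 by have /cvgr_dist_lt := c1 i j; apply.
have n2 : nbhs y U2 by have /cvgr_dist_lt := c1 j i; apply.
have nA : nbhs y (W `&` (U1 `&` U2)).
  by apply: filterI; [exact: open_nbhs_nbhs|exact: filterI].
have [d /= d0 dP] := (nbhs_ballP _ _).1 nA.
(* A side of a quarter of the radius displaces points by at most [d / 2], so the square stays in the
   ball. *)
have s0 : 0 < d / 4 by rewrite divr_gt0.
have B i' j' a b : 0 <= a <= d / 4 -> 0 <= b <= d / 4 ->
    ball y d (y + a *: evec R i' + b *: evec R j').
  move=> /andP[a0 a1] /andP[b0 b1]; rewrite mx_norm_ball /ball_ /=.
  rewrite -addrA opprD addNKr normrN (le_lt_trans (ler_normD _ _)) //.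
  rewrite !normrZ !ger0_norm //.
  have := ler_piMr a0 (evec_norm i'); have := ler_piMr b0 (evec_norm j').
  lra.
have [a [b [a1 b1 E1]]] := mvt_mixed s0 HG (fun a b ha hb => (dP _ (B i j a b ha hb)).1).
have [a' [b' [a2 b2 E2]]] := mvt_mixed s0 HG (fun a b ha hb => (dP _ (B j i a b ha hb)).1).
have E : 'D_(evec R j) (fun z => 'D_(evec R i) G z) (y + a *: evec R i + b *: evec R j) =
   'D_(evec R i) (fun z => 'D_(evec R j) G z) (y + a' *: evec R j + b' *: evec R i).
  have s1 : (d / 4) * (d / 4) != 0 by rewrite mulf_neq0 // gt_eqF.
  apply: (mulfI s1); apply: etrans (esym E1) _; apply: etrans _ E2.
  rewrite [y + _ *: evec R j + _]addrAC.
  move: (G (y + _ + _)) (G (y + _ *: evec R i)) (G (y + _ *: evec R j)) (G y) => p q r t.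
  by ring.
have [_ [H1 _]] := dP _ (B i j a b a1 b1).
have [_ [_ H2]] := dP _ (B j i a' b' a2 b2).
have key (p q X : R) : `|p - X| < eps / 2 -> `|q - X| < eps / 2 -> `|p - q| <= eps.
  move=> h1 h2; apply: le_trans (ler_distD X p q) _; rewrite (splitr eps).
  by apply: lerD; [exact: ltW|rewrite distrC; exact: ltW].
by rewrite /U1 /= E in H1; exact: key H1 H2.
Qed.

End RealCalculus.

(** * Smoothness up to the boundary *)

Section SmoothOn.
Variables (R : realType) (m : nat).
Implicit Types (A W : set 'rV[R]_m) (F G : 'rV[R]_m -> R).

(* On such a set the one-sided derivatives of Defs are determined. *)
Definition ropen A := forall y, A y -> forall i,
  \forall t \near 0^'+, A (y + t *: evec R i).

Lemma near_line W y (v : 'rV[R]_m) : open W -> W y ->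
  \forall t \near 0^'+, W (y + t *: v).
Proof.
move=> oW Wy; have := @evec_continuous R m v y 0.
rewrite /prop_for /continuous_at scale0r addr0 => /(_ W (open_nbhs_nbhs (conj oW Wy))) H.
have {}H : nbhs (0 : R) [set t | W (y + t *: v)] by [].
by apply: filterS H => t Wt _.
Qed.

Lemma open_ropen A : open A -> ropen A.
Proof. by move=> oA y Ay i; exact: near_line. Qed.

Lemma smooth_on_subset A B F : B `<=` A -> smooth_on A F -> smooth_on B F.
Proof.
move=> sBA sF y /sBA /sF[W [G [oW Wy CG E]]]; exists W, G; split=> // z /sBA; exact: E.
Qed.

Lemma smooth_on_ext A F G : (forall y, A y -> F y = G y) ->
  smooth_on A F -> smooth_on A G.
Proof.
move=> FG sF y /sF[W [H [oW Wy CH E]]]; exists W, H; split=> // z Az Wz.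
by rewrite E // FG.
Qed.

Lemma Ck_smooth_on A W F : open W -> A `<=` W -> (forall k, Ck k W F) -> smooth_on A F.
Proof. by move=> oW sAW CF y /sAW Wy; exists W, F; split. Qed.

Lemma pder_rep A W F G i y : ropen A -> open W ->
  (forall z, A z -> W z -> F z = G z) -> A y -> W y ->
  derivable G y (evec R i) -> pder i F y = 'D_(evec R i) G y.
Proof.
move=> rA oW FG Ay Wy dG; apply: pder_derive => //; last exact: FG.
near=> t; apply: FG; near: t; [exact: rA|exact: near_line].
Unshelve. all: by end_near. Qed.

(** A local extension [G] has ordinary derivatives, and these equal the one-sided derivatives of [F]
    at all nearby points of [A]. The rules for [pder] below are transported from [G] in this way. *)
Lemma smooth_onP A F y : ropen A -> smooth_on A F -> A y ->
  exists W G, [/\ open W, W y, forall k, Ck k W G,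
    forall z, A z -> W z -> F z = G z &
    forall z i, A z -> W z -> pder i F z = 'D_(evec R i) G z].
Proof.
move=> rA sF /sF[W [G [oW Wy CG E]]]; exists W, G; split=> //.
  by move=> z Az Wz; rewrite E.
move=> z i Az Wz; apply: (pder_rep rA oW) => //; first by move=> u Au Wu; rewrite E.
by have [_ /(_ i) [d _]] := CG 1%N; exact: d.
Qed.

Lemma smooth_on2P A F1 F2 y : ropen A -> smooth_on A F1 -> smooth_on A F2 -> A y ->
  exists W G1 G2, [/\ open W, W y,
    [/\ forall k, Ck k W G1, forall z, A z -> W z -> F1 z = G1 z &
    forall z i, A z -> W z -> pder i F1 z = 'D_(evec R i) G1 z] &
    [/\ forall k, Ck k W G2, forall z, A z -> W z -> F2 z = G2 z &
    forall z i, A z -> W z -> pder i F2 z = 'D_(evec R i) G2 z]].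
Proof.
move=> rA s1 s2 Ay.
have [W1 [G1 [ow1 W1y C1 E1 D1]]] := smooth_onP rA s1 Ay.
have [W2 [G2 [ow2 W2y C2 E2 D2]]] := smooth_onP rA s2 Ay.
exists (W1 `&` W2), G1, G2; split=> //; first exact: openI.
  split; first by move=> k; apply: Ck_subset (C1 k) => z [].
    by move=> z Az [z1 z2]; exact: E1.
  by move=> z i Az [z1 z2]; exact: D1.
split; first by move=> k; apply: Ck_subset (C2 k) => z [].
  by move=> z Az [z1 z2]; exact: E2.
by move=> z i Az [z1 z2]; exact: D2.
Qed.

Lemma Ck_derivable W G y i : (forall k, Ck k W G) -> W y -> derivable G y (evec R i).
Proof. by move=> CG Wy; have [_ /(_ i) [d _]] := CG 1%N; exact: d. Qed.

Lemma Ck_derive W G i : (forall k, Ck k W G) -> forall k, Ck k W ('D_(evec R i) G).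
Proof. by move=> CG k; have [_ /(_ i) [_ d]] := CG k.+1. Qed.

Lemma smooth_on_cst A a : smooth_on A (cst a).
Proof. by apply: (@Ck_smooth_on _ setT); [exact: openT| |move=> k; exact/Ck_cst/openT]. Qed.

Lemma smooth_on_op2 (op : R -> R -> R) A F G :
  (forall k W F G, open W -> Ck k W F -> Ck k W G -> Ck k W (fun y => op (F y) (G y))) ->
  smooth_on A F -> smooth_on A G -> smooth_on A (fun y => op (F y) (G y)).
Proof.
move=> Cop sF sG y Ay; have [W1 [G1 [ow1 W1y C1 E1]]] := sF y Ay.
have [W2 [G2 [ow2 W2y C2 E2]]] := sG y Ay.
exists (W1 `&` W2), (fun z => op (G1 z) (G2 z)); split=> //; first exact: openI.
  by move=> k; apply: Cop; [exact: openI|apply: Ck_subset (C1 k) => z []|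
    apply: Ck_subset (C2 k) => z []].
by move=> z Az [z1 z2]; rewrite E1 // E2.
Qed.

Lemma smooth_onD A F G : smooth_on A F -> smooth_on A G ->
  smooth_on A (fun y => F y + G y).
Proof. by apply: smooth_on_op2 => *; exact: CkD. Qed.

Lemma smooth_onM A F G : smooth_on A F -> smooth_on A G ->
  smooth_on A (fun y => F y * G y).
Proof. by apply: smooth_on_op2 => *; exact: CkM. Qed.

Lemma smooth_onN A F : smooth_on A F -> smooth_on A (fun y => - F y).
Proof.
move=> sF; apply: smooth_on_ext (smooth_onM (@smooth_on_cst A (-1)) sF) => y _.
by rewrite mulN1r.
Qed.

Lemma smooth_onB A F G : smooth_on A F -> smooth_on A G ->
  smooth_on A (fun y => F y - G y).
Proof. by move=> sF sG; exact/smooth_onD/smooth_onN. Qed.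

Lemma smooth_on_big (op : R -> R -> R) idx A (I : Type) (r : seq I) (P : pred I)
    (F : I -> 'rV[R]_m -> R) :
  (forall F G, smooth_on A F -> smooth_on A G -> smooth_on A (fun y => op (F y) (G y))) ->
  (forall i, P i -> smooth_on A (F i)) ->
  smooth_on A (fun y => \big[op/idx]_(i <- r | P i) F i y).
Proof.
move=> sop sF; elim: r => [|i r IH].
  by apply: smooth_on_ext (@smooth_on_cst A idx) => y _; rewrite big_nil.
case: (boolP (P i)) => Pi; last first.
  by apply: smooth_on_ext IH => y _; rewrite big_cons (negbTE Pi).
by apply: smooth_on_ext (sop _ _ (sF i Pi) IH) => y _; rewrite big_cons Pi.
Qed.

Lemma smooth_on_sum A (I : Type) (r : seq I) (P : pred I) (F : I -> 'rV[R]_m -> R) :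
  (forall i, P i -> smooth_on A (F i)) -> smooth_on A (fun y => \sum_(i <- r | P i) F i y).
Proof. by apply: smooth_on_big => *; exact: smooth_onD. Qed.

Lemma smooth_on_prod A (I : Type) (r : seq I) (P : pred I) (F : I -> 'rV[R]_m -> R) :
  (forall i, P i -> smooth_on A (F i)) -> smooth_on A (fun y => \prod_(i <- r | P i) F i y).
Proof. by apply: smooth_on_big => *; exact: smooth_onM. Qed.

Lemma smooth_on_powR A F a : (forall y, A y -> 0 < F y) -> smooth_on A F ->
  smooth_on A (fun y => F y `^ a).
Proof.
move=> F0 sF y Ay; have [W [G [oW Wy CG E]]] := sF y Ay.
have cG : {for y, continuous G} by have [H _] := CG 0%N; exact: H.
have : nbhs y (W `&` [set z | 0 < G z]).
  apply: filterI; first exact: open_nbhs_nbhs.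
  by apply: (cG [set t | 0 < t]); apply: lt_nbhsr; rewrite E // F0.
rewrite nbhsE => -[W' [oW' W'y] sW'].
exists W', (fun z => G z `^ a); split=> //; last first.
  by move=> z Az /sW'[Wz _]; rewrite E.
move=> k; apply: Ck_powR => //; first by move=> z /sW'[].
by apply: Ck_subset (CG k) => z /sW'[].
Qed.

Lemma smooth_on_inv A F : (forall y, A y -> 0 < F y) -> smooth_on A F ->
  smooth_on A (fun y => (F y)^-1).
Proof.
move=> F0 sF; apply: smooth_on_ext (smooth_on_powR (-1) F0 sF) => y Ay.
by rewrite powR_inv1 // ltW // F0.
Qed.

Lemma smooth_on_sqrt A F : (forall y, A y -> 0 < F y) -> smooth_on A F ->
  smooth_on A (fun y => Num.sqrt (F y)).
Proof.
move=> F0 sF; apply: smooth_on_ext (smooth_on_powR (2^-1) F0 sF) => y Ay.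
by rewrite powR12_sqrt // ltW // F0.
Qed.

Lemma coord_derive (i j : 'I_m) (y : 'rV[R]_m) :
  is_derive y (evec R i) (fun z : 'rV[R]_m => z 0 j) (i == j)%:R.
Proof.
pose q (h : R) := h^-1 *: (((fun z : 'rV[R]_m => z 0 j) \o shift y) (h *: evec R i) - y 0 j).
have nE : \forall h \near (0 : R)^', ((i == j)%:R : R) = q h.
  near=> h; rewrite /q /= !mxE eqxx /= addrK [j == i]eq_sym [RHS]mulrA mulVf ?mul1r //.
  by near: h; exact: nbhs_dnbhs_neq.
have E : q @ 0^' --> ((i == j)%:R : R).
  by apply: (cvg_trans (near_eq_cvg nE)); exact: cvg_cst.
by apply: DeriveDef; [apply/cvg_ex; exists (i == j)%:R|exact: cvg_lim].
Unshelve. all: by end_near. Qed.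

Lemma Ck_coord k j : Ck k setT (fun y : 'rV[R]_m => y 0 j).
Proof.
have cc : forall y : 'rV[R]_m, setT y -> {for y, continuous (fun y : 'rV[R]_m => y 0 j)}.
  by move=> y _; exact: coord_continuous.
case: k => [|k]; split=> // i; split=> [y _|]; first by have [] := coord_derive i j y.
apply: Ck_ext (Ck_cst k (i == j)%:R openT); first exact: openT.
by move=> y _; have [_ ->] := coord_derive i j y.
Qed.

Lemma smooth_on_coord A j : smooth_on A (fun y : 'rV[R]_m => y 0 j).
Proof. by apply: (@Ck_smooth_on _ setT); [exact: openT| |move=> k; exact: Ck_coord]. Qed.

Lemma smooth_on_pder A F i : ropen A -> smooth_on A F -> smooth_on A (pder i F).
Proof.
move=> rA sF y Ay; have [W [G [oW Wy CG E D]]] := smooth_onP rA sF Ay.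
exists W, ('D_(evec R i) G); split=> //; first exact: Ck_derive.
by move=> z Az Wz; rewrite D.
Qed.

Lemma pder_ext A F G i y : ropen A -> (forall y, A y -> F y = G y) -> A y ->
  pder i F y = pder i G y.
Proof.
move=> rA FG Ay; rewrite /pder /rder.
pose q (H : 'rV[R]_m -> R) (t : R) := t^-1 * (H (y + (0 + t) *: evec R i) - H (y + 0 *: evec R i)).
rewrite -/(q F) -/(q G).
have nE : \forall t \near 0^'+, q F t = q G t.
  near=> t; have At : A (y + t *: evec R i) by near: t; exact: rA.
  by rewrite /q !scale0r !addr0 add0r !FG.
have nE' : \forall t \near 0^'+, q G t = q F t by apply: filterS nE => t ->.
congr (lim _); rewrite eqEsubset; split; [exact: (near_eq_cvg nE)|exact: (near_eq_cvg nE')].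
Unshelve. all: by end_near. Qed.

Lemma pder_cst A a i y : ropen A -> A y -> pder i (cst a) y = 0.
Proof.
move=> rA Ay.
by rewrite (pder_rep (G := cst a) rA openT _ Ay I (derivable_cst _ _ _)) // derive_cst.
Qed.

Lemma pderD A F G i y : ropen A -> smooth_on A F -> smooth_on A G -> A y ->
  pder i (fun y => F y + G y) y = pder i F y + pder i G y.
Proof.
move=> rA sF sG Ay.
have [W [G1 [G2 [oW Wy [C1 E1 D1] [C2 E2 D2]]]]] := smooth_on2P rA sF sG Ay.
have d1 : derivable G1 y (evec R i) := Ck_derivable C1 Wy.
have d2 : derivable G2 y (evec R i) := Ck_derivable C2 Wy.
rewrite (pder_rep (G := G1 + G2) rA oW _ Ay Wy (derivableD d1 d2)).
  by rewrite deriveD // D1 // D2.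
by move=> z Az Wz; rewrite E1 // E2.
Qed.

Lemma pderM A F G i y : ropen A -> smooth_on A F -> smooth_on A G -> A y ->
  pder i (fun y => F y * G y) y = pder i F y * G y + F y * pder i G y.
Proof.
move=> rA sF sG Ay.
have [W [G1 [G2 [oW Wy [C1 E1 D1] [C2 E2 D2]]]]] := smooth_on2P rA sF sG Ay.
have d1 : derivable G1 y (evec R i) := Ck_derivable C1 Wy.
have d2 : derivable G2 y (evec R i) := Ck_derivable C2 Wy.
rewrite (pder_rep (G := G1 * G2) rA oW _ Ay Wy (derivableM d1 d2)).
  rewrite (deriveM d1 d2) (D1 _ _ Ay Wy) (D2 _ _ Ay Wy) (E1 _ Ay Wy) (E2 _ Ay Wy).
  by rewrite addrC [G2 y *: _]mulrC.
by move=> z Az Wz; rewrite E1 // E2.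
Qed.

Lemma pderC A F i j y : ropen A -> smooth_on A F -> A y ->
  pder i (pder j F) y = pder j (pder i F) y.
Proof.
move=> rA sF Ay; have [W [G [oW Wy CG E D]]] := smooth_onP rA sF Ay.
have H a b : pder a (pder b F) y = 'D_(evec R a) ('D_(evec R b) G) y.
  have d : derivable ('D_(evec R b) G) y (evec R a).
    by have [_ /(_ a) [d _]] := Ck_derive b CG 1%N; exact: d.
  by apply: (pder_rep rA oW _ Ay Wy d) => z Az Wz; rewrite D.
by rewrite !H; exact: derive_comm oW Wy (CG 2).
Qed.

Lemma pder_comp A F (g : R -> R) d i y : ropen A -> smooth_on A F -> A y ->
  is_derive (F y) 1 g d -> pder i (fun z => g (F z)) y = d * pder i F y.
Proof.
move=> rA sF Ay; have [W [G [oW Wy CG E D]]] := smooth_onP rA sF Ay.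
rewrite E // D // => dg; have dG : derivable G y (evec R i) := Ck_derivable CG Wy.
have [H1 H2] := is_derive_line_comp dG dg.
by rewrite (pder_rep rA oW _ Ay Wy H1) // => z Az Wz; rewrite E.
Qed.

Lemma pder_coord A i j y : ropen A -> A y -> pder i (fun z => z 0 j) y = (i == j)%:R.
Proof.
move=> rA Ay; have [d e] := coord_derive i j y.
by rewrite (pder_rep rA openT _ Ay I d).
Qed.

End SmoothOn.

(** * Complex-valued functions, by real and imaginary parts *)

Section ComplexParts.
Variable R : realType.
Implicit Types z w : R[i].

Lemma complexP z w : complex.Re z = complex.Re w -> complex.Im z = complex.Im w -> z = w.
Proof. by case: z => a b; case: w => c d /= -> ->. Qed.

Lemma cReD z w : complex.Re (z + w) = complex.Re z + complex.Re w.
Proof. by case: z; case: w. Qed.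
Lemma cImD z w : complex.Im (z + w) = complex.Im z + complex.Im w.
Proof. by case: z; case: w. Qed.
Lemma cReM z w : complex.Re (z * w) = complex.Re z * complex.Re w - complex.Im z * complex.Im w.
Proof. by case: z; case: w. Qed.
Lemma cImM z w : complex.Im (z * w) = complex.Re z * complex.Im w + complex.Im z * complex.Re w.
Proof. by case: z; case: w. Qed.
End ComplexParts.

Section ComplexSmooth.
Variables (R : realType) (m : nat).
Implicit Types (A : set 'rV[R]_m) (F : 'rV[R]_m -> R) (u v : 'rV[R]_m -> R[i]).

Definition csm A u := smooth_on A (fun y => complex.Re (u y)) /\
  smooth_on A (fun y => complex.Im (u y)).

Definition cpd (i : 'I_m) u := cx (pder i) u.

Lemma csm_subset A B u : B `<=` A -> csm A u -> csm B u.
Proof. by move=> sBA [s1 s2]; split; exact: smooth_on_subset sBA _. Qed.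

Lemma csm_ext A u v : (forall y, A y -> u y = v y) -> csm A u -> csm A v.
Proof. by move=> E [s1 s2]; split; [apply: smooth_on_ext s1|apply: smooth_on_ext s2] => y Ay; rewrite E. Qed.

Lemma csm_real A F : smooth_on A F -> csm A (fun y => (F y)%:C).
Proof. by move=> sF; split=> //=; exact: smooth_on_cst. Qed.

Lemma csm_cst A a : csm A (cst a).
Proof. by split; exact: smooth_on_cst. Qed.

Lemma csmD A u v : csm A u -> csm A v -> csm A (fun y => u y + v y).
Proof.
move=> [u1 u2] [v1 v2]; split.
  by apply: smooth_on_ext (smooth_onD u1 v1) => y _; rewrite cReD.
by apply: smooth_on_ext (smooth_onD u2 v2) => y _; rewrite cImD.
Qed.

Lemma csmM A u v : csm A u -> csm A v -> csm A (fun y => u y * v y).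
Proof.
move=> [u1 u2] [v1 v2]; split.
  by apply: smooth_on_ext (smooth_onB (smooth_onM u1 v1) (smooth_onM u2 v2)) => y _; rewrite cReM.
by apply: smooth_on_ext (smooth_onD (smooth_onM u1 v2) (smooth_onM u2 v1)) => y _; rewrite cImM.
Qed.

Lemma csmZ A a u : csm A u -> csm A (fun y => a * u y).
Proof. by move=> su; exact: csmM (csm_cst A a) su. Qed.

Lemma csmN A u : csm A u -> csm A (fun y => - u y).
Proof. by move=> su; apply: csm_ext (csmZ (-1) su) => y _; rewrite mulN1r. Qed.

Lemma csmB A u v : csm A u -> csm A v -> csm A (fun y => u y - v y).
Proof. by move=> su sv; exact/csmD/csmN. Qed.

Lemma csm_sum A (I : Type) (r : seq I) (P : pred I) (F : I -> 'rV[R]_m -> R[i]) :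
  (forall i, P i -> csm A (F i)) -> csm A (fun y => \sum_(i <- r | P i) F i y).
Proof.
move=> sF; elim: r => [|i r IH].
  by apply: csm_ext (csm_cst A 0) => y _; rewrite big_nil.
case: (boolP (P i)) => Pi; last first.
  by apply: csm_ext IH => y _; rewrite big_cons (negbTE Pi).
by apply: csm_ext (csmD (sF i Pi) IH) => y _; rewrite big_cons Pi.
Qed.

Lemma csmX A u k : csm A u -> csm A (fun y => u y ^+ k).
Proof.
move=> su; elim: k => [|k IH].
  by apply: csm_ext (csm_cst A 1) => y _; rewrite expr0.
by apply: csm_ext (csmM su IH) => y _; rewrite exprS.
Qed.

Lemma csm_cpd A i u : ropen A -> csm A u -> csm A (cpd i u).
Proof. by move=> rA [u1 u2]; split; exact: smooth_on_pder. Qed.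

Lemma cpd_ext A i u v y : ropen A -> (forall y, A y -> u y = v y) -> A y ->
  cpd i u y = cpd i v y.
Proof.
move=> rA E Ay; apply: complexP => /=.
  by apply: (pder_ext i rA _ Ay) => z Az; rewrite E.
by apply: (pder_ext i rA _ Ay) => z Az; rewrite E.
Qed.

Lemma cpd_cst A i a y : ropen A -> A y -> cpd i (cst a) y = 0.
Proof.
move=> rA Ay; rewrite /cpd /cx.
by rewrite [pder i _ y](pder_cst (A := A)) // [X in _ +i* X](pder_cst (A := A)).
Qed.

Lemma cpd_real i F y : cpd i (fun y => (F y)%:C) y = (pder i F y)%:C.
Proof.
apply: complexP => //=.
have := @pder_cst R m setT 0 i y (open_ropen openT) I.
by [].
Qed.

Lemma cpdD A i u v y : ropen A -> csm A u -> csm A v -> A y ->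
  cpd i (fun y => u y + v y) y = cpd i u y + cpd i v y.
Proof.
move=> rA [u1 u2] [v1 v2] Ay; apply: complexP => /=.
  rewrite -(pderD i rA u1 v1 Ay); apply: (pder_ext i rA _ Ay) => z _; exact: cReD.
rewrite -(pderD i rA u2 v2 Ay); apply: (pder_ext i rA _ Ay) => z _; exact: cImD.
Qed.

Lemma cpdM A i u v y : ropen A -> csm A u -> csm A v -> A y ->
  cpd i (fun y => u y * v y) y = cpd i u y * v y + u y * cpd i v y.
Proof.
move=> rA [u1 u2] [v1 v2] Ay; apply: complexP.
  rewrite cReD !cReM /=.
  transitivity (pder i (fun y => complex.Re (u y) * complex.Re (v y)
    + (-1) * (complex.Im (u y) * complex.Im (v y))) y).
    by apply: (pder_ext i rA _ Ay) => z _; rewrite cReM mulN1r.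
  have s := smooth_onM u2 v2.
  rewrite (pderD i rA (smooth_onM u1 v1) (smooth_onM (@smooth_on_cst _ _ _ (-1)) s) Ay).
  rewrite (pderM i rA (@smooth_on_cst _ _ _ (-1)) s Ay) (pder_cst _ _ rA Ay).
  by rewrite (pderM i rA u1 v1 Ay) (pderM i rA u2 v2 Ay) /=; ring.
rewrite cImD !cImM /=.
transitivity (pder i (fun y => complex.Re (u y) * complex.Im (v y)
    + complex.Im (u y) * complex.Re (v y)) y).
  by apply: (pder_ext i rA _ Ay) => z _; rewrite cImM.
rewrite (pderD i rA (smooth_onM u1 v2) (smooth_onM u2 v1) Ay).
by rewrite (pderM i rA u1 v2 Ay) (pderM i rA u2 v1 Ay); ring.
Qed.

Lemma cpdZ A i a u y : ropen A -> csm A u -> A y ->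
  cpd i (fun y => a * u y) y = a * cpd i u y.
Proof.
move=> rA su Ay.
by rewrite (cpdM i rA (csm_cst A a) su Ay) (cpd_cst _ _ rA Ay) mul0r add0r.
Qed.

Lemma cpdN A i u y : ropen A -> csm A u -> A y -> cpd i (fun y => - u y) y = - cpd i u y.
Proof.
move=> rA su Ay; rewrite -mulN1r -(cpdZ i _ rA su Ay).
by apply: (cpd_ext i rA _ Ay) => z _; rewrite mulN1r.
Qed.

Lemma cpdB A i u v y : ropen A -> csm A u -> csm A v -> A y ->
  cpd i (fun y => u y - v y) y = cpd i u y - cpd i v y.
Proof. by move=> rA su sv Ay; rewrite (cpdD i rA su (csmN sv) Ay) (cpdN i rA sv Ay). Qed.

Lemma cpdC A i j u y : ropen A -> csm A u -> A y ->
  cpd i (cpd j u) y = cpd j (cpd i u) y.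
Proof. by move=> rA [u1 u2] Ay; rewrite /cpd /cx (pderC i j rA u1 Ay) (pderC i j rA u2 Ay). Qed.

End ComplexSmooth.

(** * Taylor coefficients at the boundary *)

Section AffineSubstitution.
Variables (R : realType) (m m' : nat).
Variables (L : 'rV[R]_m -> 'rV[R]_m') (s : 'I_m -> option 'I_m').
Hypothesis cL : continuous L.
Hypothesis LE : forall i (y : 'rV[R]_m) (h : R),
  L (y + h *: evec R i) = L y + (if s i is Some j then h *: evec R j else 0).

(** By [LE], [L] sends a coordinate direction to a coordinate direction or, when [s i] is [None], to
    zero; difference quotients of [G \o L] are therefore those of [G], or vanish. This covers both
    the restriction to [r = 0] and the pullback along [xcoord]. *)
Lemma Ck_affine k (W : set 'rV[R]_m') (G : 'rV[R]_m' -> R) :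
  open W -> Ck k W G -> Ck k (L @^-1` W) (G \o L).
Proof.
move=> oW.
have E (H : 'rV[R]_m' -> R) i y v : v = (if s i is Some j then evec R j else 0) ->
    (fun h : R => h^-1 *: (((H \o L) \o shift y) (h *: evec R i) - (H \o L) y)) =
    (fun h : R => h^-1 *: ((H \o shift (L y)) (h *: v) - H (L y))).
  move=> ->; apply/funext => h /=; rewrite [_ + y]addrC LE [L y + _]addrC.
  by case: (s i) => // ; rewrite scaler0.
have C (H : 'rV[R]_m' -> R) : (forall y, W y -> {for y, continuous H}) ->
    forall y, (L @^-1` W) y -> {for y, continuous (H \o L)}.
  by move=> cH y Wy; apply: continuous_comp; [exact: cL|exact: cH].
elim: k G => [|k IH] G HG; split.
- by apply: C; exact: HG.1.
- by [].
- by apply: C; exact: HG.1.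
move=> i; case si : (s i) => [j|].
  have [d1 d2] := HG.2 j; split=> [y Wy|].
    rewrite /derivable (E G i y (evec R j)) ?si //; exact: d1.
  have -> : (fun y => 'D_(evec R i) (G \o L) y) = (fun y => 'D_(evec R j) G y) \o L.
    by apply/funext => y; rewrite /= /derive (E G i y (evec R j)) ?si.
  exact: IH d2.
split=> [y Wy|].
  by rewrite /derivable (E G i y 0) ?si //; apply: derivable0.
have -> : (fun y => 'D_(evec R i) (G \o L) y) = cst 0.
  by apply/funext => y; rewrite /derive (E G i y 0) ?si //; exact: derive0.
by apply: Ck_cst; apply: open_comp => // y _; exact: cL.
Qed.

Lemma smooth_on_affine A B (G : 'rV[R]_m' -> R) : smooth_on A G ->
  (forall y, B y -> A (L y)) -> smooth_on B (G \o L).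
Proof.
move=> sG BA y /BA /sG[W [H [oW Wy CH E]]]; exists (L @^-1` W), (H \o L); split=> //.
- by apply: open_comp => // z _; exact: cL.
- by move=> k; apply: Ck_affine oW (CH k).
by move=> z /BA Az Wz /=; rewrite E.
Qed.

End AffineSubstitution.

(** * Cylinders over coordinate domains *)

Section Cylinder.
Variables (R : realType) (n : nat) (eps : R) (U : set 'rV[R]_n).
Hypotheses (eps0 : 0 < eps) (oU : open U).

(** For [U = img c] this is [collar eps c]. A general [U] is allowed because support arguments also
    use the cylinder over [img c] minus a compact set. *)
Definition cyl : set 'rV[R]_(1 + n) := [set y | 0 <= rcoord y < eps /\ U (xcoord y)].

Definition i_x (j : 'I_n) : 'I_(1 + n) := rshift 1 j.

Lemma rcoord_pt r (x : 'rV[R]_n) : rcoord (pt r x) = r.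
Proof. by rewrite /rcoord /pt row_mxKl mxE eqxx. Qed.

Lemma xcoord_pt r (x : 'rV[R]_n) : xcoord (pt r x) = x.
Proof. by rewrite /xcoord /pt row_mxKr. Qed.

Lemma pt_coord (y : 'rV[R]_(1 + n)) : pt (rcoord y) (xcoord y) = y.
Proof.
rewrite /pt -[RHS]hsubmxK; congr row_mx.
by apply/rowP => i; rewrite !ord1 /rcoord mxE eqxx.
Qed.

Lemma evec_r : evec R (i_r n) = pt 1 (0 : 'rV[R]_n).
Proof.
apply/rowP => k; rewrite /pt !mxE eqxx /=; case: (split_ordP k) => j ->; rewrite !mxE.
  by rewrite !ord1 !eqxx.
by rewrite eq_rlshift.
Qed.

Lemma evec_x j : evec R (i_x j) = pt 0 (evec R j).
Proof.
apply/rowP => k; rewrite /pt !mxE eqxx /=; case: (split_ordP k) => l ->; rewrite !mxE.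
  by rewrite mul0rn eq_lrshift.
by rewrite eqxx eq_rshift.
Qed.

Lemma ptD r s (x z : 'rV[R]_n) : pt r x + pt s z = pt (r + s) (x + z).
Proof. by rewrite /pt add_row_mx raddfD. Qed.

Lemma ptZ a r (x : 'rV[R]_n) : a *: pt r x = pt (a * r) (a *: x).
Proof. by rewrite /pt scale_row_mx scale_scalar_mx. Qed.

Lemma pt_evec_r r t (x : 'rV[R]_n) : pt r x + t *: evec R (i_r n) = pt (r + t) x.
Proof. by rewrite evec_r ptZ ptD mulr1 scaler0 addr0. Qed.

Lemma pt_evec_x r t (x : 'rV[R]_n) j :
  pt r x + t *: evec R (i_x j) = pt r (x + t *: evec R j).
Proof. by rewrite evec_x ptZ ptD mulr0 addr0. Qed.

Lemma idx_case (i : 'I_(1 + n)) : i = i_r n \/ exists j, i = i_x j.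
Proof.
case: (split_ordP i) => [j ->|j ->]; last by right; exists j.
by left; rewrite ord1.
Qed.

Lemma cyl_pt r x : cyl (pt r x) <-> 0 <= r < eps /\ U x.
Proof. by rewrite /cyl /= rcoord_pt xcoord_pt. Qed.

Lemma cyl0 x : U x -> cyl (pt 0 x).
Proof. by move=> Ux; apply/cyl_pt; rewrite lexx eps0. Qed.

Lemma ropen_cyl : ropen cyl.
Proof.
move=> y; rewrite -(pt_coord y); move: (rcoord y) (xcoord y) => r x.
move=> /cyl_pt[/andP[r0 r1] Ux] i; case: (idx_case i) => [->|[j ->]].
  near=> t; rewrite pt_evec_r; apply/cyl_pt; split=> //; apply/andP; split.
    by apply: addr_ge0.
  rewrite -ltrBrDl; near: t; apply: nbhs_right_lt; by rewrite subr_gt0.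
near=> t; rewrite pt_evec_x; apply/cyl_pt; split; first by rewrite r0.
by near: t; exact: near_line.
Unshelve. all: by end_near. Qed.

Lemma xcoord_continuous : continuous (@xcoord R n).
Proof. exact: continuous_rsubmx. Qed.

Lemma rcoord_continuous : continuous (@rcoord R n).
Proof.
have -> : @rcoord R n = (fun y => y 0 (i_r n)) by apply/funext => y; rewrite /rcoord mxE.
exact: coord_continuous.
Qed.

Lemma pt_continuous r : continuous (fun x : 'rV[R]_n => pt r x).
Proof.
move=> x A /nbhs_ballP[e e0 xeA]; apply/nbhs_ballP; exists e => // z [_ xz].
apply: xeA; split=> // i j.
by rewrite /pt !mxE; case: splitP => k _; [exact: ballxx|exact: xz].
Qed.

Definition trace0 (T : Type) (u : 'rV[R]_(1 + n) -> T) (x : 'rV[R]_n) : T := u (pt 0 x).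

Lemma smooth_on_trace0 F : smooth_on cyl F -> smooth_on U (trace0 F).
Proof.
move=> sF; apply: (smooth_on_affine (s := fun j => Some (i_x j)) _ _ sF).
- exact: pt_continuous.
- by move=> i y h; rewrite pt_evec_x.
exact: cyl0.
Qed.

Lemma smooth_on_xcoord F : smooth_on U F -> smooth_on cyl (F \o @xcoord R n).
Proof.
move=> sF.
pose s (i : 'I_(1 + n)) := match fintype.split i with inl _ => None | inr j => Some j end.
apply: (@smooth_on_affine _ _ _ (@xcoord R n) s _ _ U) => //.
- exact: xcoord_continuous.
- move=> i y h; rewrite -(pt_coord y) /s; case: (idx_case i) => [->|[j ->]].
    rewrite pt_evec_r !xcoord_pt /i_r.
    by case: split_ordP => k /eqP; rewrite ?eq_lrshift ?addr0.
  rewrite pt_evec_x !xcoord_pt /i_x; case: split_ordP => k /eqP.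
    by rewrite eq_rlshift.
  by rewrite eq_rshift => /eqP ->.
by move=> y [].
Qed.

Lemma csm_trace0 u : csm cyl u -> csm U (trace0 u).
Proof. by move=> [s1 s2]; split; [exact: (smooth_on_trace0 s1)|exact: (smooth_on_trace0 s2)]. Qed.

Lemma csm_xcoord u : csm U u -> csm cyl (u \o @xcoord R n).
Proof. by move=> [s1 s2]; split; [exact: (smooth_on_xcoord s1)|exact: (smooth_on_xcoord s2)]. Qed.

Lemma csm_rcoord : csm cyl (fun y => (rcoord y)%:C).
Proof.
apply: csm_real; apply: smooth_on_ext (@smooth_on_coord R _ cyl (i_r n)) => y _.
by rewrite /rcoord mxE.
Qed.

Lemma pder_x_pt (F : 'rV[R]_(1 + n) -> R) j r x :
  pder (i_x j) F (pt r x) = pder j (fun x => F (pt r x)) x.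
Proof.
rewrite /pder.
have -> // : (fun t => F (pt r x + t *: evec R (i_x j))) = fun t => F (pt r (x + t *: evec R j)).
by apply/funext => t; rewrite pt_evec_x.
Qed.

Lemma pder_r_pt (F : 'rV[R]_(1 + n) -> R) r x :
  pder (i_r n) F (pt r x) = rder (fun r => F (pt r x)) r.
Proof.
rewrite /pder /rder.
set q1 := (X in lim (X @ _) = _); set q2 := (X in _ = lim (X @ _)).
have -> // : q1 = q2.
by apply/funext => t; rewrite /q1 /q2 !pt_evec_r add0r addr0.
Qed.

Lemma cpd_x_pt (u : 'rV[R]_(1 + n) -> R[i]) j r x : cpd (i_x j) u (pt r x) = cpd j (fun x => u (pt r x)) x.
Proof. by rewrite /cpd /cx !pder_x_pt. Qed.

Lemma rder_cst (a r : R) : rder (fun=> a) r = 0.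
Proof.
rewrite /rder (_ : (fun t => _) = cst 0); first exact: lim_cst.
by apply/funext => t; rewrite subrr mulr0.
Qed.

Lemma cpd_r_xcoord (u : 'rV[R]_n -> R[i]) y : cpd (i_r n) (u \o @xcoord R n) y = 0.
Proof.
rewrite -[in LHS](pt_coord y) /cpd /cx !pder_r_pt /=.
have E (g : 'rV[R]_n -> R) : (fun r => g (xcoord (pt r (xcoord y)))) = fun=> g (xcoord y).
  by apply/funext => r; rewrite xcoord_pt.
by rewrite (E (fun z => complex.Re (u z))) (E (fun z => complex.Im (u z))) !rder_cst.
Qed.

Lemma cpd_r_rcoord y : cyl y -> cpd (i_r n) (fun y => (rcoord y)%:C) y = 1.
Proof.
move=> Cy; rewrite cpd_real (pder_ext (A := cyl) (G := fun y => y 0 (i_r n))) //.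
- by rewrite (pder_coord _ _ ropen_cyl Cy) eqxx.
- exact: ropen_cyl.
by move=> z _; rewrite /rcoord mxE.
Qed.

Lemma cpd_x_rcoord j y : cyl y -> cpd (i_x j) (fun y => (rcoord y)%:C) y = 0.
Proof.
move=> Cy; rewrite cpd_real (pder_ext (A := cyl) (G := fun y => y 0 (i_r n))) //.
- by rewrite (pder_coord _ _ ropen_cyl Cy) /i_r /i_x eq_rlshift.
- exact: ropen_cyl.
by move=> z _; rewrite /rcoord mxE.
Qed.

End Cylinder.

Section Taylor.
Variables (R : realType) (n : nat) (eps : R) (U : set 'rV[R]_n).
Hypotheses (eps0 : 0 < eps) (oU : open U).
Implicit Types u v : 'rV[R]_(1 + n) -> R[i].
Local Notation C := (cyl eps U).
Local Notation dr := (cpd (i_r n)).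
Local Notation dx j := (cpd (i_x j)).
Let rC : ropen C := ropen_cyl oU.

Lemma csm_iter k i u : csm C u -> csm C (iter k (cpd i) u).
Proof. by move=> su; elim: k => //= k IH; exact: csm_cpd. Qed.

Lemma iter_cpd_ext k i u v : (forall y, C y -> u y = v y) ->
  forall y, C y -> iter k (cpd i) u y = iter k (cpd i) v y.
Proof. by move=> E; elim: k => //= k IH y Cy; exact: (cpd_ext i rC IH Cy). Qed.

Definition tc k u (x : 'rV[R]_n) : R[i] := iter k dr u (pt 0 x) / k`!%:R.

Lemma tc0 u x : tc 0 u x = u (pt 0 x).
Proof. by rewrite /tc /= fact0 divr1. Qed.

Lemma tc_dr k u x : tc k (dr u) x = k.+1%:R * tc k.+1 u x.
Proof.
by rewrite /tc -iterSr factS natrM invfM [RHS]mulrCA mulVKf // pnatr_eq0.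
Qed.

Lemma tc_ext k u v x : (forall y, C y -> u y = v y) -> U x -> tc k u x = tc k v x.
Proof. by move=> E Ux; rewrite /tc (iter_cpd_ext k _ E) //; exact: cyl0. Qed.

Lemma csm_tc k u : csm C u -> csm U (tc k u).
Proof.
move=> su; apply: csm_ext (csmZ k`!%:R^-1 (csm_trace0 eps0 (csm_iter k (i_r n) su))).
by move=> x Ux; rewrite /tc mulrC.
Qed.

Lemma tcD k u v x : csm C u -> csm C v -> U x ->
  tc k (fun y => u y + v y) x = tc k u x + tc k v x.
Proof.
move=> su sv Ux; rewrite /tc -mulrDl; congr (_ / _).
suff : forall y, C y -> iter k dr (fun y => u y + v y) y = iter k dr u y + iter k dr v y.
  by apply; exact: cyl0.
elim: k => //= k IH y Cy; rewrite (cpd_ext _ rC IH Cy).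
by apply: (cpdD _ rC) => //; exact: csm_iter.
Qed.

Lemma tcZ k a u x : csm C u -> U x -> tc k (fun y => a * u y) x = a * tc k u x.
Proof.
move=> su Ux; rewrite /tc mulrA; congr (_ / _).
suff : forall y, C y -> iter k dr (fun y => a * u y) y = a * iter k dr u y.
  by apply; exact: cyl0.
elim: k => //= k IH y Cy; rewrite (cpd_ext _ rC IH Cy).
by apply: (cpdZ _ _ rC) => //; exact: csm_iter.
Qed.

Lemma tc_cst k a x : U x -> tc k (cst a) x = if k == 0%N then a else 0.
Proof.
move=> Ux; case: k => [|k]; first by rewrite tc0.
have E y : C y -> iter k.+1 dr (cst a) y = 0.
  elim: k y => [|k IH] y Cy; first by rewrite /= (cpd_cst _ _ rC Cy).
  by rewrite iterS (cpd_ext _ rC (v := cst 0) IH Cy) (cpd_cst _ _ rC Cy).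
by rewrite /tc E ?mul0r //; exact: cyl0.
Qed.

Lemma tc_sum k (I : Type) (r : seq I) (P : pred I) (F : I -> 'rV[R]_(1 + n) -> R[i]) x :
  (forall i, P i -> csm C (F i)) -> U x ->
  tc k (fun y => \sum_(i <- r | P i) F i y) x = \sum_(i <- r | P i) tc k (F i) x.
Proof.
move=> sF Ux; elim: r => [|i r IH].
  rewrite big_nil (tc_ext _ (v := cst 0)) // ?tc_cst //; first by case: ifP.
  by move=> y _; rewrite big_nil.
rewrite big_cons; case: (boolP (P i)) => Pi; last first.
  by rewrite -IH; apply: tc_ext => // y _; rewrite big_cons (negbTE Pi).
rewrite -IH -tcD //; [|exact: sF|exact: csm_sum].
by apply: tc_ext => // y _; rewrite big_cons Pi.
Qed.

(** Induction through [tc_dr]: by the Leibniz rule the term with index [a] acquires the weights [a]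
    and [k.+1 - a], whose sum is the factor [k.+1] to be cancelled. *)
Lemma tcM k u v x : csm C u -> csm C v -> U x ->
  tc k (fun y => u y * v y) x = \sum_(a < k.+1) tc a u x * tc (k - a) v x.
Proof.
move=> su sv Ux; elim: k u v su sv => [|k IH] u v su sv.
  by rewrite big_ord1 !tc0.
have /mulfI I : (k.+1%:R : R[i]) != 0 by rewrite pnatr_eq0.
apply: I; rewrite -tc_dr.
rewrite (tc_ext _ (v := fun y => dr u y * v y + u y * dr v y)) //; last first.
  by move=> y Cy; rewrite (cpdM _ rC su sv Cy).
have sdu := csm_cpd (i_r n) rC su; have sdv := csm_cpd (i_r n) rC sv.
rewrite tcD //; [|exact: csmM|exact: csmM].
rewrite !IH //.
transitivity (\sum_(a < k.+2) (a%:R * (tc a u x * tc (k.+1 - a) v x)) +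
   \sum_(a < k.+2) ((k.+1 - a)%:R * (tc a u x * tc (k.+1 - a) v x))).
  congr (_ + _).
    rewrite [RHS]big_ord_recl mul0r add0r; apply: eq_bigr => a _.
    by rewrite tc_dr /= /bump /= add1n subSS mulrA.
  rewrite [RHS]big_ord_recr /= subnn mul0r addr0; apply: eq_bigr => a _.
  by rewrite tc_dr mulrCA subSn // -ltnS.
rewrite -big_split /= mulr_sumr; apply: eq_bigr => a _.
by rewrite -mulrDl -natrD subnKC // -ltnS.
Qed.

Lemma tc_dx k j u x : csm C u -> U x -> tc k (dx j u) x = cpd j (tc k u) x.
Proof.
move=> su Ux.
have E y : C y -> iter k dr (dx j u) y = dx j (iter k dr u) y.
  elim: k y => //= k IH y Cy; rewrite (cpd_ext _ rC IH Cy).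
  by apply: (cpdC _ _ rC) => //; exact: csm_iter.
rewrite /tc E; last exact: cyl0.
rewrite cpd_x_pt mulrC -(cpdZ _ _ (open_ropen oU)) //.
  by apply: (cpd_ext _ (open_ropen oU)) => // z _; rewrite mulrC.
exact: (csm_trace0 eps0 (csm_iter k (i_r n) su)).
Qed.

Lemma tc_xcoord k (w : 'rV[R]_n -> R[i]) x : U x ->
  tc k (w \o @xcoord R n) x = if k == 0%N then w x else 0.
Proof.
move=> Ux; case: k => [|k]; first by rewrite tc0 /= xcoord_pt.
have /mulfI I : (k.+1%:R : R[i]) != 0 by rewrite pnatr_eq0.
apply: I; rewrite -tc_dr mulr0 (tc_ext _ (v := cst 0)) ?tc_cst //; first by case: ifP.
by move=> y _; rewrite cpd_r_xcoord.
Qed.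

Lemma tc_r k u x : csm C u -> U x ->
  tc k (fun y => (rcoord y)%:C * u y) x = if k is k'.+1 then tc k' u x else 0.
Proof.
move=> su Ux; have sr := csm_rcoord eps U.
have T1 a : tc a (fun y => (rcoord y)%:C) x = if a == 1%N then 1 else 0.
  case: a => [|a]; first by rewrite tc0 rcoord_pt.
  have /mulfI I : (a.+1%:R : R[i]) != 0 by rewrite pnatr_eq0.
  apply: I; rewrite -tc_dr (tc_ext _ (v := cst 1)) ?tc_cst //.
    by case: a => [|a]; rewrite ?mulr1 ?mulr0.
  by move=> y Cy; rewrite (cpd_r_rcoord oU Cy).
rewrite tcM //; case: k => [|k]; first by rewrite big_ord1 T1 mul0r.
rewrite big_ord_recl T1 mul0r add0r big_ord_recl T1 mul1r big1 ?addr0.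
  by rewrite /= /bump /= subSS subn0.
by move=> i _; rewrite T1 mul0r.
Qed.

Lemma tc_rX j k u x : csm C u -> U x ->
  tc k (fun y => (rcoord y)%:C ^+ j * u y) x = if (j <= k)%N then tc (k - j) u x else 0.
Proof.
move=> su Ux; elim: j k => [|j IH] k.
  by rewrite leq0n subn0; apply: tc_ext => // y _; rewrite expr0 mul1r.
rewrite (tc_ext _ (v := fun y => (rcoord y)%:C * ((rcoord y)%:C ^+ j * u y))) //; last first.
  by move=> y _; rewrite exprS mulrA.
rewrite tc_r //; last by apply: csmM => //; apply: csmX; exact: csm_rcoord.
by case: k => [//|k]; rewrite IH ltnS subSS.
Qed.

End Taylor.

(** * Radial operators and Green's identity *)

Section Rearrangement.
Variable K : comPzRingType.
Implicit Types r al be s d a b c e : K.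

(** These identities are stated over abstract ring elements, so that their later instances with
    derivatives need no further computation. *)
Fact op_add r al be s d a1 a2 b1 b2 c1 c2 e1 e2 :
  r * (a1 + a2) + r * (b1 + b2) + al * (s * (c1 + c2)) + be * (d * (e1 + e2)) =
  (r * a1 + r * b1 + al * (s * c1) + be * (d * e1)) +
  (r * a2 + r * b2 + al * (s * c2) + be * (d * e2)).
Proof. by ring. Qed.

Fact op_scale r al be s d a b c e k :
  r * (k * a) + r * (k * b) + al * (s * (k * c)) + be * (d * (k * e)) =
  k * (r * a + r * b + al * (s * c) + be * (d * e)).
Proof. by ring. Qed.

Fact op_green r al be al' be' s d w p (w1 w2 wd p1 p2 pd : K) :
  w * (r * p2 + r * pd + al * (s * p1) + be * (d * p)) -
  p * (r * w2 + r * wd + al' * (s * w1) + be' * (d * w)) =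
  r * (w * p2 - p * w2) + r * (w * pd - p * wd)
  + al * (s * (w * p1)) - al' * (s * (p * w1)) + (be - be') * (d * (w * p)).
Proof. by ring. Qed.

End Rearrangement.

Section RadialOperator.
Variables (R : realType) (n : nat) (eps : R) (U : set 'rV[R]_n).
Hypotheses (eps0 : 0 < eps) (oU : open U).
Implicit Types u v : 'rV[R]_(1 + n) -> R[i].
Local Notation C := (cyl eps U).
Local Notation dr := (cpd (i_r n)).
Local Notation dx j := (cpd (i_x j)).
Local Notation r_ y := ((rcoord y)%:C).
Let rC : ropen C := ropen_cyl oU.
Let rU : ropen U := open_ropen oU.

Variables (sg : 'rV[R]_(1 + n) -> R[i]) (A : 'I_n -> 'I_n -> 'rV[R]_(1 + n) -> R[i]).
Hypotheses (ssg : csm C sg) (sA : forall i j, csm C (A i j)).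
Hypothesis Asym : forall i j y, C y -> A i j y = A j i y.

Let sr : csm C (fun y => r_ y) := csm_rcoord eps U.

Definition flux u i y := \sum_j A i j y * dx j u y.

(** The common shape of two operators. With [sg] the density of [h_r] and [A] the density times the
    inverse metric, the choice [al = - (2 lam - n + 1)], [be = - (lam - n + 1)] gives [sg * S(lam)],
    and [al = 2 lam - n + 1], [be = lam] gives the equation for [W] once [r ^ lam] is factored
    out. *)
Definition Op (al be : R[i]) u y :=
  r_ y * dr (fun y => sg y * dr u y) y + r_ y * \sum_i dx i (flux u i) y
  + al * (sg y * dr u y) + be * (dr sg y * u y).

Lemma csm_flux u i : csm C u -> csm C (flux u i).
Proof. by move=> su; apply: csm_sum => j _; apply: csmM => //; exact: csm_cpd. Qed.

Lemma csm_Op al be u : csm C u -> csm C (Op al be u).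
Proof.
move=> su; have sdu := csm_cpd (i_r n) rC su; have sdsg := csm_cpd (i_r n) rC ssg.
apply: csmD; last by apply: csmZ; exact: csmM.
apply: csmD; last by apply: csmZ; exact: csmM.
apply: csmD; apply: csmM => //; first by apply: csm_cpd => //; exact: csmM.
by apply: csm_sum => i _; apply: csm_cpd => //; exact: csm_flux.
Qed.

Lemma flux_ext u v i : (forall y, C y -> u y = v y) ->
  forall y, C y -> flux u i y = flux v i y.
Proof. by move=> E y Cy; apply: eq_bigr => j _; rewrite (cpd_ext _ rC E Cy). Qed.

Lemma Op_ext al be u v : (forall y, C y -> u y = v y) ->
  forall y, C y -> Op al be u y = Op al be v y.
Proof.
move=> E y Cy; rewrite /Op (cpd_ext (i_r n) rC E Cy) (E y Cy).
have -> : dr (fun y => sg y * dr u y) y = dr (fun y => sg y * dr v y) y.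
  by apply: (cpd_ext _ rC _ Cy) => z Cz; rewrite (cpd_ext _ rC E Cz).
have E2 : \sum_i dx i (flux u i) y = \sum_i dx i (flux v i) y.
  by apply: eq_bigr => i _; apply: (cpd_ext _ rC _ Cy); exact: flux_ext.
by rewrite E2.
Qed.

Lemma OpD al be u v y : csm C u -> csm C v -> C y ->
  Op al be (fun y => u y + v y) y = Op al be u y + Op al be v y.
Proof.
move=> su sv Cy; have sdu := csm_cpd (i_r n) rC su; have sdv := csm_cpd (i_r n) rC sv.
have E1 : dr (fun y => sg y * dr (fun y => u y + v y) y) y =
    dr (fun y => sg y * dr u y) y + dr (fun y => sg y * dr v y) y.
  rewrite -(cpdD _ rC _ _ Cy); [|exact: csmM|exact: csmM].
  by apply: (cpd_ext _ rC _ Cy) => z Cz; rewrite (cpdD _ rC su sv Cz) mulrDr.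
have E2 : \sum_i dx i (flux (fun y => u y + v y) i) y =
    \sum_i dx i (flux u i) y + \sum_i dx i (flux v i) y.
  rewrite -big_split; apply: eq_bigr => i _ /=.
  rewrite -(cpdD _ rC _ _ Cy); [|exact: csm_flux|exact: csm_flux].
  apply: (cpd_ext _ rC _ Cy) => z Cz; rewrite /flux -big_split; apply: eq_bigr => j _ /=.
  by rewrite (cpdD _ rC su sv Cz) mulrDr.
by rewrite /Op (cpdD (i_r n) rC su sv Cy) E1 E2; exact: op_add.
Qed.

Lemma OpZ al be a u y : csm C u -> C y ->
  Op al be (fun y => a * u y) y = a * Op al be u y.
Proof.
move=> su Cy; have sdu := csm_cpd (i_r n) rC su.
have E1 : dr (fun y => sg y * dr (fun y => a * u y) y) y = a * dr (fun y => sg y * dr u y) y.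
  rewrite -(cpdZ _ _ rC _ Cy); last exact: csmM.
  by apply: (cpd_ext _ rC _ Cy) => z Cz; rewrite (cpdZ _ _ rC su Cz) mulrCA.
have E2 : \sum_i dx i (flux (fun y => a * u y) i) y = a * \sum_i dx i (flux u i) y.
  rewrite mulr_sumr; apply: eq_bigr => i _ /=.
  rewrite -(cpdZ _ _ rC _ Cy); last exact: csm_flux.
  apply: (cpd_ext _ rC _ Cy) => z Cz; rewrite /flux mulr_sumr; apply: eq_bigr => j _ /=.
  by rewrite (cpdZ _ _ rC su Cz) mulrCA.
by rewrite /Op (cpdZ (i_r n) _ rC su Cy) E1 E2; exact: op_scale.
Qed.

(* The Wronskian W psi' - psi W' and its tangential analogue turn the
   difference of the two sides into a total derivative. *)
Lemma Op_green (al be al' be' : R[i]) W psi y : csm C W -> csm C psi -> C y ->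
  W y * Op al be psi y - psi y * Op al' be' W y =
  r_ y * dr (fun y => sg y * (W y * dr psi y - psi y * dr W y)) y
  + r_ y * \sum_i dx i (fun y => W y * flux psi i y - psi y * flux W i y) y
  + al * (sg y * (W y * dr psi y)) - al' * (sg y * (psi y * dr W y))
  + (be - be') * (dr sg y * (W y * psi y)).
Proof.
move=> sW sp Cy; have sdW := csm_cpd (i_r n) rC sW; have sdp := csm_cpd (i_r n) rC sp.
have sd2W := csmM ssg sdW; have sd2p := csmM ssg sdp.
have E1 : dr (fun y => sg y * (W y * dr psi y - psi y * dr W y)) y =
    W y * dr (fun y => sg y * dr psi y) y - psi y * dr (fun y => sg y * dr W y) y.
  transitivity (dr (fun y => W y * (sg y * dr psi y) - psi y * (sg y * dr W y)) y).
    by apply: (cpd_ext _ rC _ Cy) => z _; ring.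
  rewrite (cpdB _ rC (csmM sW sd2p) (csmM sp sd2W) Cy).
  by rewrite (cpdM _ rC sW sd2p Cy) (cpdM _ rC sp sd2W Cy); ring.
have E2 : \sum_i dx i (fun y => W y * flux psi i y - psi y * flux W i y) y =
    W y * (\sum_i dx i (flux psi i) y) - psi y * (\sum_i dx i (flux W i) y).
  (* The products of first derivatives cancel because [A] is symmetric. *)
  have sym : \sum_i dx i W y * flux psi i y = \sum_i dx i psi y * flux W i y.
    rewrite /flux; under eq_bigr => i _ do rewrite mulr_sumr.
    rewrite exchange_big /=; apply: eq_bigr => i _; rewrite mulr_sumr.
    by apply: eq_bigr => j _; rewrite (Asym _ _ Cy); ring.
  transitivity (\sum_i (dx i W y * flux psi i y + W y * dx i (flux psi i) y
      - (dx i psi y * flux W i y + psi y * dx i (flux W i) y))).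
    apply: eq_bigr => i _.
    have sfp := csm_flux i sp; have sfW := csm_flux i sW.
    rewrite (cpdB _ rC (csmM sW sfp) (csmM sp sfW) Cy).
    by rewrite (cpdM _ rC sW sfp Cy) (cpdM _ rC sp sfW Cy).
  rewrite sumrB !big_split /= sym -!mulr_sumr [X in X - _]addrC.
  by rewrite [X in _ - X]addrC opprD addrACA subrr addr0.
by rewrite /Op E1 E2; exact: op_green.
Qed.

Lemma tc_rdr k u x : csm C u -> U x -> tc k (fun y => r_ y * dr u y) x = k%:R * tc k u x.
Proof.
move=> su Ux; rewrite (tc_r eps0 oU) //; last exact: csm_cpd.
by case: k => [|k]; rewrite ?mul0r // tc_dr.
Qed.

(** Put [b = 2 nu + k - nn + 1]. The parameters of the two operators are [al = - b - k],
    [al' = b - k] and [be - be' = - b], so the lower-order terms of [Op_green] collapse to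
    [- k F - b d_r Q]. Taking the coefficient of [r^k] kills [r d_r F - k F] and turns [d_r Q] into
    [k.+1] times the next coefficient of [Q]; the divergences carry a factor [r] and drop by one
    order. The product of [psi] with the operator applied to [W] involves orders up to [k] only. *)
Lemma tc_pairing (nu nn : R[i]) k W psi x : csm C W -> csm C psi -> U x ->
  (forall m, (m <= k)%N -> tc m (Op (2 * nu - nn + 1) nu W) x = 0) ->
  tc k (fun y => W y * Op (- (2 * (nu + k%:R) - nn + 1)) (- (nu + k%:R - nn + 1)) psi y) x =
  - (k.+1%:R * (2 * nu + k%:R - nn + 1)) * tc k.+1 (fun y => sg y * (W y * psi y)) x
  + if k is k'.+1 then \sum_i cpd i (tc k' (fun y => W y * flux psi i y - psi y * flux W i y)) x
    else 0.
Proof.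
move=> sW sp Ux zero.
set F := fun y => sg y * (W y * dr psi y - psi y * dr W y).
set Q := fun y => sg y * (W y * psi y).
set B := fun i y => W y * flux psi i y - psi y * flux W i y.
have sdW := csm_cpd (i_r n) rC sW; have sdp := csm_cpd (i_r n) rC sp.
have sF : csm C F by apply: csmM => //; apply: csmB; exact: csmM.
have sQ : csm C Q by apply: csmM => //; exact: csmM.
have sB i : csm C (B i).
  by apply: csmB; apply: csmM => //; exact: csm_flux.
have sdB : csm C (fun y => \sum_i dx i (B i) y).
  by apply: csm_sum => i _; exact: csm_cpd.
set o1 := Op _ _ psi; set o2 := Op (2 * nu - nn + 1) nu W.
have so1 : csm C o1 by exact: csm_Op.
have so2 : csm C o2 by exact: csm_Op.
have E y : C y -> W y * o1 y = psi y * o2 y + (r_ y * dr F y + r_ y * (\sum_i dx i (B i) y)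
    + ((- k%:R) * F y + (- (2 * nu + k%:R - nn + 1)) * dr Q y)).
  move=> Cy; have := Op_green (- (2 * (nu + k%:R) - nn + 1)) (- (nu + k%:R - nn + 1))
    (2 * nu - nn + 1) nu sW sp Cy.
  rewrite -/o1 -/o2 => /(canRL (subrK _)) ->.
  rewrite [RHS]addrC; congr (_ + _).
  rewrite /Q (cpdM _ rC ssg (csmM sW sp) Cy) (cpdM _ rC sW sp Cy) /F.
  by ring.
rewrite (tc_ext eps0 oU _ E Ux).
rewrite (tcD eps0 oU) //; first last.
- apply: csmD; first by apply: csmD; apply: csmM => //; exact: csm_cpd.
  by apply: csmD; apply: csmZ => //; exact: csm_cpd.
- exact: csmM.
rewrite (tcM eps0 oU) // big1 ?add0r; last first.
  by move=> a _; rewrite zero ?mulr0 // leq_subr.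
rewrite (tcD eps0 oU) //; first last.
- by apply: csmD; apply: csmZ => //; exact: csm_cpd.
- by apply: csmD; apply: csmM => //; exact: csm_cpd.
rewrite (tcD eps0 oU) //; first last.
- exact: csmM.
- by apply: csmM => //; exact: csm_cpd.
rewrite (tcD eps0 oU) //; first last.
- by apply: csmZ; exact: csm_cpd.
- exact: csmZ.
rewrite !(tcZ eps0 oU) //; last exact: csm_cpd.
rewrite tc_rdr // tc_dr (tc_r eps0 oU) //.
clear E so1 o1 zero so2 o2.
case: k => [|k].
  by ring.
rewrite (tc_sum eps0 oU) //; last by move=> i _; exact: csm_cpd.
under eq_bigr => i _ do rewrite (tc_dx eps0 oU) //.
by ring.
Qed.

(* b is false for even and true for odd functions of r. *)
Definition par (b : bool) u := forall k x, U x -> odd k != b -> tc k u x = 0.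

Lemma par_ext b u v : (forall y, C y -> u y = v y) -> par b u -> par b v.
Proof. by move=> E pu k x Ux ob; rewrite -(tc_ext eps0 oU k E Ux) pu. Qed.

Lemma parD b u v : csm C u -> csm C v -> par b u -> par b v -> par b (fun y => u y + v y).
Proof. by move=> su sv pu pv k x Ux ob; rewrite (tcD eps0 oU) // pu // pv // addr0. Qed.

Lemma par_sum b (I : Type) (r : seq I) (P : pred I) (F : I -> 'rV[R]_(1 + n) -> R[i]) :
  (forall i, P i -> csm C (F i)) -> (forall i, P i -> par b (F i)) ->
  par b (fun y => \sum_(i <- r | P i) F i y).
Proof.
move=> sF pF k x Ux ob; rewrite (tc_sum eps0 oU) // big1 // => i Pi.
by rewrite (pF i Pi).
Qed.

Lemma parM a b u v : csm C u -> csm C v -> par a u -> par b v ->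
  par (a (+) b) (fun y => u y * v y).
Proof.
move=> su sv pu pv k x Ux ob; rewrite (tcM eps0 oU) // big1 // => i _.
case: (boolP (odd i == a)) => [/eqP ia|ia]; last by rewrite pu // mul0r.
rewrite pv ?mulr0 // oddB -1?ltnS //; apply: contra ob => /eqP <-.
by rewrite ia; case: (odd k); case: (a).
Qed.

Lemma parZ b a u : csm C u -> par b u -> par b (fun y => a * u y).
Proof. by move=> su pu k x Ux ob; rewrite (tcZ eps0 oU) // pu // mulr0. Qed.

Lemma par_cst a : par false (cst a).
Proof. by move=> [|k] x Ux // ob; rewrite (tc_cst eps0 oU). Qed.

Lemma par_dr b u : par b u -> par (~~ b) (dr u).
Proof.
move=> pu k x Ux ob; rewrite tc_dr pu ?mulr0 //=; apply: contra ob => /eqP <-.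
by rewrite negbK.
Qed.

Lemma par_dx b j u : csm C u -> par b u -> par b (dx j u).
Proof.
move=> su pu k x Ux ob; rewrite (tc_dx eps0 oU) //.
rewrite (cpd_ext _ rU (v := cst 0)) // ?(cpd_cst _ _ rU) // => z Uz.
exact: pu.
Qed.

Lemma par_r : par true (fun y => r_ y).
Proof.
move=> k x Ux ok; have s1 := csm_cst C 1.
rewrite (tc_ext eps0 oU _ (v := fun y => r_ y * cst 1 y)) //; last first.
  by move=> y _; rewrite mulr1.
rewrite (tc_r eps0 oU) //; case: k ok => // k /=.
by rewrite (tc_cst eps0 oU) //; case: k.
Qed.

(** Multiplication by [r] and [dr] each reverse parity, while tangential derivatives and even
    coefficients keep it; every term of [Op] contains an odd number of reversals. *)
Lemma par_Op al be u : csm C u -> par false sg -> (forall i j, par false (A i j)) ->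
  par false u -> par true (Op al be u).
Proof.
move=> su psg pA pu.
have sdu := csm_cpd (i_r n) rC su; have sdsg := csm_cpd (i_r n) rC ssg.
have pdu := par_dr pu; have sd2 := csmM ssg sdu.
have pd2 := parM ssg sdu psg pdu.
have sf i := csm_flux i su.
have sdf : csm C (fun y => \sum_i dx i (flux u i) y).
  by apply: csm_sum => i _; exact: csm_cpd.
have sdd := csm_cpd (i_r n) rC sd2.
have p1 := parM sr sdd par_r (par_dr pd2).
have pf i : par false (flux u i).
  apply: par_sum => j _; first by apply: csmM => //; exact: csm_cpd.
  by apply: (parM (a := false) (b := false)) => //; [exact: csm_cpd|exact: par_dx].
have p2 : par true (fun y => r_ y * \sum_i dx i (flux u i) y).
  apply: (parM (a := true) (b := false)) => //; first exact: par_r.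
  by apply: par_sum => i _; [exact: csm_cpd|exact: par_dx].
have p3 := parZ al sd2 pd2.
have p4 := parZ be (csmM sdsg su) (parM sdsg su (par_dr psg) pu).
apply: parD => //; [|by apply: csmZ; exact: csmM| ].
  by apply: csmD; [apply: csmD; exact: csmM|exact: csmZ].
apply: parD => //; [|exact: csmZ| ].
  by apply: csmD; exact: csmM.
by apply: parD => //; exact: csmM.
Qed.

End RadialOperator.

(** * Laplacians of conformally compact metrics *)

Section MatrixFunctions.
Variables (R : realType) (m : nat) (A : set 'rV[R]_m).
Hypothesis rA : ropen A.

Lemma smooth_on_det k (H : 'rV[R]_m -> 'M[R]_k) :
  (forall a b, smooth_on A (fun y => H y a b)) -> smooth_on A (fun y => \det (H y)).
Proof.
move=> sH; rewrite /determinant; apply: smooth_on_sum => s _.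
by apply: smooth_onM; [exact: smooth_on_cst|apply: smooth_on_prod => i _; exact: sH].
Qed.

Lemma smooth_on_cofactor k (H : 'rV[R]_m -> 'M[R]_k) a b :
  (forall a b, smooth_on A (fun y => H y a b)) ->
  smooth_on A (fun y => cofactor (H y) a b).
Proof.
move=> sH; rewrite /cofactor; apply: smooth_onM; first exact: smooth_on_cst.
apply: smooth_on_det => i j.
by apply: smooth_on_ext (sH (lift a i) (lift b j)) => y _; rewrite !mxE.
Qed.

Lemma pder_prod k (F : 'I_k -> 'rV[R]_m -> R) i y :
  (forall j, smooth_on A (F j)) -> A y ->
  pder i (fun y => \prod_j F j y) y =
  \sum_l \prod_j (if j == l then pder i (F j) y else F j y).
Proof.
move=> sF Ay; elim: k F sF => [|k IH] F sF.
  rewrite big_ord0; apply: etrans _ (pder_cst 1 i rA Ay); apply: (pder_ext i rA _ Ay) => z _.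
  by rewrite big_ord0.
have sF' j : smooth_on A (F (lift ord0 j)) by exact: sF.
transitivity (pder i (fun y => F ord0 y * \prod_j F (lift ord0 j) y) y).
  by apply: (pder_ext i rA _ Ay) => z _; rewrite big_ord_recl.
rewrite (pderM i rA (sF ord0) _ Ay); last by apply: smooth_on_prod => j _; exact: sF'.
rewrite (IH _ sF') [RHS]big_ord_recl big_ord_recl eqxx; congr (_ + _).
rewrite mulr_sumr; apply: eq_bigr => l _.
rewrite big_ord_recl /=; congr (_ * _).
Qed.

(** Jacobi's formula. The product rule differentiates one row at a time: [M a] has row [a]
    differentiated, and expansion along that row meets only unchanged cofactors. *)
Lemma pder_det k (H : 'rV[R]_m -> 'M[R]_k) i y :
  (forall a b, smooth_on A (fun y => H y a b)) -> A y ->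
  pder i (fun y => \det (H y)) y =
  \sum_a \sum_b pder i (fun y => H y a b) y * cofactor (H y) a b.
Proof.
move=> sH Ay.
pose M a : 'M[R]_k := \matrix_(l, j) (if l == a then pder i (fun y => H y l j) y else H y l j).
have detM a : \det (M a) = \sum_b pder i (fun y => H y a b) y * cofactor (H y) a b.
  rewrite (expand_det_row _ a); apply: eq_bigr => b _; rewrite mxE eqxx; congr (_ * _).
  rewrite /cofactor; congr (_ * \det _); apply/matrixP => p q.
  by rewrite !mxE eq_sym (negbTE (neq_lift _ _)).
under eq_bigr => a _ do rewrite -detM.
have sP (s : {perm 'I_k}) : smooth_on A (fun y => \prod_j H y j (s j)).
  by apply: smooth_on_prod => j _; exact: sH.
have E (s : {perm 'I_k}) : pder i (fun y => (-1) ^+ s * \prod_j H y j (s j)) y =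
    (-1) ^+ s * \sum_l \prod_j M l j (s j).
  rewrite (pderM i rA (@smooth_on_cst _ _ _ _) (sP s) Ay) (pder_cst _ _ rA Ay) mul0r add0r.
  congr (_ * _); rewrite pder_prod //; apply: eq_bigr => l _; apply: eq_bigr => j _.
  by rewrite mxE.
have pder_sum (r : seq {perm 'I_k}) : pder i (fun y => \sum_(s <- r) (-1) ^+ s * \prod_j H y j (s j)) y =
    \sum_(s <- r) pder i (fun y => (-1) ^+ s * \prod_j H y j (s j)) y.
  have sS (s : {perm 'I_k}) : smooth_on A (fun y => (-1) ^+ s * \prod_j H y j (s j)).
    by apply: smooth_onM => //; exact: smooth_on_cst.
  elim: r => [|s r IH].
    rewrite big_nil; apply: etrans _ (pder_cst 0 i rA Ay).
    by apply: (pder_ext i rA _ Ay) => z _; rewrite big_nil.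
  rewrite big_cons -IH -(pderD i rA _ _ Ay) //; last by apply: smooth_on_sum => ? _; exact: sS.
  by apply: (pder_ext i rA _ Ay) => z _; rewrite big_cons.
rewrite /determinant pder_sum (eq_bigr _ (fun s _ => E s)).
under eq_bigr => s _ do rewrite mulr_sumr.
by rewrite exchange_big.
Qed.

End MatrixFunctions.

Section PositiveDefinite.
Variables (R : realType) (n : nat).

Definition posdef (H : 'M[R]_n) := forall w : 'rV[R]_n, w != 0 -> 0 < (w *m H *m w^T) 0 0.

(* The segment from 1 to H consists of positive definite matrices, so the
   determinant does not vanish along it. *)
Lemma posdef_det (H : 'M[R]_n) : posdef H -> 0 < \det H.
Proof.
move=> pH; rewrite ltNge; apply/negP => detH.
(* With polynomial entries the determinant along the segment is a polynomial in [t], equal to 1 at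
   [t = 0], so the intermediate value theorem for polynomials yields a root. *)
pose Q : 'M[{poly R}]_n := 'X *: map_mx polyC H + (1 - 'X) *: 1%:M.
have QE t : (\det Q).[t] = \det (t *: H + (1 - t) *: 1%:M).
  rewrite -[LHS]/(horner_eval t (\det Q)) -det_map_mx; congr (\det _).
  apply/matrixP => i j; rewrite !mxE -[LHS]/(_.[t]) !hornerE.
  by case: (i == j); rewrite ?hornerE.
have [|t /andP[t0 t1] /rootP] := @poly_ivt _ (- \det Q) 0 1 ler01.
  rewrite !hornerN !QE !scale0r !scale1r subr0 subrr scale0r add0r addr0 scale1r det1.
  by rewrite oppr_ge0 detH lerN10.
rewrite hornerN QE => /eqP; rewrite oppr_eq0 => /det0P[w w0 /(congr1 (fun B => (B *m w^T) 0 0))].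
rewrite mul0mx mulmxDr mulmxDl -!scalemxAr -!scalemxAl mulmx1 !mxE => E.
have ww : 0 <= \sum_j w 0 j * w^T j 0 by apply: sumr_ge0 => j _; rewrite mxE -expr2 sqr_ge0.
have := pH w w0; rewrite mxE => Hw.
have [t00|tp] : t = 0 \/ 0 < t by case: (ltgtP 0 t) t0 => //; [right|left].
  move: E; rewrite t00 mul0r add0r subr0 mul1r => E.
  have /eqP := E; rewrite psumr_eq0 => [/allP/= Z|j _]; last by rewrite mxE -expr2 sqr_ge0.
  move/eqP: w0; apply; apply/rowP => j; rewrite mxE; apply/eqP.
  by have := Z j (mem_index_enum _); rewrite mxE -expr2 sqrf_eq0.
have : 0 < t * \sum_j (w *m H) 0 j * w^T j 0 + (1 - t) * \sum_j w 0 j * w^T j 0.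
  by apply: ltr_pwDl; [exact: mulr_gt0|apply: mulr_ge0; rewrite // subr_ge0].
by rewrite E ltxx.
Qed.

End PositiveDefinite.

Section CylinderMetric.
Variables (R : realType) (n : nat) (A : set 'rV[R]_(1 + n)).
Hypothesis rA : ropen A.
Variable H : 'rV[R]_(1 + n) -> 'M[R]_n.
Hypothesis sH : forall i j, smooth_on A (fun y => H y i j).
Hypothesis symH : forall y, A y -> (H y)^T = H y.
Hypothesis posH : forall y, A y -> posdef (H y).
Implicit Types (F : 'rV[R]_(1 + n) -> R) (u : 'rV[R]_(1 + n) -> R[i]).

Definition sgR y := Num.sqrt (\det (H y)).
Definition AR i j y := sgR y * invmx (H y) i j.
Definition Gb y : 'M[R]_(1 + n) := block_mx 1%:M 0 0 (H y).

Lemma detH_gt0 y : A y -> 0 < \det (H y).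
Proof. by move=> /posH; exact: posdef_det. Qed.

Lemma unitH y : A y -> H y \in unitmx.
Proof. by move=> /detH_gt0 h; rewrite unitmxE unitfE gt_eqF. Qed.

Lemma sgR_gt0 y : A y -> 0 < sgR y.
Proof. by move=> /detH_gt0; rewrite sqrtr_gt0. Qed.

Lemma smooth_sgR : smooth_on A sgR.
Proof. by apply: smooth_on_sqrt; [exact: detH_gt0|exact: smooth_on_det]. Qed.

Lemma invH_E y i j : A y -> invmx (H y) i j = (\det (H y))^-1 * cofactor (H y) j i.
Proof. by move=> Ay; rewrite /invmx unitH // !mxE. Qed.

Lemma smooth_invH i j : smooth_on A (fun y => invmx (H y) i j).
Proof.
apply: (smooth_on_ext (F := fun y => (\det (H y))^-1 * cofactor (H y) j i)).
  by move=> y Ay; rewrite invH_E.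
apply: smooth_onM; last exact: smooth_on_cofactor.
by apply: smooth_on_inv; [exact: detH_gt0|exact: smooth_on_det].
Qed.

Lemma smooth_AR i j : smooth_on A (AR i j).
Proof. by apply: smooth_onM; [exact: smooth_sgR|exact: smooth_invH]. Qed.

Lemma AR_sym i j y : A y -> AR i j y = AR j i y.
Proof.
by move=> Ay; rewrite /AR -[in LHS](symH Ay) -trmx_inv mxE.
Qed.

(** Differentiate [sgR ^ 2 = \det H] and apply Jacobi's formula. *)
Lemma pder_sgR i y : A y ->
  pder i sgR y = 2^-1 * sgR y * \tr (invmx (H y) *m \matrix_(a, b) pder i (fun z => H z a b) y).
Proof.
move=> Ay; have s0 := sgR_gt0 Ay.
have d2 : 2 * (sgR y * pder i sgR y) = pder i (fun y => \det (H y)) y.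
  have <- : pder i (fun y => sgR y * sgR y) y = pder i (fun y => \det (H y)) y.
    apply: (pder_ext i rA _ Ay) => z Az.
    by rewrite -expr2 sqr_sqrtr // ltW // detH_gt0.
  by rewrite (pderM i rA smooth_sgR smooth_sgR Ay) mulrC; ring.
have tE : \tr (invmx (H y) *m \matrix_(a, b) pder i (fun z => H z a b) y) =
    (\det (H y))^-1 * pder i (fun y => \det (H y)) y.
  rewrite (pder_det rA _ sH Ay) /mxtrace mulr_sumr.
  under eq_bigr => a _ do rewrite mxE.
  rewrite exchange_big /=; apply: eq_bigr => b _; rewrite mulr_sumr.
  by apply: eq_bigr => a _; rewrite invH_E // mxE -mulrA [cofactor _ _ _ * _]mulrC.
have detE : \det (H y) = sgR y * sgR y.
  by rewrite -expr2 sqr_sqrtr // ltW // detH_gt0.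
rewrite tE -d2 detE; field; by rewrite gt_eqF.
Qed.

Lemma invGb y : A y -> invmx (Gb y) = block_mx 1%:M 0 0 (invmx (H y)).
Proof.
move=> Ay; rewrite /Gb invmx_block_diag ?invmx1 //.
by rewrite block_diag_mx_unit unitmx1 unitH.
Qed.

Lemma detGb y : \det (Gb y) = \det (H y).
Proof. by rewrite /Gb det_ublock det1 mul1r. Qed.

Section Conformal.
Variables (G : 'rV[R]_(1 + n) -> 'M[R]_(1 + n)) (a b : 'rV[R]_(1 + n) -> R).
Hypothesis sqG : forall y, A y -> Num.sqrt (\det (G y)) = a y * sgR y.
Hypothesis invG : forall y, A y -> invmx (G y) = b y *: invmx (Gb y).

(** The functions [a] and [b] are the conformal factors of the density and of the inverse metric:
    both are 1 for [r^2 g_+], and [r ^- n.+1], [r ^+ 2] for [g_+] itself. One computation thus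
    serves both Laplacians. *)
Lemma lap_conf F y : A y ->
  laplacian G F y = (a y * sgR y)^-1 *
   (pder (i_r n) (fun z => a z * b z * (sgR z * pder (i_r n) F z)) y +
    \sum_i pder (i_x i) (fun z => a z * b z * \sum_j AR i j z * pder (i_x j) F z) y).
Proof.
move=> Ay; rewrite /laplacian sqG //; congr (_ * _).
rewrite big_split_ord big_ord1 /=; congr (_ + _).
  rewrite -/(i_r n); apply: (pder_ext _ rA _ Ay) => z Az; rewrite sqG // invG // invGb //.
  rewrite big_split_ord big_ord1 /= big1 ?addr0; last first.
    by move=> j _; rewrite mxE block_mxEur mxE mulr0 mul0r.
  by rewrite mxE block_mxEul mxE eqxx mulr1n /i_r; ring.
apply: eq_bigr => i _; apply: (pder_ext _ rA _ Ay) => z Az; rewrite sqG // invG // invGb //.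
rewrite big_split_ord big_ord1 /= mxE block_mxEdl mxE mulr0 mul0r add0r.
rewrite !mulr_sumr; apply: eq_bigr => j _.
by rewrite mxE block_mxEdr /AR /i_x; ring.
Qed.

Lemma cx_lap_conf u y : A y ->
  cx (laplacian G) u y = ((a y * sgR y)^-1)%:C *
   (cpd (i_r n) (fun z => (a z * b z)%:C * ((sgR z)%:C * cpd (i_r n) u z)) y +
    \sum_i cpd (i_x i) (fun z => (a z * b z)%:C * \sum_j (AR i j z)%:C * cpd (i_x j) u z) y).
Proof.
move=> Ay.
(* The argument uses only that [p] is real-linear and commutes with derivatives, so it is made once
   for the real and the imaginary part. *)
have part (p : R[i] -> R) : (forall z w, p (z + w) = p z + p w) ->
    (forall (k : R) w, p (k%:C * w) = k * p w) ->
    (forall i (w : 'rV[R]_(1 + n) -> R[i]) x, p (cpd i w x) = pder i (fun z => p (w z)) x) ->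
    laplacian G (fun z => p (u z)) y = p (((a y * sgR y)^-1)%:C *
     (cpd (i_r n) (fun z => (a z * b z)%:C * ((sgR z)%:C * cpd (i_r n) u z)) y +
      \sum_i cpd (i_x i) (fun z => (a z * b z)%:C * \sum_j (AR i j z)%:C * cpd (i_x j) u z) y)).
  move=> pD pZ pd.
  have p_sum (I : Type) (r : seq I) (f : I -> R[i]) : p (\sum_(i <- r) f i) = \sum_(i <- r) p (f i).
    elim: r => [|i r IH]; last by rewrite !big_cons pD IH.
    by rewrite !big_nil; have := pZ 0 0; rewrite mulr0 mul0r.
  rewrite pZ lap_conf // pD p_sum pd; congr (_ * (_ + _)).
    by apply: (pder_ext _ rA _ Ay) => z Az; rewrite !pZ pd.
  apply: eq_bigr => i _; rewrite pd; apply: (pder_ext _ rA _ Ay) => z Az.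
  by rewrite pZ p_sum; congr (_ * _); apply: eq_bigr => j _; rewrite pZ pd.
apply: complexP; apply: part => //.
- exact: cReD.
- by move=> k w; rewrite cReM /= mul0r subr0.
- exact: cImD.
- by move=> k w; rewrite cImM /= mul0r addr0.
Qed.

End Conformal.

End CylinderMetric.

(** * Complex powers of [r] *)

Section ComplexPower.
Variable R : realType.
Implicit Types (r : R) (z w : R[i]).

Lemma natC k : (k%:R : R[i]) = (k%:R)%:C.
Proof. by rewrite (rmorph_nat (real_complex R)). Qed.

Lemma cpow0 r : cpow r 0 = 1.
Proof. by rewrite /cpow /= powRr0 mul0r cos0 sin0 mul1r. Qed.

Lemma cpowD r z w : 0 < r -> cpow r (z + w) = cpow r z * cpow r w.
Proof.
move=> r0; case: z => a b; case: w => c d.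
have p : r `^ (a + c) = r `^ a * r `^ c.
  by rewrite powRD //; apply/implyP => _; rewrite gt_eqF.
rewrite /cpow /= p mulrDl cosD sinD; apply: complexP => /=; ring.
Qed.

Lemma cpow_nat r k : 0 < r -> cpow r k%:R = r%:C ^+ k.
Proof.
move=> r0; rewrite natC /cpow /= mul0r cos0 sin0 mulr1 powR_mulrn ?ltW //.
by rewrite (rmorphXn (real_complex R)).
Qed.

Lemma cpow_neq0 r z : 0 < r -> cpow r z != 0.
Proof.
move=> r0; apply/eqP => E; have := cpowD z (- z) r0.
by rewrite subrr cpow0 E mul0r => /eqP; rewrite oner_eq0.
Qed.

Lemma cpowN r z : 0 < r -> cpow r (- z) = (cpow r z)^-1.
Proof.
move=> r0; apply: (mulfI (cpow_neq0 z r0)).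
by rewrite -cpowD // subrr cpow0 mulfV // cpow_neq0.
Qed.

Lemma norm_cpow r z : 0 < r -> complex.Re `|cpow r z| = r `^ complex.Re z.
Proof.
move=> r0; rewrite normc_def /= !mul0r subr0 addr0 !exprMn -mulrDr cos2Dsin2 mulr1.
by rewrite sqrtr_sqr ger0_norm // powR_ge0.
Qed.

Lemma is_derive_cpow_parts (a b t : R) : 0 < t ->
  is_derive t 1 (fun t => t `^ a * cos (b * ln t))
    (a * (t `^ (a - 1) * cos (b * ln t)) - b * (t `^ (a - 1) * sin (b * ln t))) /\
  is_derive t 1 (fun t => t `^ a * sin (b * ln t))
    (a * (t `^ (a - 1) * sin (b * ln t)) + b * (t `^ (a - 1) * cos (b * ln t))).
Proof.
move=> t0.
have tE : t `^ (a - 1) * t = t `^ a.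
  rewrite -[X in _ * X](powRr1 (ltW t0)) -powRD ?subrK //.
  by apply/implyP => _; rewrite gt_eqF.
have dp := is_derive1_powR a t0; have dl := is_derive1_ln t0.
have dbl : is_derive t 1 (fun t => b * ln t) (b * t^-1).
  by apply: is_derive_eq.
have dc : is_derive t 1 (fun t => cos (b * ln t)) (- sin (b * ln t) * (b * t^-1)).
  exact: (@is_derive1_comp _ cos (fun t => b * ln t) t _ _ (is_derive_cos _) dbl).
have ds : is_derive t 1 (fun t => sin (b * ln t)) (cos (b * ln t) * (b * t^-1)).
  exact: (@is_derive1_comp _ sin (fun t => b * ln t) t _ _ (is_derive_sin _) dbl).
split; apply: is_derive_eq; rewrite -tE /GRing.scale /=; field; by rewrite gt_eqF.
Qed.

(** The complex factor [c] makes the family closed under differentiation, as [Ck_comp] requires;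
    [c = 1] gives the real part of the power and [c = -i] the imaginary part. *)
Lemma is_derive_cpow_lin (c z : R[i]) (t : R) : 0 < t ->
  is_derive t 1 (fun t => complex.Re (c * cpow t z)) (complex.Re (c * (z * cpow t (z - 1)))).
Proof.
case: z => a b t0; have [dc ds] := is_derive_cpow_parts a b t0.
have -> : (fun t => complex.Re (c * cpow t (a +i* b))) =
    (fun t => complex.Re c * (t `^ a * cos (b * ln t)) - complex.Im c * (t `^ a * sin (b * ln t))).
  by apply/funext => s; rewrite /cpow; case: c => c d /=; ring.
apply: is_derive_eq.
by rewrite /cpow /GRing.scale; case: c => c d /=; rewrite !subr0; ring.
Qed.

End ComplexPower.

Section PositiveCylinder.
Variables (R : realType) (n : nat) (eps : R) (U : set 'rV[R]_n).
Hypothesis oU : open U.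
Implicit Types z : R[i].

Definition cylp : set 'rV[R]_(1 + n) := [set y | 0 < rcoord y < eps /\ U (xcoord y)].

Lemma cylp_cyl : cylp `<=` cyl eps U.
Proof. by move=> y [/andP[r0 r1] Uy]; split=> //; rewrite ltW. Qed.

Lemma ropen_cylp : ropen cylp.
Proof.
move=> y [/andP[r0 r1] Uy] i.
have Cy : cyl eps U y by apply: cylp_cyl; split; rewrite ?r0.
have h1 := @ropen_cyl R n eps U oU y Cy i.
have h2 : \forall t \near 0^'+, 0 < rcoord (y + t *: evec R i).
  near=> t; have t0 : 0 < t by near: t; exact: nbhs_right_gt.
  rewrite -(pt_coord y); case: (idx_case i) => [->|[j ->]].
    by rewrite pt_evec_r rcoord_pt addr_gt0.
  by rewrite pt_evec_x rcoord_pt.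
near=> t; have [/andP[_ a] b] : cyl eps U (y + t *: evec R i) by near: t.
split=> //; apply/andP; split=> //; by near: t.
Unshelve. all: by end_near. Qed.

Lemma csm_cpow z : csm cylp (fun y => cpow (rcoord y) z).
Proof.
have aux (c : R[i]) : smooth_on cylp (fun y => complex.Re (c * cpow (rcoord y) z)).
  pose W := [set y : 'rV[R]_(1 + n) | 0 < rcoord y].
  have oW : open W.
    have -> : W = (@rcoord R n) @^-1` [set t : R | 0 < t] by [].
    by apply: open_comp; [move=> y _; exact: rcoord_continuous|exact: open_gt].
  pose cf j := \prod_(i < j) (z - i%:R).
  pose g j t := complex.Re (c * cf j * cpow t (z - j%:R)).
  apply: (@Ck_smooth_on _ _ _ W) => //; first by move=> y [/andP[]].
  move=> k; have -> : (fun y => complex.Re (c * cpow (rcoord y) z)) = (fun y : 'rV[R]_(1 + n) => g 0%N (rcoord y)).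
    by apply/funext => y; rewrite /g /cf big_ord0 mulr1 subr0.
  apply: (@Ck_comp R _ W _ [set t | 0 < t] g) => // [j t t0|].
    have := is_derive_cpow_lin (c * cf j) (z - j%:R) t0.
    rewrite /g; set d1 := complex.Re _; set d2 := complex.Re _; suff -> : d1 = d2 by [].
    rewrite /d1 /d2 /cf big_ord_recr /= -natr1 opprD addrA.
    by congr complex.Re; rewrite !mulrA.
  have HC : Ck k W (fun y => y 0 (i_r n)) by apply: Ck_subset (Ck_coord _ k (i_r n)).
  by apply: Ck_ext oW _ HC => y _; rewrite /rcoord mxE.
split.
  by apply: smooth_on_ext (aux 1) => y _; rewrite mul1r.
apply: smooth_on_ext (aux (0 -i* 1)) => y _.
by case: (cpow _ _) => a b /=; ring.
Qed.

Lemma cpd_r_cpow z y : cylp y ->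
  cpd (i_r n) (fun y => cpow (rcoord y) z) y = z * cpow (rcoord y) (z - 1).
Proof.
move=> Ay; have r0 : 0 < rcoord y by case: Ay => /andP[].
have sr : smooth_on cylp (@rcoord R n).
  by apply: smooth_on_ext (@smooth_on_coord R _ cylp (i_r n)) => u _; rewrite /rcoord mxE.
have pr : pder (i_r n) (@rcoord R n) y = 1.
  have -> : @rcoord R n = (fun y => y 0 (i_r n)) by apply/funext => u; rewrite /rcoord mxE.
  by rewrite (pder_coord _ _ ropen_cylp Ay) eqxx.
have aux (c : R[i]) : pder (i_r n) (fun y => complex.Re (c * cpow (rcoord y) z)) y =
    complex.Re (c * (z * cpow (rcoord y) (z - 1))).
  by rewrite (pder_comp (i_r n) ropen_cylp sr Ay (is_derive_cpow_lin c z r0)) pr mulr1.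
apply: complexP.
  rewrite -[LHS]/(pder (i_r n) (fun y => complex.Re (cpow (rcoord y) z)) y).
  have := aux 1; rewrite mul1r => <-.
  by apply: (pder_ext _ ropen_cylp _ Ay) => u _; rewrite mul1r.
rewrite -[LHS]/(pder (i_r n) (fun y => complex.Im (cpow (rcoord y) z)) y).
have E (w : R[i]) : complex.Im w = complex.Re ((0 -i* 1) * w).
  by case: w => a b /=; ring.
by rewrite E -aux; apply: (pder_ext _ ropen_cylp _ Ay) => u _; exact: E.
Qed.

Lemma cpd_x_cpow z j (y : 'rV[R]_(1 + n)) : cpd (i_x j) (fun y => cpow (rcoord y) z) y = 0.
Proof.
rewrite -(pt_coord y) cpd_x_pt; move: (rcoord y) (xcoord y) => r x.
have -> : (fun x : 'rV[R]_n => cpow (rcoord (pt r x)) z) = cst (cpow r z).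
  by apply/funext => u; rewrite rcoord_pt.
exact: (cpd_cst j (cpow r z) (open_ropen openT) (I : setT x)).
Qed.

End PositiveCylinder.

Section CollarOperators.
Variables (R : realType) (n : nat) (eps : R) (U : set 'rV[R]_n).
Hypotheses (eps0 : 0 < eps) (oU : open U).
Variable H : 'rV[R]_(1 + n) -> 'M[R]_n.
Local Notation C := (cyl eps U).
Hypothesis sH : forall i j, smooth_on C (fun y => H y i j).
Hypothesis symH : forall y, C y -> (H y)^T = H y.
Hypothesis posH : forall y, C y -> posdef (H y).
Implicit Types (lam : R[i]) (u W : 'rV[R]_(1 + n) -> R[i]).
Local Notation dr := (cpd (i_r n)).
Local Notation dx j := (cpd (i_x j)).
Let rC : ropen C := ropen_cyl oU.

Definition sg y : R[i] := (sgR H y)%:C.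
Definition Ac i j y : R[i] := (AR H i j y)%:C.

Lemma csm_sg : csm C sg.
Proof. by apply: csm_real; exact: smooth_sgR. Qed.

Lemma csm_Ac i j : csm C (Ac i j).
Proof. by apply: csm_real; exact: smooth_AR. Qed.

Lemma Ac_sym i j y : C y -> Ac i j y = Ac j i y.
Proof. by move=> Cy; rewrite /Ac (AR_sym symH _ _ Cy). Qed.

Lemma sg_neq0 y : C y -> sg y != 0.
Proof.
move=> Cy; have := sgR_gt0 posH Cy; rewrite /sg => s0.
by apply/eqP => /(congr1 (@complex.Re R)) /= E; rewrite E ltxx in s0.
Qed.

Lemma sg_inv y : ((sgR H y)^-1)%:C = (sg y)^-1.
Proof. by rewrite /sg -fmorphV. Qed.

Lemma lap_Gb u y : C y -> csm C u ->
  sg y * cx (laplacian (Gb H)) u y =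
  dr (fun z => sg z * dr u z) y + \sum_i dx i (flux Ac u i) y.
Proof.
move=> Cy su.
have h1 z : C z -> Num.sqrt (\det (Gb H z)) = (cst 1 z) * sgR H z.
  by move=> _; rewrite detGb mul1r.
have h2 z : C z -> invmx (Gb H z) = (cst 1 z) *: invmx (Gb H z).
  by move=> _; rewrite scale1r.
rewrite (cx_lap_conf rC posH h1 h2 u Cy) /= mul1r sg_inv mulVKf ?sg_neq0 //.
congr (_ + _).
  by apply: (cpd_ext _ rC _ Cy) => z _; rewrite mulr1 mul1r.
apply: eq_bigr => i _; apply: (cpd_ext _ rC _ Cy) => z _.
by rewrite mulr1 mul1r.
Qed.

Lemma dr_sg y : C y -> dr sg y = 2^-1 * sg y *
  (\tr (invmx (H y) *m \matrix_(a, b) pder (i_r n) (fun z => H z a b) y))%:C.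
Proof.
move=> Cy; rewrite cpd_real (pder_sgR rC sH posH _ Cy) !rmorphM.
by rewrite (fmorphV (real_complex R)) (rmorph_nat (real_complex R) 2).
Qed.

(** Multiplication by the density puts the Laplacian in divergence form and, by [dr_sg], turns the
    trace term of [S] into a multiple of [dr sg]. *)
Lemma shift_eq lam u y : C y -> csm C u ->
  sg y * ((rcoord y)%:C * cx (laplacian (Gb H)) u y
  - (2 * lam - n%:R + 1) * dr u y
  - 2^-1 * (lam - n%:R + 1) *
    (\tr (invmx (H y) *m \matrix_(i, j) pder (i_r n) (fun z => H z i j) y))%:C * u y) =
  Op sg Ac (- (2 * lam - n%:R + 1)) (- (lam - n%:R + 1)) u y.
Proof.
move=> Cy su; rewrite /Op dr_sg // -(mulrDr (rcoord y)%:C) -lap_Gb //.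
by ring.
Qed.

Definition Gp y : 'M[R]_(1 + n) := (rcoord y) ^- 2 *: Gb H y.

Let sub := @cylp_cyl R n eps U.

(** Conjugation by [r ^ lam]: differentiating the power twice produces [lam * (lam - n)], which
    cancels the zeroth-order term. What remains is an operator whose coefficients are smooth up to
    [r = 0], so it can be expanded in Taylor series. *)
Lemma lap_Gp lam W y : cylp eps U y -> csm C W ->
  cx (laplacian Gp) (fun z => cpow (rcoord z) lam * W z) y
    + lam * (n%:R - lam) * (cpow (rcoord y) lam * W y) =
  cpow (rcoord y) (lam + 1) * (sg y)^-1 * Op sg Ac (2 * lam - n%:R + 1) lam W y.
Proof.
move=> Py sW; have Cy := sub Py.
have rP : ropen (cylp eps U) := ropen_cylp oU.
have r_gt0 z : cylp eps U z -> 0 < rcoord z by case=> /andP[].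
pose a (z : 'rV[R]_(1 + n)) : R := (rcoord z) ^- n.+1.
pose b (z : 'rV[R]_(1 + n)) : R := (rcoord z) ^+ 2.
have h1 z : cylp eps U z -> Num.sqrt (\det (Gp z)) = a z * sgR H z.
  move=> Pz; have z0 := r_gt0 _ Pz.
  rewrite detZ detGb -exprVn -exprM mulnC exprM sqrtrM ?sqr_ge0 //.
  have p : 0 <= (rcoord z)^-1 ^+ n.+1 by apply: exprn_ge0; rewrite invr_ge0 ltW.
  by rewrite sqrtr_sqr (ger0_norm p) exprVn.
have h2 z : cylp eps U z -> invmx (Gp z) = b z *: invmx (Gb H z).
  move=> Pz; have z0 := r_gt0 _ Pz.
  rewrite invmxZ ?invrK // unitmxE unitfE detZ mulf_neq0 //.
    by rewrite expf_neq0 // invr_neq0 // expf_neq0 // gt_eqF.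
  by rewrite detGb gt_eqF // (detH_gt0 posH) //; exact: sub.
have abE z : cylp eps U z -> (a z * b z)%:C = cpow (rcoord z) (1 - n%:R).
  move=> Pz; have z0 := r_gt0 _ Pz.
  rewrite cpowD // cpowN // cpow_nat // -[1 : R[i]]/(1%:R) cpow_nat // expr1.
  rewrite -(rmorphXn (real_complex R)) -fmorphV -rmorphM; congr _%:C.
  rewrite /a /b exprS expr2; field.
  by rewrite expf_neq0 ?gt_eqF.
have sHp i j : smooth_on (cylp eps U) (fun y => H y i j).
  exact: smooth_on_subset sub (sH i j).
have posHp z : cylp eps U z -> posdef (H z) by move=> /sub; exact: posH.
have se z := csm_cpow eps U z.
have sWp := csm_subset sub sW.
have ssg := csm_subset sub csm_sg.
have sdW := csm_subset sub (csm_cpd (i_r n) rC sW).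
have ssW := csmM ssg sWp; have ssdW := csmM ssg sdW.
have drE z : cylp eps U z -> dr (fun z => cpow (rcoord z) lam * W z) z =
    lam * cpow (rcoord z) (lam - 1) * W z + cpow (rcoord z) lam * dr W z.
  by move=> Pz; rewrite (cpdM _ rP (se lam) sWp Pz) (cpd_r_cpow oU _ Pz).
have dxE j z : cylp eps U z -> dx j (fun z => cpow (rcoord z) lam * W z) z =
    cpow (rcoord z) lam * dx j W z.
  by move=> Pz; rewrite (cpdM _ rP (se lam) sWp Pz) cpd_x_cpow mul0r add0r.
rewrite (cx_lap_conf rP posHp h1 h2 _ Py).
have E1 : dr (fun z => (a z * b z)%:C * ((sgR H z)%:C *
      dr (fun z => cpow (rcoord z) lam * W z) z)) y =
    lam * ((lam - n%:R) * cpow (rcoord y) (lam - n%:R - 1) * (sg y * W y) +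
      cpow (rcoord y) (lam - n%:R) * (dr sg y * W y + sg y * dr W y)) +
    ((lam + 1 - n%:R) * cpow (rcoord y) (lam - n%:R) * (sg y * dr W y) +
     cpow (rcoord y) (lam + 1 - n%:R) * dr (fun z => sg z * dr W z) y).
  transitivity (dr (fun z => lam * (cpow (rcoord z) (lam - n%:R) * (sg z * W z))
     + cpow (rcoord z) (lam + 1 - n%:R) * (sg z * dr W z)) y).
    apply: (cpd_ext _ rP _ Py) => z Pz; have z0 := r_gt0 _ Pz.
    have e1 : cpow (rcoord z) (lam - n%:R) = cpow (rcoord z) (1 - n%:R) * cpow (rcoord z) (lam - 1).
      by rewrite -cpowD //; congr cpow; ring.
    have e2 : cpow (rcoord z) (lam + 1 - n%:R) = cpow (rcoord z) (1 - n%:R) * cpow (rcoord z) lam.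
      by rewrite -cpowD //; congr cpow; ring.
    by rewrite abE // drE // -/(sg z) e1 e2; ring.
  rewrite (cpdD _ rP (csmZ _ (csmM (se _) ssW)) (csmM (se _) ssdW) Py).
  rewrite (cpdZ _ _ rP (csmM (se _) ssW) Py) (cpdM _ rP (se _) ssW Py).
  rewrite (cpdM _ rP (se _) ssdW Py) !(cpd_r_cpow oU _ Py) (cpdM _ rP ssg sWp Py).
  by rewrite (_ : lam + 1 - n%:R - 1 = lam - n%:R); last by ring.
have E2 : \sum_i dx i (fun z => (a z * b z)%:C *
      \sum_j (AR H i j z)%:C * dx j (fun z => cpow (rcoord z) lam * W z) z) y =
    cpow (rcoord y) (lam + 1 - n%:R) * \sum_i dx i (flux Ac W i) y.
  rewrite mulr_sumr; apply: eq_bigr => i _.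
  have sf : csm (cylp eps U) (flux Ac W i).
    by apply: csm_subset sub _; apply: csm_flux => // ? ?; exact: csm_Ac.
  transitivity (dx i (fun z => cpow (rcoord z) (lam + 1 - n%:R) * flux Ac W i z) y).
    apply: (cpd_ext _ rP _ Py) => z Pz; have z0 := r_gt0 _ Pz.
    have e2 : cpow (rcoord z) (lam + 1 - n%:R) = cpow (rcoord z) (1 - n%:R) * cpow (rcoord z) lam.
      by rewrite -cpowD //; congr cpow; ring.
    rewrite abE // /flux e2 -mulrA mulr_sumr; congr (_ * _); apply: eq_bigr => j _.
    by rewrite dxE // mulrCA.
  by rewrite (cpdM _ rP (se _) sf Py) cpd_x_cpow mul0r add0r.
rewrite E1 E2 /Op; have y0 := r_gt0 _ Py.
set X := dr (fun z => sg z * _) y; set Y := \sum_i _; set D := dr W y; set S := dr sg y.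
have rho : cpow (rcoord y) 1 = (rcoord y)%:C by rewrite -[1 : R[i]]/(1%:R) cpow_nat.
have aE : (a y)%:C = cpow (rcoord y) (- n%:R - 1).
  rewrite -opprD natr1 cpowN // cpow_nat // /a.
  by rewrite -(rmorphXn (real_complex R)) -fmorphV.
have -> : ((a y * sgR H y)^-1)%:C = (cpow (rcoord y) (- n%:R - 1))^-1 * (sg y)^-1.
  by rewrite -aE /sg -!(fmorphV (real_complex R)) -(rmorphM (real_complex R)) invfM.
have -> : lam - n%:R - 1 = lam + (- n%:R - 1) by ring.
have -> : lam - n%:R = lam + (- n%:R - 1) + 1 by ring.
have -> : lam + 1 - n%:R = lam + (- n%:R - 1) + 1 + 1 by ring.
rewrite !(cpowD _ _ y0) rho.
have s0 := sg_neq0 Cy.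
move: (sg y) (W y) X Y D S ((rcoord y)%:C) s0 => s w X Y D S r s0.
field.
by rewrite s0 !cpow_neq0.
Qed.

End CollarOperators.

(** * Decay and vanishing Taylor coefficients *)

Section TaylorVanishing.
Variables (R : realType) (n : nat) (eps : R) (U : set 'rV[R]_n).
Hypotheses (eps0 : 0 < eps) (oU : open U).
Local Notation C := (cyl eps U).
Let rC : ropen C := ropen_cyl oU.

Lemma pt_line r (x : 'rV[R]_n) : pt r x = pt 0 x + r *: evec R (i_r n).
Proof. by rewrite pt_evec_r add0r. Qed.

Lemma pt_r_continuous (x : 'rV[R]_n) : continuous (fun r => pt r x).
Proof.
have -> : (fun r => pt r x) = (fun r => pt 0 x + r *: evec R (i_r n)).
  by apply/funext => r; exact: pt_line.
by move=> r; exact: evec_continuous.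
Qed.

Lemma smooth_right_cvg F x : smooth_on C F -> U x ->
  F (pt r x) @[r --> 0^'+] --> F (pt 0 x).
Proof.
move=> sF Ux; have Cx := cyl0 eps0 Ux.
have [W [G [oW Wy CG E]]] := sF _ Cx.
rewrite -(E _ Cx Wy).
have cG : {for pt 0 x, continuous G} by have [h _] := CG 0%N; exact: h.
have cGp : G (pt r x) @[r --> 0^'+] --> G (pt 0 x).
  apply: cvg_at_right_filter.
  by apply: (@continuous_comp _ _ _ (fun r => pt r x) G 0) => //; exact: pt_r_continuous.
have nE : \forall r \near 0^'+, G (pt r x) = F (pt r x).
  near=> r; apply: E.
    by rewrite pt_line; near: r; exact: rC.
  by rewrite pt_line; near: r; exact: near_line.
by apply: cvg_trans cGp; exact: (near_eq_cvg nE).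
Unshelve. all: by end_near. Qed.

Lemma smooth_r_derive F x r : smooth_on C F -> U x -> 0 < r -> r < eps ->
  is_derive r 1 (fun s => F (pt s x)) (pder (i_r n) F (pt r x)).
Proof.
move=> sF Ux r0 r1.
have Cr : C (pt r x) by apply/cyl_pt; rewrite ltW.
have [W [G [oW Wy CG E D]]] := smooth_onP rC sF Cr.
rewrite D //.
have dG : derivable G (pt 0 x + r *: evec R (i_r n)) (evec R (i_r n)).
  by rewrite -pt_line; exact: (Ck_derivable CG Wy).
have := line_is_derive dG; rewrite -pt_line.
apply: near_eq_is_derive.
have nW : \forall s \near r, W (pt s x).
  by have := @pt_r_continuous x r; apply; exact: open_nbhs_nbhs.
have n0 : \forall s \near r, 0 < s by exact: lt_nbhsr.
have n1 : \forall s \near r, s < eps by exact: lt_nbhsl.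
near=> s; rewrite -pt_line E //.
  by apply/cyl_pt; split=> //; apply/andP; split; [apply: ltW|]; near: s.
by near: s.
Unshelve. all: by end_near. Qed.

(** Induction by l'Hospital's rule: differentiating numerator and denominator leaves the same limit
    for [pder (i_r n) F] and the exponent [k], up to the factor [k.+1]. *)
Lemma taylor_lim k F x : smooth_on C F -> U x ->
  (forall i, (i < k)%N -> iter i (pder (i_r n)) F (pt 0 x) = 0) ->
  F (pt r x) / r ^+ k @[r --> 0^'+] --> iter k (pder (i_r n)) F (pt 0 x) / k`!%:R.
Proof.
elim: k F => [|k IH] F sF Ux D0.
  rewrite fact0 divr1 /=; apply: cvg_trans (smooth_right_cvg sF Ux).
  by apply: near_eq_cvg; near=> r; rewrite expr0 divr1.
have e0 : 0 < eps by [].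
apply: (@lhopital_at_right R (fun r => F (pt r x)) (fun r => pder (i_r n) F (pt r x))
   (fun r => r ^+ k.+1) (fun r => k.+1%:R * r ^+ k) 0 eps) => //.
- move=> r; rewrite in_itv /= => /andP[r0 r1]; exact: smooth_r_derive.
- move=> r _; apply: DeriveDef; first exact: exprn_derivable.
  by rewrite exp_derive /GRing.scale /= mulr1.
- have F0 : F (pt 0 x) = 0 := D0 0%N isT.
  by have := smooth_right_cvg sF Ux; rewrite F0.
- rewrite -[X in _ --> X](expr0n R k.+1).
  by apply: cvg_at_right_filter; exact: exprn_continuous.
- move=> r; rewrite in_itv /= => /andP[r0 r1].
  by rewrite mulf_neq0 ?pnatr_eq0 // expf_neq0 // gt_eqF.
have IHp : pder (i_r n) F (pt r x) / r ^+ k @[r --> 0^'+] -->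
    iter k (pder (i_r n)) (pder (i_r n) F) (pt 0 x) / k`!%:R.
  apply: IH => // [|i ik]; first exact: smooth_on_pder.
  by rewrite -iterSr D0.
rewrite iterSr factS natrM invfM mulrCA.
have -> : (fun r : R => pder (i_r n) F (pt r x) / (k.+1%:R * r ^+ k)) =
   (fun r : R => k.+1%:R^-1 * (pder (i_r n) F (pt r x) / r ^+ k)).
  by apply/funext => r; rewrite invfM mulrCA.
by apply: cvgMl_tmp.
Unshelve. all: by end_near. Qed.

(** Strong induction: once the lower derivatives vanish, [F / r ^+ m] tends to the Taylor
    coefficient of order [m] by [taylor_lim], and to zero by the assumed decay. *)
Lemma smooth_vanish K F x : smooth_on C F -> U x ->
  F (pt r x) / r ^+ K @[r --> 0^'+] --> (0 : R) ->
  forall m, (m <= K)%N -> iter m (pder (i_r n)) F (pt 0 x) = 0.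
Proof.
move=> sF Ux cF; elim/ltn_ind => m IH mK.
have c1 := taylor_lim sF Ux (fun i im => IH i im (leq_trans (ltnW im) mK)).
have c2 : F (pt r x) / r ^+ m @[r --> 0^'+] --> (0 : R).
  have c3 : F (pt r x) / r ^+ K * r ^+ (K - m) @[r --> 0^'+] --> (0 * 0 ^+ (K - m) : R).
    apply: cvgM => //; apply: cvg_at_right_filter; exact: exprn_continuous.
  rewrite mul0r in c3; apply: cvg_trans c3; apply: near_eq_cvg; near=> r.
  have r0 : r != 0 by rewrite gt_eqF //; near: r; exact: nbhs_right_gt.
  rewrite -{1}(subnK mK) exprD invfM mulrA mulrAC mulfVK //.
  by rewrite expf_neq0.
have E : iter m (pder (i_r n)) F (pt 0 x) / m`!%:R = 0.
  by apply: cvg_unique c1 c2.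
move/eqP: E; by rewrite mulf_eq0 invr_eq0 pnatr_eq0 (negbTE (lt0n_neq0 (fact_gt0 m))) orbF => /eqP.
Unshelve. all: by end_near. Qed.

Lemma iter_cpd_parts k i (u : 'rV[R]_(1 + n) -> R[i]) y :
  iter k (cpd i) u y = iter k (pder i) (fun z => complex.Re (u z)) y +i*
                       iter k (pder i) (fun z => complex.Im (u z)) y.
Proof.
elim: k y => [|k IH] y; first by rewrite /=; case: (u y).
have E1 : (fun z => complex.Re (iter k (cpd i) u z)) = iter k (pder i) (fun z => complex.Re (u z)).
  by apply/funext => z; rewrite IH.
have E2 : (fun z => complex.Im (iter k (cpd i) u z)) = iter k (pder i) (fun z => complex.Im (u z)).
  by apply/funext => z; rewrite IH.
by rewrite !iterS -E1 -E2.
Qed.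

Lemma tc_vanish K u x : csm C u -> U x ->
  complex.Re `|u (pt r x)| / r ^+ K @[r --> 0^'+] --> (0 : R) ->
  forall m, (m <= K)%N -> tc m u x = 0.
Proof.
move=> [su1 su2] Ux cu m mK.
have sq (f : R[i] -> R) : (forall z, `|f z| <= complex.Re `|z|) ->
    f (u (pt r x)) / r ^+ K @[r --> 0^'+] --> (0 : R).
  move=> fle; apply/cvgrPdist_le => e e0.
  have /cvgrPdist_le/(_ e e0) := cu; apply: filterS2 (nbhs_right_gt 0) => r r0.
  rewrite !sub0r !normrN => h; apply: le_trans h.
  rewrite !normrM ler_wpM2r // [X in _ <= X]ger0_norm ?fle //.
  by apply: le_trans (fle (u (pt r x))).
have h1 : iter m (pder (i_r n)) (fun z => complex.Re (u z)) (pt 0 x) = 0.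
  apply: (smooth_vanish su1 Ux _ mK); apply: (sq (@complex.Re R)) => z.
  by have := normc_ge_Re z; rewrite normc_def lecR.
have h2 : iter m (pder (i_r n)) (fun z => complex.Im (u z)) (pt 0 x) = 0.
  apply: (smooth_vanish su2 Ux _ mK); apply: (sq (@complex.Im R)) => z.
  rewrite normc_def /= -sqrtr_sqr ler_sqrt; last by rewrite addr_ge0 ?sqr_ge0.
  by rewrite lerDr sqr_ge0.
by rewrite /tc iter_cpd_parts h1 h2 (_ : 0 +i* 0 = 0) // mul0r.
Qed.

End TaylorVanishing.

(** * Integration and test functions *)

Section IntegralOnLine.
Variable R : realType.
Local Notation mu := (@lebesgue_measure R).
Implicit Types (g : R -> R) (K : R).

Definition cc1 K g := continuous g /\ forall t, K <= `|t| -> g t = 0.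

Definition line_int g : R := \int[mu]_(t in [set: R]) g t.

Lemma cc1_restrict K g : cc1 K g -> g = g \_ `[- K, K].
Proof.
move=> [_ gK]; apply/funext => t; rewrite patchE; case: ifPn => // /negP tK.
apply: gK; rewrite leNgt ltr_norml; apply/negP => /andP[t1 t2]; apply: tK.
by apply/mem_set; rewrite /= in_itv /= !ltW.
Qed.

Lemma cc1_integrable_itv g (a b : R) : continuous g -> mu.-integrable `[a, b] (EFin \o g).
Proof.
move=> cg; apply: continuous_compact_integrable; first exact: segment_compact.
exact: continuous_subspaceT.
Qed.

Lemma cc1_integrable K g : cc1 K g -> mu.-integrable setT (EFin \o g).
Proof.
move=> cg; rewrite (cc1_restrict cg).
have -> : EFin \o (g \_ `[- K, K]) = (EFin \o g) \_ `[- K, K] by rewrite restrict_EFin.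
apply/(integrable_mkcond _ _).1 => //; exact: cc1_integrable_itv cg.1.
Qed.

Lemma line_intE K g : cc1 K g -> line_int g = \int[mu]_(t in `[- K, K]) g t.
Proof. by move=> cg; rewrite /line_int {1}(cc1_restrict cg) -Rintegral_mkcond. Qed.

Lemma line_int_lin K a g g' : cc1 K g -> cc1 K g' -> line_int (fun t => g t + a * g' t) = line_int g + a * line_int g'.
Proof.
move=> cg cg'; rewrite /line_int RintegralD //.
- by rewrite RintegralZl //; exact: cc1_integrable cg'.
- exact: cc1_integrable cg.
apply: (@cc1_integrable K); split=> [t|t tK].
  by apply: continuousM; [exact: cst_continuous|exact: cg'.1].
by rewrite cg'.2 ?mulr0.
Qed.

Lemma mu_itv (a b : R) : a <= b -> fine (mu `[a, b]) = b - a.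
Proof.
move=> ab; rewrite lebesgue_measure_itv /= lte_fin; case: ltgtP ab => // -> _.
by rewrite subrr.
Qed.

Lemma line_int_bound K B g : 0 <= K -> cc1 K g -> (forall t, `|g t| <= B) -> `|line_int g| <= B * (K + K).
Proof.
move=> K0 cg gB; rewrite (line_intE cg).
have ci : mu.-integrable `[- K, K] (EFin \o g) by exact: cc1_integrable_itv cg.1.
apply: (le_trans (le_normr_Rintegral _ ci)) => //.
have -> : B * (K + K) = \int[mu]_(t in `[- K, K]) (cst B t).
  by rewrite Rintegral_cst // mu_itv ?opprK // (le_trans _ K0) // oppr_le0.
apply: le_Rintegral => // [|].
  apply: (@cc1_integrable_itv (fun t => `|g t|)) => t.
  by apply: continuous_comp; [exact: cg.1|exact: norm_continuous].
by apply: cc1_integrable_itv => t; exact: cst_continuous.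
Qed.

Lemma line_int_derive0 K g (dg : R -> R) : 0 < K -> cc1 K g -> cc1 K dg ->
  (forall t : R, is_derive t 1 g (dg t)) -> line_int dg = 0.
Proof.
move=> K0 cg dgK gd.
have cdg := dgK.1.
rewrite (line_intE dgK) /Rintegral.
have cgt t : {for t, continuous g} by exact: cg.1.
rewrite (@continuous_FTC2 _ dg g) //.
- by rewrite -EFinB /= !cg.2 ?subrr ?normrN ?ger0_norm // ltW.
- by rewrite (lt_trans _ K0) // oppr_lt0.
- exact: continuous_subspaceT.
- split=> [t _| |].
  + by case: (gd t).
  + by apply: cvg_at_right_filter; exact: cgt.
  + by apply: cvg_at_left_filter; exact: cgt.
by move=> t _; rewrite derive1E; case: (gd t).
Qed.

Lemma line_int_ge0 g : (forall t, 0 <= g t) -> 0 <= line_int g.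
Proof. by move=> g0; apply: Rintegral_ge0. Qed.

(** By continuity [g] stays above [g t0 / 2] on an interval around [t0]; the integral of that
    constant over the interval is a positive lower bound. *)
Lemma line_int_gt0 K g t0 : cc1 K g -> (forall t, 0 <= g t) -> 0 < g t0 -> 0 < line_int g.
Proof.
move=> cg g0 gt0.
have [d /= d0 dP] : exists2 d : R, 0 < d & forall t, `|t0 - t| <= d -> g t0 / 2 <= g t.
  have n1 : \forall t \near t0, g t0 / 2 < g t.
    apply: (cg.1 t0 [set u | g t0 / 2 < u]); apply: lt_nbhsr.
    by rewrite ltr_pdivrMr // ltr_pMr // ltr1n.
  have [d d0 dP] := (nbhs_ballP _ _).1 n1; exists (d / 2); first by rewrite divr_gt0.
  move=> t td; apply: ltW; apply: dP; rewrite /ball /= (le_lt_trans td) //.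
  by rewrite ltr_pdivrMr // ltr_pMr // ltr1n.
pose J : set R := `[t0 - d, t0 + d]%classic.
have E : \int[mu]_(t in J) (cst (g t0 / 2) t) = g t0 / 2 * (d + d).
  rewrite Rintegral_cst; last exact: measurable_itv.
  rewrite /J mu_itv; first by congr (_ * _); ring.
  by lra.
have p : 0 < g t0 / 2 * (d + d) by rewrite mulr_gt0 ?divr_gt0 ?addr_gt0.
apply: (lt_le_trans p); rewrite -E Rintegral_mkcond.
have mJ : measurable J by exact: measurable_itv.
apply: le_Rintegral => //.
- have -> : EFin \o ((cst (g t0 / 2)) \_ J) = (EFin \o cst (g t0 / 2)) \_ J by rewrite restrict_EFin.
  apply/(integrable_mkcond _ _).1 => //; apply: cc1_integrable_itv => t; exact: cst_continuous.
- exact: cc1_integrable cg.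
move=> t _; rewrite patchE; case: ifPn => // /set_mem; rewrite /J /= in_itv /= => /andP[t1 t2].
by apply: dP; rewrite ler_norml; apply/andP; split; lra.
Qed.

End IntegralOnLine.

Section IteratedIntegral.
Variable R : realType.

(** The size [K] of the support is kept explicit because the bound on [rvint] and the uniform
    continuity of slices depend on it. *)
Definition cc m (K : R) (F : 'rV[R]_m -> R) :=
  continuous F /\ forall y : 'rV[R]_m, (exists i, K <= `|y 0 i|) -> F y = 0.

Lemma cc_lin m K a (F G : 'rV[R]_m -> R) : cc K F -> cc K G -> cc K (fun y => F y + a * G y).
Proof.
move=> [cF F0] [cG G0]; split=> [y|y yK]; last by rewrite F0 // G0 // mulr0 addr0.
suff : {for y, continuous (fun y => F y + a * G y)} by [].
by apply: continuousD; [exact: cF|apply: continuousM; [exact: cst_continuous|exact: cG]].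
Qed.

Lemma cc_slice m K t (F : 'rV[R]_(1 + m) -> R) : cc K F -> cc K (fun y => F (pt t y)).
Proof.
move=> [cF F0]; split=> [y|y [i yi]].
  by apply: (@continuous_comp _ _ _ (fun y => pt t y)); [exact: pt_continuous|exact: cF].
by apply: F0; exists (i_x i); rewrite /pt /i_x row_mxEr.
Qed.

Lemma cc_slice0 m K t (F : 'rV[R]_(1 + m) -> R) y : cc K F -> K <= `|t| -> F (pt t y) = 0.
Proof.
by move=> [_ F0] tK; apply: F0; exists (i_r m); rewrite /pt /i_r row_mxEl mxE eqxx mulr1n.
Qed.

(** Compactness of the cube of points with coordinates in [[- K, K]] makes continuity uniform in
    [y]; outside the cube both slices vanish. *)
Lemma slice_near m K (F : 'rV[R]_(1 + m) -> R) (t0 e : R) : cc K F -> 0 < e ->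
  \forall t \near t0, forall y, `|F (pt t y) - F (pt t0 y)| < e.
Proof.
move=> cF e0.
pose B := [set y : 'rV[R]_m | forall i, [set` `[- K, K]] (y 0 i)].
have cB : compact B by apply: (@rV_compact R m (fun=> [set` `[- K, K]])) => i; exact: segment_compact.
have /compact_near_coveringP/(_ R (nbhs t0) (fun t y => `|F (pt t y) - F (pt t0 y)| < e) _) := cB.
case=> [y _|d /= d0 dP].
  have e20 : 0 < e / 2 by rewrite divr_gt0.
  have [d /= d0 dP] : exists2 d : R, 0 < d & forall z, ball (pt t0 y) d z -> `|F (pt t0 y) - F z| < e / 2.
    have h : \forall z \near pt t0 y, `|F (pt t0 y) - F z| < e / 2.
      by have /cvgr_dist_lt := cF.1 (pt t0 y); apply.
    have [d d0 dP] := (nbhs_ballP _ _).1 h; by exists d.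
  exists (ball y d, ball t0 d); first by split; exact: nbhsx_ballx.
  move=> [z t] [/= zd td].
  have b1 s : ball t0 d s -> ball (pt t0 y) d (pt s z).
    move=> sd; split=> // i j; rewrite /pt !mxE; case: splitP => k _; last by case: zd.
    by rewrite !mxE; case: (_ == _); rewrite ?mulr1n ?mulr0n //; exact: ballxx.
  have h1 := dP _ (b1 t td); have h2 := dP _ (b1 t0 (ballxx _ d0)).
  apply: le_lt_trans (ler_distD (F (pt t0 y)) _ _) _; rewrite (splitr e).
  by apply: ltrD => //; rewrite distrC.
apply/nbhs_ballP; exists d => // t td y; have [By|nBy] := pselect (B y); first exact: dP.
suff [i yi] : exists i, K <= `|y 0 i|.
  have z s : F (pt s y) = 0 by apply: (cc_slice s cF).2; exists i.
  by rewrite !z subrr normr0.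
apply: contrapT => nE; apply: nBy => i; rewrite /= in_itv /= -ler_norml.
by apply: ltW; rewrite ltNge; apply/negP => h; apply: nE; exists i.
Qed.

(** Linearity and the bound in dimension [m] are hypotheses because they are proved by induction on
    the dimension, and the induction step needs the partial integral to be continuous, which is what
    they yield here. *)
Lemma cc1_slice_of m :
  (forall K a (F G : 'rV[R]_m -> R), 0 <= K -> cc K F -> cc K G ->
    rvint (fun y => F y + a * G y) = rvint F + a * rvint G) ->
  (forall K B (F : 'rV[R]_m -> R), 0 <= K -> cc K F -> (forall y, `|F y| <= B) ->
    `|rvint F| <= B * (K + K) ^+ m) ->
  forall K (F : 'rV[R]_(1 + m) -> R), 0 <= K -> cc K F ->
    cc1 K (fun t => rvint (fun y => F (pt t y))).
Proof.
move=> lin bound K F K0 cF; split=> [t0|t tK]; last first.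
  have -> : (fun y => F (pt t y)) = (fun y => F (pt t y) + (-1) * F (pt t y)).
    by apply/funext => y; rewrite (cc_slice0 _ cF tK) mulr0 addr0.
  by rewrite (lin K) ?mulN1r ?subrr //; exact: cc_slice.
apply/cvgrPdist_le => e e0.
(* The summand 1 makes [M] positive, so that one may divide by it; [e / M] times the volume of the
   cube remains at most [e]. *)
pose M := (K + K) ^+ m + 1.
have M0 : 0 < M by rewrite ltr_wpDl // exprn_ge0 // addr_ge0.
have := slice_near t0 cF (divr_gt0 e0 M0); apply: filterS => t tP.
have -> : rvint (fun y => F (pt t0 y)) - rvint (fun y => F (pt t y)) =
    rvint (fun y => F (pt t0 y) + (-1) * F (pt t y)).
  by rewrite (lin K) ?mulN1r //; exact: cc_slice.
apply: le_trans (bound K (e / M) _ K0 _ _) _.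
- by apply: cc_lin; exact: cc_slice.
- by move=> y; rewrite mulN1r distrC; exact: ltW.
by rewrite -mulrA ler_piMr ?(ltW e0) // mulrC ler_pdivrMr // mul1r lerDl.
Qed.

Lemma rvint_lin_bound m : (forall K a (F G : 'rV[R]_m -> R), 0 <= K -> cc K F -> cc K G ->
    rvint (fun y => F y + a * G y) = rvint F + a * rvint G) /\
  (forall K B (F : 'rV[R]_m -> R), 0 <= K -> cc K F -> (forall y, `|F y| <= B) ->
    `|rvint F| <= B * (K + K) ^+ m).
Proof.
elim: m => [|m [IH1 IH2]].
  split=> [K a F G _ _ _ //|K B F _ _ FB /=]; by rewrite expr0 mulr1.
have sl := cc1_slice_of IH1 IH2.
split=> [K a F G K0 cF cG|K B F K0 cF FB].
  rewrite -[RHS]/(line_int _ + a * line_int _) -(line_int_lin a (sl K F K0 cF) (sl K G K0 cG)).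
  rewrite -[LHS]/(line_int _); congr line_int; apply/funext => t.
  exact: (IH1 K a _ _ K0 (cc_slice t cF) (cc_slice t cG)).
rewrite -[rvint F]/(line_int _) exprSr mulrA.
apply: line_int_bound => //; first exact: sl.
by move=> t; apply: IH2 => //; exact: cc_slice.
Qed.

Lemma rvint_lin m K a (F G : 'rV[R]_m -> R) : 0 <= K -> cc K F -> cc K G ->
  rvint (fun y => F y + a * G y) = rvint F + a * rvint G.
Proof. by move=> K0; exact: (rvint_lin_bound m).1. Qed.

Lemma rvint_bound m K B (F : 'rV[R]_m -> R) : 0 <= K -> cc K F ->
  (forall y, `|F y| <= B) -> `|rvint F| <= B * (K + K) ^+ m.
Proof. exact: (rvint_lin_bound m).2. Qed.

Lemma rvint_sub m K (F G : 'rV[R]_m -> R) : 0 <= K -> cc K F -> cc K G ->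
  rvint F - rvint G = rvint (fun y => F y - G y).
Proof.
move=> K0 cF cG; rewrite -[- rvint G]mulN1r -(rvint_lin _ K0 cF cG).
by congr rvint; apply/funext => y; rewrite mulN1r.
Qed.

Lemma rvint0 m : rvint (fun _ : 'rV[R]_m => 0) = 0.
Proof.
elim: m => [//|m IH]; rewrite -[LHS]/(line_int (fun _ => rvint (fun _ : 'rV[R]_m => 0))) IH.
by rewrite /line_int Rintegral_cst // mul0r.
Qed.

Lemma cc1_slice m K (F : 'rV[R]_(1 + m) -> R) : 0 <= K -> cc K F ->
  cc1 K (fun t => rvint (fun y => F (pt t y))).
Proof.
by have [lin bound] := rvint_lin_bound m; exact: (cc1_slice_of lin bound).
Qed.

Lemma slice_is_derive m (F : 'rV[R]_(1 + m) -> R) y (t : R) :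
  (forall y, derivable F y (evec R (i_r m))) ->
  is_derive t 1 (fun t => F (pt t y)) ('D_(evec R (i_r m)) F (pt t y)).
Proof.
move=> dF; have := @line_is_derive R (1 + m) F (pt 0 y) (evec R (i_r m)) t (dF _).
rewrite -pt_line.
have -> // : (fun t => F (pt 0 y + t *: evec R (i_r m))) = (fun t => F (pt t y)).
by apply/funext => s; rewrite -pt_line.
Qed.

Lemma derive_slice m (F : 'rV[R]_(1 + m) -> R) (t : R) j y :
  'D_(evec R j) (fun y => F (pt t y)) y = 'D_(evec R (i_x j)) F (pt t y) /\
  (derivable F (pt t y) (evec R (i_x j)) -> derivable (fun y => F (pt t y)) y (evec R j)).
Proof.
have E : (fun h : R => h^-1 *: (((fun y => F (pt t y)) \o shift y) (h *: evec R j) - F (pt t y))) =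
  (fun h : R => h^-1 *: ((F \o shift (pt t y)) (h *: evec R (i_x j)) - F (pt t y))).
  by apply/funext => h /=; rewrite [_ + pt t y]addrC pt_evec_x [y + _]addrC.
by split; [rewrite /derive E|rewrite /derivable E].
Qed.

Lemma mvt_between (f df : R -> R) (a h : R) : (forall t : R, is_derive t 1 f (df t)) ->
  exists2 c, `|c - a| <= `|h| & f (a + h) - f a = df c * h.
Proof.
move=> fd; have cf (x y : R) : {within `[x, y], continuous f}.
  by apply: derivable_within_continuous => t _; case: (fd t).
have [h0|h0] := leP 0 h.
  have [|c] := @MVT_segment R f df a (a + h) _ (fun x _ => fd x) (cf _ _).
    by rewrite lerDl.
  rewrite in_itv /= => /andP[c1 c2] E; exists c; last by rewrite E; congr (_ * _); ring.
  by rewrite (ger0_norm h0) ger0_norm; lra.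
have [|c] := @MVT_segment R f df (a + h) a _ (fun x _ => fd x) (cf _ _).
  by rewrite gerDl ltW.
rewrite in_itv /= => /andP[c1 c2] E; exists c.
  by rewrite (ltr0_norm h0) ler0_norm; lra.
by rewrite -opprB E; ring.
Qed.

(** In a direction other than the first, the induction hypothesis applies to every slice. In the
    first direction the derivative is moved out of the inner integral and the fundamental theorem of
    calculus finishes on the line. *)
Lemma rvint_derive0 m K (F : 'rV[R]_m -> R) i : 0 < K -> cc K F ->
  (forall y, derivable F y (evec R i)) -> cc K (fun y => 'D_(evec R i) F y) ->
  rvint (fun y => 'D_(evec R i) F y) = 0.
Proof.
move=> K0; elim: m F i => [F [] //|m IH] F i cF dF cdF.
case: (@idx_case m i) => [ir|[j ij]]; last first.
  rewrite -[LHS]/(line_int (fun t => rvint (fun y => 'D_(evec R i) F (pt t y)))).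
  have -> : (fun t => rvint (fun y => 'D_(evec R i) F (pt t y))) = cst 0.
    apply/funext => t.
    have E : (fun y => 'D_(evec R i) F (pt t y)) = (fun y => 'D_(evec R j) (fun y => F (pt t y)) y).
      by apply/funext => y; rewrite ij (derive_slice F t j y).1.
    rewrite E; apply: IH.
    - exact: cc_slice.
    - by move=> y; apply: (derive_slice F t j y).2; rewrite -ij.
    - by rewrite -E; exact: (cc_slice t cdF).
  by rewrite /line_int Rintegral_cst // mul0r.
subst i; set i := i_r m.
rewrite -[LHS]/(line_int (fun t => rvint (fun y => 'D_(evec R i) F (pt t y)))).
have K00 := ltW K0.
apply: (line_int_derive0 K0 (cc1_slice K00 cF) (cc1_slice K00 cdF)) => t.
pose M := (K + K) ^+ m + 1.
have M0 : 0 < M by rewrite ltr_wpDl // exprn_ge0 // addr_ge0.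
pose q (h : R) := h^-1 *: (((fun t => rvint (fun y => F (pt t y))) \o shift t) (h *: (1 : R))
   - rvint (fun y => F (pt t y))).
(* Differentiation under the integral sign: by the mean value theorem the difference quotient at [y]
   is the derivative on some slice between [t] and [t + h], which [slice_near] compares with the
   slice at [t] uniformly in [y]. *)
suff C : q h @[h --> 0^'] --> rvint (fun y => 'D_(evec R i) F (pt t y)).
  by apply: DeriveDef; [apply/cvg_ex; eexists; exact: C|apply: cvg_lim => //; exact: C].
apply/cvgrPdist_le => e e0.
have [d /= d0 dP] := (nbhs_ballP _ _).1 (slice_near t cdF (divr_gt0 e0 M0)).
have nd : \forall h \near (0 : R)^', h != 0 /\ `|h| < d.
  near=> h; split; first by near: h; exact: nbhs_dnbhs_neq.
  near: h; apply: nbhs_dnbhs; apply/nbhs_ballP; exists d => // h.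
  by rewrite /ball /= sub0r normrN.
apply: filterS nd => h [h0 hd].
have qE : q h = rvint (fun y => 0 + h^-1 * (F (pt (h + t) y) - F (pt t y))).
  have c1 := cc_slice (h + t) cF; have c2 := cc_slice t cF.
  rewrite (@rvint_lin _ K h^-1 (fun=> 0) (fun y => F (pt (h + t) y) - F (pt t y))) //.
  - rewrite rvint0 add0r -(rvint_sub K00 c1 c2) /q /= [h *: 1]mulr1.
    by [].
  - by split=> // y; exact: cst_continuous.
  by have := cc_lin (-1) c1 c2; under eq_fun => y do rewrite mulN1r.
have cq : cc K (fun y => 0 + h^-1 * (F (pt (h + t) y) - F (pt t y))).
  apply: cc_lin; first by split=> // y; exact: cst_continuous.
  have := cc_lin (-1) (cc_slice (h + t) cF) (cc_slice t cF).
  by under eq_fun => y do rewrite mulN1r.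
rewrite qE (rvint_sub K00 (cc_slice t cdF) cq).
apply: le_trans (@rvint_bound _ K (e / M) _ K00 _ _) _.
- have := cc_lin (-1) (cc_slice t cdF) cq.
  by under eq_fun => y do rewrite mulN1r.
- move=> y; rewrite add0r.
  have [c cb E] := @mvt_between (fun s => F (pt s y)) _ t h (fun s => slice_is_derive y s dF).
  rewrite [h + t]addrC E mulrC mulfK //; apply: ltW; rewrite distrC; apply: dP.
  by rewrite /ball /= distrC; exact: le_lt_trans cb hd.
rewrite -mulrA ler_piMr ?(ltW e0) // mulrC ler_pdivrMr // mul1r.
by rewrite lerDl.
Unshelve. all: by end_near. Qed.

Lemma rvint_gt0 m K (F : 'rV[R]_m -> R) y0 : 0 < K -> cc K F ->
  (forall y, 0 <= F y) -> 0 < F y0 -> 0 < rvint F.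
Proof.
move=> K0; elim: m F y0 => [F y0 _ _|m IH F y0 cF F0 Fy0].
  by rewrite (_ : y0 = 0) //; apply/rowP => -[].
have ge0 k (G : 'rV[R]_k -> R) : (forall y, 0 <= G y) -> 0 <= rvint G.
  elim: k G => [G G0|k IHk G G0]; first exact: G0.
  by apply: line_int_ge0 => t; apply: IHk.
rewrite -[rvint F]/(line_int (fun t => rvint (fun y => F (pt t y)))).
apply: (@line_int_gt0 R K _ (rcoord y0)).
- by apply: cc1_slice => //; exact: ltW.
- by move=> t; exact: ge0.
by apply: (IH _ (xcoord y0)) => //; [exact: cc_slice|rewrite pt_coord].
Qed.

End IteratedIntegral.

(** * A flat smooth function and bump functions *)

Section FlatFunction.
Variable R : realType.
Implicit Types (p q : {poly R}) (s t : R).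

(* A family closed under differentiation. *)
Definition flat p t : R := if 0 < t then p.[t^-1] * expR (- t^-1) else 0.

Lemma poly_bound p : exists2 B, 0 <= B & forall s, 1 <= s -> `|p.[s]| <= B * s ^+ size p.
Proof.
exists (\sum_(i < size p) `|p`_i|); first by apply: sumr_ge0.
move=> s s1; have s0 : 0 <= s by rewrite (le_trans ler01).
rewrite horner_coef (le_trans (ler_norm_sum _ _ _)) // mulr_suml; apply: ler_sum => i _.
rewrite normrM ler_wpM2l // normrX ger0_norm //.
by apply: ler_weXn2l => //; exact: ltnW.
Qed.

(** The exponential dominates a power one degree above the one that bounds [p]; the spare power is
    the decay [1 / s]. *)
Lemma poly_exp_bound p : exists2 B, 0 <= B & forall s, 1 <= s -> `|p.[s] * expR (- s)| <= B / s.
Proof.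
have [B B0 pB] := poly_bound p; set k := size p in pB.
exists (B * k.+1`!%:R); first by rewrite mulr_ge0.
move=> s s1; have s0 : 0 < s by rewrite (lt_le_trans ltr01).
rewrite normrM (ger0_norm (expR_ge0 _)) expRN.
have e0 := expR_gt0 s.
rewrite ler_pdivrMr // (le_trans (pB s s1)) //.
rewrite -!mulrA ler_wpM2l // mulrCA ler_pdivlMl // -exprS.
have h := expR_ge1Dxn k (ltW s0).
rewrite mulrC -ler_pdivrMr ?ltr0n ?fact_gt0 //.
by apply: le_trans h; rewrite lerDr.
Qed.

(** The derivative of [p(1/t) exp(-1/t)] is [t^-2 (p - p')(1/t) exp(-1/t)], and ['X^2] evaluated at
    [1/t] is [t^-2]. *)
Definition flatS p : {poly R} := 'X^2 * (p - p^`()).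

Lemma flat_is_derive p t : is_derive t 1 (flat p) (flat (flatS p) t).
Proof.
have [t0|t0|<-] := ltgtP 0 t.
- have tV : is_derive t 1 (fun t => t^-1) (- t ^- 2).
    have := @is_deriveV R id t 1 1 (lt0r_neq0 t0) _.
    by move=> h; apply: is_derive_eq; rewrite /GRing.scale /= mulr1.
  have h : is_derive t 1 (fun t => p.[t^-1] * expR (- t^-1)) (flat (flatS p) t).
    have d1 : is_derive t 1 (fun t => p.[t^-1]) (p^`().[t^-1] * - t ^- 2).
      exact: (@is_derive1_comp _ (horner p) (fun t => t^-1) t _ _ (is_derive_poly p _) tV).
    have d2 : is_derive t 1 (fun t => expR (- t^-1)) (expR (- t^-1) * - (- t ^- 2)).
      exact: (@is_derive1_comp _ expR (fun t => - t^-1) t _ _ (is_derive_expR _) _).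
    apply: is_derive_eq; rewrite /flat t0 /flatS !hornerE /GRing.scale /=.
    rewrite exprVn; ring.
  apply: near_eq_is_derive h; have : \forall s \near t, 0 < s by exact: lt_nbhsr.
  by apply: filterS => s s0; rewrite /flat s0.
- have h : is_derive t 1 (cst 0 : R -> R) (flat (flatS p) t).
    by rewrite /flat ltNge (ltW t0); exact: is_derive_cst.
  apply: near_eq_is_derive h; have : \forall s \near t, s < 0 by exact: lt_nbhsl.
  by apply: filterS => s s0; rewrite /flat ltNge (ltW s0).
have f0 q : flat q 0 = 0 by rewrite /flat ltxx.
rewrite f0; pose q (h : R) := h^-1 *: ((flat p \o shift 0) (h *: (1 : R)) - flat p 0).
suff C : q h @[h --> 0^'] --> (0 : R).
  by apply: DeriveDef; [apply/cvg_ex; exists 0; exact: C|apply: cvg_lim => //; exact: C].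
(* The difference quotient at 0 is [p(1/h) exp(-1/h) / h] for [h > 0]; the factor ['X] accounts for
   the division by [h], and the bound becomes [B * h]. *)
have [B B0 pB] := poly_exp_bound ('X * p).
apply/cvgrPdist_le => e e0.
pose d := e / (B + 1).
have d0 : 0 < d by rewrite divr_gt0 // ltr_wpDl.
have nd : \forall h \near (0 : R)^', h != 0 /\ (`|h| < d /\ `|h| < 1).
  near=> h; split; first by near: h; exact: nbhs_dnbhs_neq.
  split; near: h; apply: nbhs_dnbhs; apply/nbhs_ballP.
    by exists d => // h; rewrite /ball /= sub0r normrN.
  by exists 1 => //= h; rewrite /ball /= sub0r normrN.
apply: filterS nd => h [h0 [hd h1]].
rewrite sub0r normrN /q /= addr0 [h *: 1]mulr1 f0 subr0 /flat.
case: ifPn => hp; last by rewrite scaler0 normr0 ltW.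
have := pB h^-1; rewrite !hornerE invrK => H.
have {}H := H _; rewrite /GRing.scale /= mulrA.
apply: le_trans (H _) _.
  by rewrite invf_ge1 // ltW // (le_lt_trans (ler_norm _) h1).
rewrite (le_trans (ler_wpM2l B0 (ltW (le_lt_trans (ler_norm h) hd)))) //.
rewrite /d mulrCA ler_piMr ?(ltW e0) // ler_pdivrMr ?mul1r ?lerDl // ltr_wpDl //.
Unshelve. all: by end_near. Qed.

Lemma smooth_on_flat m (A : set 'rV[R]_m) F : smooth_on A F -> smooth_on A (fun y => flat 1 (F y)).
Proof.
move=> sF y Ay; have [W [G [oW Wy CG E]]] := sF y Ay.
exists W, (fun z => flat 1 (G z)); split=> //; last by move=> z Az Wz; rewrite E.
move=> k; pose g j := flat (iter j flatS 1).
apply: (@Ck_comp R m W G setT g oW _ _ k 0%N (CG k)) => // j t _.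
exact: flat_is_derive.
Qed.

Lemma flat_gt0 t : 0 < t -> 0 < flat 1 t.
Proof. by move=> t0; rewrite /flat t0 hornerC mul1r expR_gt0. Qed.

Lemma flat_le0 t : t <= 0 -> flat 1 t = 0.
Proof. by move=> t0; rewrite /flat ltNge t0. Qed.

Lemma flat_ge0 t : 0 <= flat 1 t.
Proof. by have [/flat_le0 ->|/flat_gt0/ltW] := leP t 0. Qed.

(** For [d > 0] it is positive exactly on the open cube of half-side [d] about [x0]; each coordinate
    contributes one cut-off for either face. *)
Definition box_bump m (x0 : 'rV[R]_m) (d : R) (x : 'rV[R]_m) : R :=
  \prod_i (flat 1 (d - (x 0 i - x0 0 i)) * flat 1 (d + (x 0 i - x0 0 i))).

Lemma bump_ge0 m (x0 x : 'rV[R]_m) (d : R) : 0 <= box_bump x0 d x.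
Proof. by apply: prodr_ge0 => i _; rewrite mulr_ge0 ?flat_ge0. Qed.

Lemma bump_gt0 m (x0 : 'rV[R]_m) d : 0 < d -> 0 < box_bump x0 d x0.
Proof. by move=> d0; apply: prodr_gt0 => i _; rewrite subrr subr0 addr0 mulr_gt0 ?flat_gt0. Qed.

Lemma bump_eq0 m (x0 x : 'rV[R]_m) (d : R) i : d <= `|x 0 i - x0 0 i| -> box_bump x0 d x = 0.
Proof.
move=> h; rewrite /box_bump (bigD1 i) //=.
suff -> : flat 1 (d - (x 0 i - x0 0 i)) * flat 1 (d + (x 0 i - x0 0 i)) = 0 by rewrite mul0r.
move: h; rewrite ler_normr => /orP[h|h].
  by rewrite flat_le0 ?mul0r // subr_le0.
have -> : flat 1 (d + (x 0 i - x0 0 i)) = 0 by apply: flat_le0; rewrite -lerBrDr sub0r.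
by rewrite mulr0.
Qed.

Lemma smooth_on_bump_comp m k (A : set 'rV[R]_m) (x0 : 'rV[R]_k) d (F : 'rV[R]_m -> 'rV[R]_k) :
  (forall i, smooth_on A (fun y => F y 0 i)) -> smooth_on A (fun y => box_bump x0 d (F y)).
Proof.
move=> sF; apply: smooth_on_prod => i _; apply: smooth_onM; apply: smooth_on_flat.
  apply: smooth_onB; first exact: smooth_on_cst.
  by apply: smooth_onB; [exact: sF|exact: smooth_on_cst].
apply: smooth_onD; first exact: smooth_on_cst.
by apply: smooth_onB; [exact: sF|exact: smooth_on_cst].
Qed.

End FlatFunction.

(** * Integration by parts in a coordinate patch *)

Section PatchIntegral.
Variables (R : realType) (n : nat) (U K : set 'rV[R]_n).
Hypotheses (oU : open U) (cK : compact K) (KU : K `<=` U).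
Implicit Types (F : 'rV[R]_n -> R) (g : 'rV[R]_n -> R[i]).
Let rU : ropen U := open_ropen oU.

Definition vanish_off (T : nmodType) (g : 'rV[R]_n -> T) := forall x, U x -> ~ K x -> g x = 0.

Lemma closedK : closed K.
Proof. by apply: compact_closed => //; exact: norm_hausdorff. Qed.

Lemma boundK : exists2 M : R, 0 < M & forall y, K y -> forall i, `|y 0 i| < M.
Proof.
have /ex_strict_bound_gt0[M M0 MK] := compact_bounded cK.
exists M => // y Ky i; apply: le_lt_trans (MK _ Ky).
have -> : `|y| = mx_norm y by [].
by rewrite mx_normrE; apply: (le_bigmax _ (fun ij : 'I_1 * 'I_n => `|y ij.1 ij.2|) (0, i)).
Qed.

Lemma Ck_local k (A : set 'rV[R]_n) F :
  (forall y, A y -> exists W, [/\ open W, W y & Ck k W F]) -> Ck k A F.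
Proof.
elim: k F => [|k IH] F H; split.
- by move=> y /H[W [_ Wy [cF _]]]; exact: cF.
- by [].
- by move=> y /H[W [_ Wy [cF _]]]; exact: cF.
move=> i; split=> [y /H[W [_ Wy [_ /(_ i) [d _]]]]|]; first exact: d.
by apply: IH => y /H[W [oW Wy [_ /(_ i) [_ d]]]]; exists W.
Qed.

Lemma off_support F y : vanish_off F -> ~ K y -> (F \_ U) y = 0.
Proof. by move=> F0 nK; rewrite patchE; case: ifPn => // /set_mem Uy; exact: F0. Qed.

(** The open sets [U] and the complement of [K] cover the space; the extension by zero agrees with
    [F] on the first and is zero on the second. *)
Lemma restr_Ck k F : smooth_on U F -> vanish_off F -> Ck k setT (F \_ U).
Proof.
move=> sF F0; apply: Ck_local => y _; have [Uy|nUy] := pselect (U y).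
  have [W [G [oW Wy CG E]]] := sF y Uy.
  have oV := openI oW oU; exists (W `&` U); split=> //.
  apply: Ck_ext oV _ (Ck_subset _ (CG k)) => [z [Wz Uz]|z []//].
  by rewrite E // patchE mem_set.
have oV : open (~` K) by rewrite openC; exact: closedK.
exists (~` K); split=> //; first by move=> /KU.
by apply: Ck_ext oV _ (Ck_cst k 0 oV) => z nK; rewrite off_support.
Qed.

Lemma restr_derive F i y : smooth_on U F -> vanish_off F ->
  'D_(evec R i) (F \_ U) y = (pder i F \_ U) y.
Proof.
move=> sF F0; rewrite [RHS]patchE; case: ifPn => [/set_mem Uy|/negP nUy].
  apply/esym; apply: (pder_rep rU oU) => //; first by move=> z Uz _; rewrite patchE mem_set.
  by have [_ /(_ i) [d _]] := restr_Ck 1 sF F0; exact: d.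
have oV : open (~` K) by rewrite openC; exact: closedK.
apply: etrans _ (derive_cst (0 : R) y (evec R i)); apply: near_eq_derive.
apply: filterS (open_nbhs_nbhs (conj oV _)) => [z nK|]; first by rewrite off_support.
by move=> /KU Uy; apply: nUy; exact: mem_set.
Qed.

Lemma pder_vanish F i : smooth_on U F -> vanish_off F -> vanish_off (pder i F).
Proof.
move=> sF F0 x Ux nK; have oV : open (U `&` ~` K).
  by apply: openI => //; rewrite openC; exact: closedK.
have rV := open_ropen oV.
rewrite (pder_ext i rV (G := cst 0)) //; first by rewrite (pder_cst _ i rU Ux).
by move=> y [Uy nKy]; exact: F0.
Qed.

(** [M] comes from [K] alone, so all integrands of one computation can share it. *)
Lemma restr_cc : exists2 M : R, 0 < M &
  forall F, smooth_on U F -> vanish_off F -> cc M (F \_ U).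
Proof.
have [M M0 MK] := boundK; exists M => // F sF F0; split=> [y|y [i yi]].
  by have [c _] := restr_Ck 0 sF F0; exact: c.
by apply: off_support => // /MK /(_ i); rewrite ltNge yi.
Qed.

Lemma rvint_pder0 F i : smooth_on U F -> vanish_off F -> rvint (pder i F \_ U) = 0.
Proof.
move=> sF F0; have [M M0 HM] := restr_cc.
have E : (fun y => 'D_(evec R i) (F \_ U) y) = pder i F \_ U.
  by apply/funext => y; exact: restr_derive.
rewrite -E; apply: (rvint_derive0 M0); first exact: HM.
  by move=> y; have [_ /(_ i) [d _]] := restr_Ck 1 sF F0; exact: d.
rewrite E; apply: HM; first exact: smooth_on_pder.
exact: pder_vanish.
Qed.

Lemma rvint_restr_lin a F G : smooth_on U F -> vanish_off F -> smooth_on U G -> vanish_off G ->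
  rvint ((fun x => F x + a * G x) \_ U) = rvint (F \_ U) + a * rvint (G \_ U).
Proof.
move=> sF F0 sG G0; have [M M0 HM] := restr_cc.
rewrite -(rvint_lin a (ltW M0) (HM F sF F0) (HM G sG G0)); congr rvint.
by apply/funext => y; rewrite !patchE; case: ifP; rewrite // mulr0 addr0.
Qed.

(** No density is built in: [sg] is a factor of the integrand, so that coordinate divergences
    integrate to zero directly. *)
Definition icx g : R[i] :=
  rvint ((fun x => complex.Re (g x)) \_ U) +i* rvint ((fun x => complex.Im (g x)) \_ U).

Definition test g := csm U g /\ vanish_off g.

Lemma test_parts g : test g ->
  [/\ smooth_on U (fun x => complex.Re (g x)), vanish_off (fun x => complex.Re (g x)),
      smooth_on U (fun x => complex.Im (g x)) & vanish_off (fun x => complex.Im (g x))].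
Proof. by move=> [[s1 s2] g0]; split=> // x Ux nK; rewrite g0. Qed.

Lemma icx_ext g g' : (forall x, U x -> g x = g' x) -> icx g = icx g'.
Proof.
move=> E; rewrite /icx.
have E1 : (fun x => complex.Re (g x)) \_ U = (fun x => complex.Re (g' x)) \_ U.
  by apply/funext => x; rewrite !patchE; case: ifPn => // /set_mem Ux; rewrite E.
have E2 : (fun x => complex.Im (g x)) \_ U = (fun x => complex.Im (g' x)) \_ U.
  by apply/funext => x; rewrite !patchE; case: ifPn => // /set_mem Ux; rewrite E.
by rewrite E1 E2.
Qed.

Lemma icx0 : icx (fun=> 0) = 0.
Proof.
rewrite /icx /= (_ : (fun=> 0) \_ U = fun=> 0) ?rvint0 //.
by apply/funext => x; rewrite patchE; case: ifP.
Qed.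

Lemma testD g g' : test g -> test g' -> test (fun x => g x + g' x).
Proof.
move=> [s0 g0] [s0' g0']; split; first exact: csmD.
by move=> x Ux nK; rewrite g0 // g0' // addr0.
Qed.

Lemma testM g g' : test g -> csm U g' -> test (fun x => g x * g' x).
Proof.
move=> [s0 g0] s0'; split; first exact: csmM.
by move=> x Ux nK; rewrite g0 // mul0r.
Qed.

Lemma testZ a g : test g -> test (fun x => a * g x).
Proof.
move=> [s0 g0]; split; first exact: csmZ.
by move=> x Ux nK; rewrite g0 // mulr0.
Qed.

Lemma test_ext g g' : (forall x, U x -> g x = g' x) -> test g -> test g'.
Proof.
move=> E [sg g0]; split; first exact: csm_ext sg.
by move=> x Ux nK; rewrite -E // g0.
Qed.

Lemma test0 : test (fun=> 0).
Proof. by split=> //; exact: csm_cst. Qed.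

Lemma test_sum (I : Type) (r : seq I) (F : I -> 'rV[R]_n -> R[i]) :
  (forall i, test (F i)) -> test (fun x => \sum_(i <- r) F i x).
Proof.
move=> tF; elim: r => [|i r IH]; first by apply: test_ext test0 => x _; rewrite big_nil.
by apply: test_ext (testD (tF i) IH) => x _; rewrite big_cons.
Qed.

Lemma test_cpd i g : test g -> test (cpd i g).
Proof.
move=> tg; have [s1 v1 s2 v2] := test_parts tg; split; first by apply: csm_cpd => //; exact: tg.1.
move=> x Ux nK; rewrite /cpd /cx (pder_vanish i s1 v1 Ux nK).
by rewrite (pder_vanish i s2 v2 Ux nK).
Qed.

Lemma icxD g g' : test g -> test g' -> icx (fun x => g x + g' x) = icx g + icx g'.
Proof.
move=> tg tg'; have [s1 v1 s2 v2] := test_parts tg; have [s1' v1' s2' v2'] := test_parts tg'.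
have H F G : smooth_on U F -> vanish_off F -> smooth_on U G -> vanish_off G ->
    rvint ((fun x => F x + G x) \_ U) = rvint (F \_ U) + rvint (G \_ U).
  move=> sF F0 sG G0; rewrite -[rvint (G \_ U)]mul1r -rvint_restr_lin //.
  by congr (rvint (_ \_ U)); apply/funext => x; rewrite mul1r.
apply: complexP; rewrite ?cReD ?cImD /=.
  rewrite -H //; congr (rvint (_ \_ U)); apply/funext => x; exact: cReD.
rewrite -H //; congr (rvint (_ \_ U)); apply/funext => x; exact: cImD.
Qed.

Lemma icxZ a g : test g -> icx (fun x => a * g x) = a * icx g.
Proof.
move=> tg; have [s1 v1 s2 v2] := test_parts tg; case: a => a b.
have HZ c F : smooth_on U F -> vanish_off F -> rvint ((fun x => c * F x) \_ U) = c * rvint (F \_ U).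
  move=> sF F0; have := rvint_restr_lin c (@smooth_on_cst _ _ U 0) (fun _ _ _ => erefl) sF F0.
  have -> : cst 0 \_ U = fun _ : 'rV[R]_n => (0 : R).
    by apply/funext => x; rewrite patchE; case: ifP.
  rewrite rvint0 add0r => <-; congr (rvint (_ \_ U)).
  by apply/funext => x; rewrite add0r.
have H c d F G : smooth_on U F -> vanish_off F -> smooth_on U G -> vanish_off G ->
    rvint ((fun x => c * F x + d * G x) \_ U) = c * rvint (F \_ U) + d * rvint (G \_ U).
  move=> sF F0 sG G0; rewrite -HZ // -rvint_restr_lin //.
    by apply: smooth_onM => //; exact: smooth_on_cst.
  by move=> x Ux nK; rewrite F0 // mulr0.
apply: complexP; rewrite ?cReM ?cImM /=.
  rewrite -mulNr -H //; congr (rvint (_ \_ U)); apply/funext => x.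
  by rewrite cReM /= mulNr.
rewrite -H //; congr (rvint (_ \_ U)); apply/funext => x; exact: cImM.
Qed.

Lemma icx_sum (I : Type) (r : seq I) (F : I -> 'rV[R]_n -> R[i]) :
  (forall i, test (F i)) -> icx (fun x => \sum_(i <- r) F i x) = \sum_(i <- r) icx (F i).
Proof.
move=> tF; have tS s := test_sum s tF.
elim: r => [|i r IH].
  rewrite big_nil; apply: etrans _ icx0; apply: icx_ext => x _; exact: big_nil.
rewrite big_cons -IH -icxD //; apply: icx_ext => x _; exact: big_cons.
Qed.

Lemma icx_cpd0 i g : test g -> icx (cpd i g) = 0.
Proof.
move=> tg; have [s1 v1 s2 v2] := test_parts tg.
by rewrite /icx /cpd /cx /= (rvint_pder0 i s1 v1) (rvint_pder0 i s2 v2).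
Qed.

End PatchIntegral.

(** * Testing against bump functions in a chart *)

Section ChartTests.
Variables (R : realType) (n : nat) (M : manifold R n) (c : chart R n M).
Hypothesis ac : atlas c.

Lemma img_param x : img c x -> dom c (param c x) /\ chart_map c (param c x) = x.
Proof. by have [_ _ pc _ _] := atlas_chart ac; move=> [p dp <-]; rewrite pc. Qed.

Lemma open_img : open (img c).
Proof. by have [_ oi _ _ _] := atlas_chart ac. Qed.

Lemma smooth_on_local m (A : set 'rV[R]_m) F :
  (forall y, A y -> exists O, [/\ open O, O y & smooth_on (A `&` O) F]) -> smooth_on A F.
Proof.
move=> H y Ay; have [B [oO Oy sF]] := H y Ay.
have [W [G [oW Wy CG E]]] := sF y (conj Ay Oy).
have oV := openI oW oO; exists (W `&` B), G; split=> //.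
  by move=> k; apply: Ck_subset (CG k) => z [].
by move=> z Az [Wz Oz]; rewrite E.
Qed.

Definition box (x0 : 'rV[R]_n) (d : R) : set 'rV[R]_n :=
  [set x | forall i, [set` `[x0 0 i - d, x0 0 i + d]] (x 0 i)].

(** The values of [chart_map c] outside [dom c] are arbitrary, whence the case distinction. *)
Definition bumpM (x0 : 'rV[R]_n) (d : R) (p : M) : R[i] :=
  (if `[< dom c p >] then box_bump x0 d (chart_map c p) else 0)%:C.

Lemma compact_box x0 d : compact (box x0 d).
Proof.
by apply: (@rV_compact R n (fun i => [set` `[x0 0 i - d, x0 0 i + d]])) => i; exact: segment_compact.
Qed.

Lemma bump_out_box x0 d x : ~ box x0 d x -> box_bump x0 d x = 0.
Proof.
move=> nb; suff : exists i, d <= `|x 0 i - x0 0 i| by move=> [k]; exact: bump_eq0.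
apply: contrapT => nE; apply: nb => i /=; rewrite in_itv /=.
have : `|x 0 i - x0 0 i| < d by rewrite ltNge; apply/negP => h; apply: nE; exists i.
by rewrite ltr_norml => /andP[h1 h2]; apply/andP; split; lra.
Qed.

Section Box.
Variables (x0 : 'rV[R]_n) (d : R).
Hypothesis bU : box x0 d `<=` img c.

Lemma compact_param_box : compact (param c @` box x0 d).
Proof.
apply: continuous_compact; last exact: compact_box.
apply: continuous_in_subspaceT => x /set_mem/bU Ux.
by have [_ _ _ _ cp] := atlas_chart ac; exact: cp.
Qed.

Lemma param_box_dom : param c @` box x0 d `<=` dom c.
Proof. by move=> _ [x /bU Ux <-]; have [] := img_param Ux. Qed.

Lemma bumpM_off p : ~ (param c @` box x0 d) p -> bumpM x0 d p = 0.
Proof.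
move=> nb; rewrite /bumpM; case: asboolP => // dp; rewrite bump_out_box // => b.
by apply: nb; exists (chart_map c p) => //; have [_ _ pc _ _] := atlas_chart ac; exact: pc.
Qed.

(** Read in another chart: near points mapped into [dom c] the smooth transition map applies; near
    the others the bump is zero, since the image of the box is compact and therefore closed in the
    Hausdorff space [M]. *)
Lemma smoothM_bumpM : smoothM (bumpM x0 d).
Proof.
move=> c' ac'; split=> /=; last exact: smooth_on_cst.
have [od' oi' pc' cc' cp'] := atlas_chart ac'.
have [od oi pc cc cp] := atlas_chart ac.
apply: smooth_on_local => y Uy; have [dy|ndy] := pselect (dom c (param c' y)).
  set A := img c' `&` param c' @^-1` dom c.
  have nA : nbhs y A.
    apply: filterI; first exact: open_nbhs_nbhs.
    by apply: (cp' y Uy); exact: open_nbhs_nbhs.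
  exists A^°; split=> //; first exact: open_interior.
  have sb : smooth_on A (fun x => box_bump x0 d (chart_map c (param c' x))).
    apply: (smooth_on_bump_comp x0 d (F := fun x => chart_map c (param c' x))) => i.
    exact: atlas_smooth.
  have sub : img c' `&` A^° `<=` A by move=> z [_ /interior_subset].
  apply: smooth_on_ext (smooth_on_subset sub sb) => z /sub[_ dz].
  by rewrite asboolT.
have clK : closed (param c @` box x0 d).
  by apply: compact_closed; [exact: manifold_hausdorff|exact: compact_param_box].
set B := [set z | ~ (param c @` box x0 d) (param c' z)].
have nB : nbhs y B.
  apply: (cp' y Uy (~` (param c @` box x0 d))); apply: open_nbhs_nbhs; split.
    by rewrite openC.
  by move=> /param_box_dom.
exists B^°; split=> //; first exact: open_interior.
apply: smooth_on_ext (@smooth_on_cst R n _ 0) => z [_ /interior_subset Bz].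
have := bumpM_off Bz; rewrite /bumpM => /(congr1 (@complex.Re R)) /= ->.
by [].
Qed.

Lemma bumpM_param x : img c x -> bumpM x0 d (param c x) = (box_bump x0 d x)%:C.
Proof. by move=> /img_param[dx cx0]; rewrite /bumpM asboolT // cx0. Qed.

End Box.

Lemma box_in (A : set 'rV[R]_n) x0 : nbhs x0 A -> exists2 d : R, 0 < d & box x0 d `<=` A.
Proof.
move=> /nbhs_ballP[d /= d0 dA]; exists (d / 2); first by rewrite divr_gt0.
move=> x xb; apply: dA; split=> // i j; rewrite ord1 /ball /=.
have := xb j; rewrite /= in_itv /= => /andP[h1 h2].
by rewrite ltr_norml; apply/andP; split; lra.
Qed.

(** If [H] were positive at a point, a bump in a small box around it would have a positive integral
    against [H]. The converse inequality comes from applying this to [- H]. *)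
Lemma weak_zero_real H : smooth_on (img c) H ->
  (forall x0 d, box x0 d `<=` img c -> rvint ((fun x => box_bump x0 d x * H x) \_ (img c)) = 0) ->
  forall x, img c x -> H x <= 0.
Proof.
move=> sH wH x0 Ux; rewrite leNgt; apply/negP => H0.
have cH : \forall x \near x0, 0 < (H \_ (img c)) x.
  have [W [G [oW Wx CG E]]] := sH x0 Ux.
  have cG : {for x0, continuous G} by have [h _] := CG 0%N; exact: h.
  have n1 : nbhs x0 [set x | 0 < G x].
    by apply: (cG [set t | 0 < t]); apply: lt_nbhsr; rewrite E.
  have n2 : nbhs x0 (W `&` img c).
    by apply: open_nbhs_nbhs; split=> //; apply: openI => //; exact: open_img.
  by apply: filterS2 n1 n2 => x G0 [Wz Uz]; rewrite patchE mem_set // -E.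
have nU : nbhs x0 (img c) by apply: open_nbhs_nbhs; split=> //; exact: open_img.
have [d d0 dP] := box_in (filterI nU cH).
have bU : box x0 d `<=` img c by move=> z /dP[].
set F := fun x => box_bump x0 d x * H x.
have sF : smooth_on (img c) F.
  apply: smooth_onM => //.
  by apply: (smooth_on_bump_comp x0 d (F := id)) => i; exact: smooth_on_coord.
have vF : vanish_off (img c) (box x0 d) F.
  by move=> x _ nb; rewrite /F bump_out_box // mul0r.
have [L L0 HL] := restr_cc open_img (compact_box (x0 := x0) (d := d)) bU.
have := rvint_gt0 L0 (HL F sF vF) (y0 := x0).
rewrite wH // ltxx => HF; have //: false.
apply: HF => [y|]; last first.
  rewrite patchE mem_set //; apply: mulr_gt0 => //; exact: bump_gt0.
rewrite patchE; case: ifPn => // /set_mem Uy; have [/dP[_]|nb] := pselect (box x0 d y).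
  by rewrite /= patchE mem_set // => h; apply: mulr_ge0; [exact: bump_ge0|exact: ltW].
by rewrite /F bump_out_box // mul0r.
Qed.

Lemma weak_zero (G : 'rV[R]_n -> R[i]) : csm (img c) G ->
  (forall x0 d, box x0 d `<=` img c ->
    icx (img c) (fun x => bumpM x0 d (param c x) * G x) = 0) ->
  forall x, img c x -> G x = 0.
Proof.
move=> [s1 s2] wG x Ux.
have E x0 d : box x0 d `<=` img c ->
    rvint ((fun x => box_bump x0 d x * complex.Re (G x)) \_ (img c)) = 0 /\
    rvint ((fun x => box_bump x0 d x * complex.Im (G x)) \_ (img c)) = 0.
  move=> /wG; rewrite (icx_ext (g' := fun x => (box_bump x0 d x)%:C * G x)); last first.
    by move=> z Uz; rewrite bumpM_param.
  move=> [e1 e2]; split; [rewrite -[RHS]e1|rewrite -[RHS]e2]; congr (rvint (_ \_ _)).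
    by apply/funext => z; rewrite cReM /= mul0r subr0.
  by apply/funext => z; rewrite cImM /= mul0r addr0.
have neg H : (forall x0 d, box x0 d `<=` img c -> rvint ((fun x => box_bump x0 d x * H x) \_ (img c)) = 0) ->
    smooth_on (img c) H ->
    forall x0 d, box x0 d `<=` img c -> rvint ((fun x => box_bump x0 d x * - H x) \_ (img c)) = 0.
  move=> wH sH x0 d bU; have sF : smooth_on (img c) (fun x => box_bump x0 d x * H x).
    apply: smooth_onM => //.
    by apply: (smooth_on_bump_comp x0 d (F := id)) => i; exact: smooth_on_coord.
  have vF : vanish_off (img c) (box x0 d) (fun x => box_bump x0 d x * H x).
    by move=> z _ nb; rewrite bump_out_box // mul0r.
  have cb := compact_box (x0 := x0) (d := d).
  (* The coefficient [- 2] expresses the change of sign as [F + (- 2) F = - F], the form covered by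
     [rvint_restr_lin]. *)
  have := rvint_restr_lin open_img cb bU (- 2) sF vF sF vF.
  rewrite wH // mulr0 addr0 => <-; congr (rvint (_ \_ _)).
  by apply/funext => z; ring.
apply: complexP; apply/eqP; rewrite eq_le /=; apply/andP; split.
- by apply: (weak_zero_real s1 _ Ux) => x0 d /E[].
- rewrite -oppr_le0; apply: (weak_zero_real (smooth_onN s1) _ Ux).
  by apply: neg => // x0 d /E[].
- by apply: (weak_zero_real s2 _ Ux) => x0 d /E[].
rewrite -oppr_le0; apply: (weak_zero_real (smooth_onN s2) _ Ux).
by apply: neg => // x0 d /E[].
Qed.

End ChartTests.

(** * Parity *)

Section Parity.
Variables (R : realType) (n : nat) (eps : R) (U : set 'rV[R]_n).
Hypotheses (eps0 : 0 < eps) (oU : open U).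
Implicit Types u v : 'rV[R]_(1 + n) -> R[i].
Local Notation C := (cyl eps U).
Local Notation even_fun := (par U false).

Lemma par_prod (I : Type) (r : seq I) (F : I -> 'rV[R]_(1 + n) -> R[i]) :
  (forall i, csm C (F i)) -> (forall i, even_fun (F i)) ->
  csm C (fun y => \prod_(i <- r) F i y) /\ even_fun (fun y => \prod_(i <- r) F i y).
Proof.
move=> sF pF; elim: r => [|i r [s1 p1]].
  split; first by apply: csm_ext (csm_cst _ 1) => y _; rewrite big_nil.
  apply: (par_ext eps0 oU (u := cst 1)); first by move=> y _; rewrite big_nil.
  exact: par_cst eps0 oU 1.
split; first by apply: csm_ext (csmM (sF i) s1) => y _; rewrite big_cons.
apply: (par_ext eps0 oU (u := fun y => F i y * \prod_(j <- r) F j y)).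
  by move=> y _; rewrite big_cons.
exact: (parM eps0 oU (sF i) s1 (pF i) p1).
Qed.

(** In the coefficient of odd order [k] of [u * v = 1], each product other than [u_0 v_k] contains
    an odd coefficient of [u] or an odd coefficient of [v] of lower order; and [u_0] is
    invertible. *)
Lemma par_inv u v : csm C u -> csm C v -> (forall y, C y -> u y * v y = 1) ->
  even_fun u -> even_fun v.
Proof.
move=> su sv uv pu; elim/ltn_ind => k IH x Ux ok.
have := tc_ext eps0 oU k uv Ux; rewrite (tcM eps0 oU) //.
have := tc_cst eps0 oU k 1 Ux; rewrite /cst => ->.
have k0 : (k == 0%N) = false by case: k {IH} ok.
rewrite k0 big_ord_recl subn0 big1 ?addr0 => [/eqP|j _].
  rewrite mulf_eq0 => /orP[|/eqP //]; rewrite tc0 => /eqP z.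
  by have := uv _ (cyl0 eps0 Ux); rewrite z mul0r => /eqP; rewrite eq_sym oner_eq0.
rewrite /= /bump /= add1n; case: (boolP (odd j.+1)) => oj; first by rewrite pu ?mul0r ?oj.
rewrite IH ?mulr0 //; first by rewrite ltn_subrL /= lt0n k0.
by rewrite oddB ?ltn_ord // (negbTE oj) addbF.
Qed.

(* As u is nonzero at r = 0, its odd Taylor coefficients are determined
   recursively by those of u ^ 2. *)
Lemma par_sqrt u : csm C u -> (forall y, C y -> u y != 0) ->
  even_fun (fun y => u y * u y) -> even_fun u.
Proof.
move=> su u0 pu; elim/ltn_ind => k IH x Ux ok.
have := pu k x Ux ok; rewrite (tcM eps0 oU) //.
have k0 : (0 < k)%N by case: k {IH} ok.
case: k k0 IH ok => // k _ IH ok.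
rewrite big_ord_recl big_ord_recr /= subnn subn0 /bump /= add1n big1 ?add0r => [/eqP|j _].
  rewrite mulrC -mulrDl mulf_eq0 tc0 -mulr2n mulrn_eq0 /= => /orP[/eqP //|/eqP z].
  by have := u0 _ (cyl0 eps0 Ux); rewrite z eqxx.
rewrite add1n subSS.
have jk : (j < k)%N by [].
case: (boolP (odd j.+1)) => oj; first by rewrite (IH j.+1) ?mul0r ?oj.
rewrite (IH (k - j)%N) ?mulr0 //; first by rewrite ltnS leq_subr.
by rewrite oddB ?(ltnW jk) //; move: ok oj => /=; case: (odd k); case: (odd j).
Qed.

Variable H : 'rV[R]_(1 + n) -> 'M[R]_n.
Hypothesis sH : forall i j, smooth_on C (fun y => H y i j).
Hypothesis posH : forall y, C y -> posdef (H y).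
Hypothesis evH : forall i j, even_fun (fun y => (H y i j)%:C).

Lemma par_det k (B : 'rV[R]_(1 + n) -> 'M[R]_k) :
  (forall i j, smooth_on C (fun y => B y i j)) ->
  (forall i j, even_fun (fun y => (B y i j)%:C)) -> even_fun (fun y => (\det (B y))%:C).
Proof.
move=> sB pB.
have sP (s : {perm 'I_k}) := par_prod (index_enum 'I_k)
  (fun i => csm_real (sB i (s i))) (fun i => pB i (s i)).
apply: (par_ext eps0 oU (u := fun y => \sum_(s : {perm 'I_k}) (-1) ^+ s * \prod_i (B y i (s i))%:C)).
  move=> y _; rewrite /determinant (rmorph_sum (real_complex R)); apply: eq_bigr => s _.
  rewrite (rmorphM (real_complex R)) (rmorph_sign (real_complex R)); congr (_ * _).
  by rewrite (rmorph_prod (real_complex R)).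
apply: (par_sum eps0 oU) => s _; first by apply: csmZ; exact: (sP s).1.
exact: (parZ eps0 oU _ (sP s).1 (sP s).2).
Qed.

Lemma even_sg : even_fun (sg H).
Proof.
apply: par_sqrt.
- exact: (csm_sg sH posH).
- exact: (sg_neq0 posH).
apply: (par_ext eps0 oU (u := fun y => (\det (H y))%:C)); last exact: par_det.
move=> y Cy; rewrite /sg -(rmorphM (real_complex R)) -expr2 sqr_sqrtr // ltW //.
exact: (detH_gt0 posH Cy).
Qed.

Lemma even_Ac i j : even_fun (Ac H i j).
Proof.
have sdet := csm_real (smooth_on_det sH).
have sinv : csm C (fun y => ((\det (H y))^-1)%:C).
  by apply: csm_real; apply: smooth_on_inv; [exact: (detH_gt0 posH)|exact: smooth_on_det].
have pinv : even_fun (fun y => ((\det (H y))^-1)%:C).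
  apply: (par_inv sdet sinv); last exact: par_det.
  move=> y Cy; rewrite -(rmorphM (real_complex R)) mulfV ?gt_eqF //.
  exact: (detH_gt0 posH Cy).
have scof := csm_real (smooth_on_cofactor j i sH).
have pcof : even_fun (fun y => (cofactor (H y) j i)%:C).
  have sB a b : smooth_on C (fun y => row' j (col' i (H y)) a b).
    by apply: smooth_on_ext (sH (lift j a) (lift i b)) => y _; rewrite !mxE.
  have pB a b : even_fun (fun y => (row' j (col' i (H y)) a b)%:C).
    apply: (par_ext eps0 oU) (evH (lift j a) (lift i b)) => y _.
    by rewrite !mxE.
  apply: (par_ext eps0 oU (u := fun y => ((-1) ^+ (j + i))%:C * (\det (row' j (col' i (H y))))%:C)).
    by move=> y _; rewrite /cofactor (rmorphM (real_complex R)).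
  apply: (parZ eps0 oU); first by apply: csm_real; exact: smooth_on_det.
  exact: par_det.
have s2 := csmM sinv scof.
have p2 := parM eps0 oU sinv scof pinv pcof.
have s0 := csm_sg sH posH.
apply: (par_ext eps0 oU) (parM eps0 oU s0 s2 even_sg p2) => y Cy.
rewrite /Ac /AR (invH_E posH _ _ Cy) /sg !(rmorphM (real_complex R)).
by [].
Qed.

End Parity.

Section IteratedRadial.
Variables (R : realType) (n : nat).

Lemma iter_pder_pt k (F : 'rV[R]_(1 + n) -> R) r x :
  iter k (pder (i_r n)) F (pt r x) = iter k (@rder R) (fun r => F (pt r x)) r.
Proof.
elim: k r => [//|k IH] r; rewrite iterS pder_r_pt /=; congr (rder _ r).
by apply/funext => s; exact: IH.
Qed.

Lemma tc_iter_rder k (u : 'rV[R]_(1 + n) -> R[i]) x :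
  k`!%:R * tc k u x = cx (iter k (@rder R)) (fun r => u (pt r x)) 0.
Proof.
rewrite /tc mulrC divfK ?pnatr_eq0 -?lt0n ?fact_gt0 //.
by rewrite iter_cpd_parts /cx !iter_pder_pt.
Qed.

Lemma tc_real k (F : 'rV[R]_(1 + n) -> R) x :
  tc k (fun y => (F y)%:C) x = (iter k (@rder R) (fun r => F (pt r x)) 0 / k`!%:R)%:C.
Proof.
rewrite /tc iter_cpd_parts !iter_pder_pt /=.
have -> : iter k (@rder R) (fun=> 0) 0 = 0.
  suff -> : iter k (@rder R) (fun=> 0) = fun=> 0 by [].
  by elim: k => //= k ->; apply/funext => r; exact: rder_cst.
by rewrite natC [RHS](rmorphM (real_complex R)) (fmorphV (real_complex R)).
Qed.

End IteratedRadial.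

(** * The equation for the solution series in a chart *)

Lemma laplacian_ext (R : realType) m (A : set 'rV[R]_m) (G : 'rV[R]_m -> 'M[R]_m) F F' y :
  ropen A -> (forall z, A z -> F z = F' z) -> A y -> laplacian G F y = laplacian G F' y.
Proof.
move=> rA E Ay; rewrite /laplacian; congr (_ * _); apply: eq_bigr => i _.
apply: (pder_ext i rA _ Ay) => z Az; congr (_ * _); apply: eq_bigr => j _.
by rewrite (pder_ext j rA E Az).
Qed.

Lemma cx_laplacian_ext (R : realType) m (A : set 'rV[R]_m) (G : 'rV[R]_m -> 'M[R]_m)
    (u v : 'rV[R]_m -> R[i]) y :
  ropen A -> (forall z, A z -> u z = v z) -> A y ->
  cx (laplacian G) u y = cx (laplacian G) v y.
Proof.
move=> rA E Ay; apply: complexP => /=; apply: (laplacian_ext G rA _ Ay) => z Az.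
  by rewrite E.
by rewrite E.
Qed.

Section ChartGeometry.
Variables (R : realType) (n : nat) (M : manifold R n) (h : tensor2 M).
Variables (eps : R) (hr : R -> tensor2 M).
Hypothesis hp : poincare hr eps h.
Variable c : chart R n M.
Hypothesis ac : atlas c.
Local Notation U := (img c).
Local Notation C := (cyl eps (img c)).
Local Notation H := (hmx hr c).
Local Notation sgm := (sg (hmx hr c)).
Local Notation Acm := (Ac (hmx hr c)).

Lemma poincare_eps_gt0 : 0 < eps. Proof. by case: hp. Qed.

Lemma chart_smooth i j : smooth_on C (fun y => H y i j).
Proof. by have [_ _ s _ _] := hp; exact: s. Qed.

Lemma chart_sym y : C y -> (H y)^T = H y.
Proof.
move=> [yr yU]; have [_ rm _ _ _] := hp; have [a _] := rm _ yr.
by have [_ /(_ _ yU)[]] := a c ac.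
Qed.

Lemma chart_posdef y : C y -> posdef (H y).
Proof.
move=> [yr yU]; have [_ rm _ _ _] := hp; have [a _] := rm _ yr.
by have [_ /(_ _ yU)[]] := a c ac.
Qed.

Lemma chart_even i j : par U false (fun y => (H y i j)%:C).
Proof.
move=> k x Ux ok; have [_ _ _ _ [ev _]] := hp; rewrite tc_real.
have E : (fun r => H (pt r x) i j) = (fun r => hr r c x i j).
  by apply/funext => r; rewrite /hmx rcoord_pt xcoord_pt.
rewrite E ev ?mul0r //; by case: (odd k) ok.
Qed.

Let e0 := poincare_eps_gt0.
Let oU := open_img ac.

Lemma csm_sgm : csm C sgm.
Proof. exact: (csm_sg chart_smooth chart_posdef). Qed.

Lemma csm_Acm i j : csm C (Acm i j).
Proof. exact: (csm_Ac chart_smooth chart_posdef). Qed.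

Lemma sgm_neq0 y : C y -> sgm y != 0.
Proof. exact: (sg_neq0 chart_posdef). Qed.

Lemma csm_sgmV : csm C (fun y => (sgm y)^-1).
Proof.
apply: (csm_ext (u := fun y => ((sgR H y)^-1)%:C)); first by move=> y _; exact: sg_inv.
apply: csm_real; apply: smooth_on_inv; first exact: (sgR_gt0 chart_posdef).
exact: (smooth_sgR chart_smooth chart_posdef).
Qed.

Lemma sg_shift_op lam u y : C y -> csm C u -> sgm y * shift_op hr c lam u y =
  Op sgm Acm (- (2 * lam - n%:R + 1)) (- (lam - n%:R + 1)) u y.
Proof. by move=> Cy su; exact: (shift_eq oU chart_smooth chart_posdef lam Cy su). Qed.

Lemma shift_opE lam u y : C y -> csm C u -> shift_op hr c lam u y =
  (sgm y)^-1 * Op sgm Acm (- (2 * lam - n%:R + 1)) (- (lam - n%:R + 1)) u y.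
Proof. by move=> Cy su; rewrite -sg_shift_op // mulKf // sgm_neq0. Qed.

Lemma csm_shift_op lam u : csm C u -> csm C (shift_op hr c lam u).
Proof.
move=> su; have so := csm_Op oU csm_sgm csm_Acm (- (2 * lam - n%:R + 1)) (- (lam - n%:R + 1)) su.
apply: csm_ext (csmM csm_sgmV so) => y Cy.
exact: esym (shift_opE lam Cy su).
Qed.

Lemma csm_shift_opN N lam u : csm C u -> csm C (shift_opN hr c N lam u).
Proof. by move=> su; elim: N lam => //= N IH lam; apply: csm_shift_op. Qed.

Lemma csm_in_chart phi : smoothMplus eps phi -> csm C (in_chart c phi).
Proof. by move=> sp; have [] := sp c ac. Qed.

Lemma bdry_der_tc k (phi : R -> M -> R[i]) x :
  bdry_der k phi (param c x) = k`!%:R * tc k (in_chart c phi) x.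
Proof.
rewrite tc_iter_rder /bdry_der; congr (cx _ _ _).
by apply/funext => r; rewrite /in_chart rcoord_pt xcoord_pt.
Qed.

Section Volume.
Variable v : R -> M -> R.
Hypothesis hv : volume_ratio hr eps h v.

Let V (y : 'rV[R]_(1 + n)) : R[i] := (v (rcoord y) (param c (xcoord y)))%:C.

Lemma sgm_factor y : C y -> sgm y = V y * ((fun x => sgm (pt 0 x)) \o @xcoord R n) y.
Proof.
move=> [yr yU]; have [_ _ _ h0 _] := hp.
rewrite /sg /V /= -(rmorphM (real_complex R)); congr _%:C.
rewrite /sgR /hmx rcoord_pt xcoord_pt h0 //; exact: hv.
Qed.

Let s0 : csm U (fun x => sgm (pt 0 x)) := csm_trace0 e0 csm_sgm.
Let s0x : csm C ((fun x => sgm (pt 0 x)) \o @xcoord R n) := csm_xcoord eps s0.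

(** [v] is given only by the relation between the two densities, so its smoothness is obtained from
    the quotient of [sgm] by its value at [r = 0]. *)
Lemma csm_volume : csm C V.
Proof.
have sV : csm C ((fun x => (sgm (pt 0 x))^-1) \o @xcoord R n).
  by apply: csm_xcoord; exact: (csm_trace0 e0 csm_sgmV).
apply: csm_ext (csmM csm_sgm sV) => y Cy; have Uy : U (xcoord y) by case: Cy.
by rewrite sgm_factor //= mulfK //; apply: sgm_neq0; exact: cyl0.
Qed.

Lemma vcoef_tc i x : (vcoef v i (param c x))%:C = tc i V x.
Proof.
rewrite tc_real /vcoef.
suff -> : (fun r => v (rcoord (pt r x)) (param c (xcoord (pt r x)))) = (fun r => v r (param c x)) by [].
by apply/funext => r; rewrite rcoord_pt xcoord_pt.
Qed.

(** [sgm] is [v] times a function independent of [r]. Thus the volume coefficients, multiplied by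
    the density of [h], become the Taylor coefficients of [sgm] that occur in the pairing. *)
Lemma vcoef_sgm i x : U x -> (vcoef v i (param c x))%:C * sgm (pt 0 x) = tc i sgm x.
Proof.
move=> Ux; rewrite vcoef_tc (tc_ext e0 oU i sgm_factor Ux).
rewrite (tcM e0 oU _ csm_volume s0x Ux) big_ord_recr /= subnn (tc_xcoord e0 oU) //= big1 ?add0r //.
by move=> j _; rewrite (tc_xcoord e0 oU) // subn_eq0 leqNgt ltn_ord mulr0.
Qed.

Lemma csm_vcoef i : csm U (fun x => (vcoef v i (param c x))%:C).
Proof.
by apply: csm_ext (csm_tc e0 oU i csm_volume) => x _; rewrite vcoef_tc.
Qed.

End Volume.

Section Solutions.
Variable T : operators M.
Hypothesis hT : solution_operators hr T.
Variable f : M -> R[i].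
Hypothesis sf : smoothM f.

Definition wcoef nu j x := T j.*2 nu f (param c x).
(** The series [W] is cut after [r^(2J)], because for even [n] only the operators [T k] with
    [k <= n] are available. *)
Definition Wser J nu (y : 'rV[R]_(1 + n)) : R[i] :=
  \sum_(j < J.+1) (rcoord y)%:C ^+ j.*2 * (wcoef nu j \o @xcoord R n) y.

Lemma csm_smoothM (g : M -> R[i]) : smoothM g -> csm U (fun x => g (param c x)).
Proof. by move=> sg; have [] := sg c ac. Qed.

Lemma csm_wcoef nu j : admissible n j.*2 -> regular n j.*2 nu -> csm U (wcoef nu j).
Proof. by move=> aj rj; have [_ _ sT _] := hT; apply: csm_smoothM; exact: sT. Qed.

Lemma admissible_le j J : (j <= J)%N -> admissible n J.*2 -> admissible n j.*2.
Proof.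
move=> jJ; rewrite /admissible !odd_double /=.
case: (odd n) => //= JN; apply: leq_trans JN; by rewrite leq_double.
Qed.

Lemma regular_le (j J : nat) (nu : R[i]) : (j <= J)%N -> regular n J nu -> regular n j nu.
Proof. by move=> jJ rJ i i0 ij; apply: rJ => //; exact: leq_trans ij jJ. Qed.

Variables (J : nat) (nu : R[i]).
Hypotheses (aJ : admissible n J.*2) (rJ : regular n J.*2 nu).

Let swj (j : 'I_J.+1) : csm C (wcoef nu j \o @xcoord R n).
Proof.
apply: csm_xcoord; apply: csm_wcoef; first by apply: admissible_le aJ; rewrite -ltnS.
by apply: regular_le rJ; rewrite leq_double -ltnS.
Qed.

Lemma csm_Wser : csm C (Wser J nu).
Proof.
apply: csm_sum => j _; apply: csmM; last exact: swj.
by apply: csmX; exact: csm_rcoord.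
Qed.

(** The bound is [2J + 1] rather than [2J]: the truncated series has no term of odd order, and [T k]
    is zero for odd [k]. *)
Lemma tc_Wser k x : U x -> (k <= J.*2.+1)%N -> tc k (Wser J nu) x = T k nu f (param c x).
Proof.
move=> Ux kJ; have [_ Todd _ _] := hT.
have term (j : 'I_J.+1) : tc k (fun y => (rcoord y)%:C ^+ j.*2 * (wcoef nu j \o @xcoord R n) y) x =
    if k == j.*2 then wcoef nu j x else 0.
  rewrite (tc_rX e0 oU _ _ (swj j) Ux); case: ifPn => jk.
    by rewrite (tc_xcoord e0 oU) // subn_eq0 eqn_leq jk andbT.
  by case: eqP => // E; rewrite E leqnn in jk.
rewrite (tc_sum e0 oU) //; last first.
  by move=> j _; apply: csmM; [apply: csmX; exact: csm_rcoord|exact: swj].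
under eq_bigr => j _ do rewrite term.
case: (boolP (odd k)) => ok.
  rewrite Todd // big1 // => j _; case: eqP => // E.
  by rewrite E odd_double in ok.
have kE : k = (k./2).*2 by rewrite -[LHS]odd_double_half (negbTE ok).
have kJ' : (k./2 < J.+1)%N.
  by rewrite ltnS leq_half_double.
rewrite (bigD1 (Ordinal kJ')) //= -kE eqxx big1 ?addr0 => [|j /eqP jk].
  by rewrite /wcoef -kE.
case: eqP => // E; case: jk; apply: val_inj => /=.
by rewrite E doubleK.
Qed.

(* The operator in the definition of solution_operators maps r ^ nu * W to
   r ^ (nu + 1) / sgm * Op W, so its decay gives Op W = o(r ^ (2J - 1)). *)
Lemma Wser_Op m x : U x -> (m.+1 <= J.*2)%N ->
  tc m (Op sgm Acm (2 * nu - n%:R + 1) nu (Wser J nu)) x = 0.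
Proof.
move=> Ux mJ; have [_ _ _ sol] := hT.
set o := Op _ _ _ _ _; have so : csm C o := csm_Op oU csm_sgm csm_Acm _ _ csm_Wser.
have mJ1 : (m <= J.*2.-1)%N by rewrite -ltnS (ltn_predK mJ).
apply: (tc_vanish e0 oU so Ux _ mJ1).
pose u := in_chart c (partial_sum T nu f J).
pose q (r : R) := complex.Re `|cx (laplacian (gplus hr c)) u (pt r x) + nu * (n%:R - nu) * u (pt r x)|
  / (r `^ (complex.Re nu + J.*2%:R)).
have cq : q r @[r --> 0^'+] --> (0 : R) := sol J nu f aJ rJ sf c ac x Ux.
have sgc : sgR H (pt r x) @[r --> 0^'+] --> sgR H (pt 0 x).
  exact: (smooth_right_cvg e0 oU (smooth_sgR chart_smooth chart_posdef) Ux).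
(* The factor [1 / sgm] in front of [Op W] is compensated by the density, which has a limit at
   [r = 0]. *)
have cp : sgR H (pt r x) * q r @[r --> 0^'+] --> sgR H (pt 0 x) * 0 by exact: (cvgM sgc cq).
rewrite mulr0 in cp; apply: cvg_trans cp; apply: near_eq_cvg; near=> r.
have r0 : 0 < r by near: r; exact: nbhs_right_gt.
have r1 : r < eps by near: r; exact: nbhs_right_lt.
have Pr : cylp eps U (pt r x) by rewrite /cylp /= rcoord_pt xcoord_pt r0 r1.
have Cr := cylp_cyl Pr.
have uE z : cylp eps U z -> u z = cpow (rcoord z) nu * Wser J nu z.
  move=> [/andP[z0 _] _]; rewrite /u /in_chart /partial_sum mulr_sumr; apply: eq_bigr => j _.
  by rewrite cpowD // cpow_nat // mulrA.
rewrite /q (cx_laplacian_ext _ (ropen_cylp oU) uE Pr) uE //.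
rewrite (lap_Gp oU chart_smooth chart_posdef nu Pr csm_Wser) -/o rcoord_pt.
have sp := sgR_gt0 chart_posdef Cr.
have nM (a b : R[i]) : complex.Re `|a * b| = complex.Re `|a| * complex.Re `|b|.
  by rewrite normrM cReM; case: a => a1 a2; case: b => b1 b2; rewrite !normc_def /= mulr0 subr0.
have ns : complex.Re `|(sgm (pt r x))^-1| = (sgR H (pt r x))^-1.
  by rewrite -sg_inv normc_def /= expr0n /= addr0 sqrtr_sqr ger0_norm // invr_ge0 ltW.
rewrite 2!nM ns norm_cpow // cReD.
have -> : complex.Re (1 : R[i]) = 1 by [].
have -> : (J.*2%:R : R) = 1 + (J.*2.-1)%:R.
  by rewrite nat1r (ltn_predK mJ).
have rn0 : r != 0 by rewrite gt_eqF.
have -> : r `^ (complex.Re nu + (1 + (J.*2.-1)%:R)) = r `^ (complex.Re nu + 1) * r ^+ J.*2.-1.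
  have rK : r `^ (J.*2.-1)%:R = r ^+ J.*2.-1 by apply: powR_mulrn; exact: ltW.
  by rewrite -rK addrA -powRD //; apply/implyP.
have p0 : r `^ (complex.Re nu + 1) != 0 by rewrite gt_eqF // powR_gt0.
by field; rewrite expf_neq0 // p0 gt_eqF.
Unshelve. all: by end_near. Qed.

Lemma Wser_even : par U false (Wser J nu).
Proof.
move=> k x Ux ok; rewrite (tc_sum e0 oU) //; last first.
  by move=> j _; apply: csmM; [apply: csmX; exact: csm_rcoord|exact: swj].
rewrite big1 // => j _; rewrite (tc_rX e0 oU _ _ (swj j) Ux); case: ifP => // jk.
rewrite (tc_xcoord e0 oU) // subn_eq0; case: ifP => // kj; move: ok.
have -> : k = j.*2 by apply/eqP; rewrite eqn_leq kj jk.
by rewrite odd_double.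
Qed.

(** Follows from the evenness of the metric. The order that matters is [m = 2J]: [Wser_Op] stops
    just below it, and the odd residue family needs it. *)
Lemma Wser_Op_even m x : U x -> ~~ odd m ->
  tc m (Op sgm Acm (2 * nu - n%:R + 1) nu (Wser J nu)) x = 0.
Proof.
move=> Ux om.
have p := par_Op e0 oU csm_sgm csm_Acm (2 * nu - n%:R + 1) nu csm_Wser
  (even_sg e0 oU chart_smooth chart_posdef chart_even)
  (even_Ac e0 oU chart_smooth chart_posdef chart_even) Wser_even.
by apply: p => //; rewrite (negbTE om).
Qed.

End Solutions.

End ChartGeometry.

(** * Polynomial dependence on the spectral parameter *)

Section TopCoefficient.
Variables (R : realType) (n : nat) (eps : R) (U : set 'rV[R]_n).
Hypotheses (eps0 : 0 < eps) (oU : open U).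
Local Notation C := (cyl eps U).
Local Notation r_ y := ((rcoord y)%:C).
Let rC : ropen C := ropen_cyl oU.
Variables (sg : 'rV[R]_(1 + n) -> R[i]) (A : 'I_n -> 'I_n -> 'rV[R]_(1 + n) -> R[i]).
Hypotheses (ssg : csm C sg) (sA : forall i j, csm C (A i j)).
Let sr : csm C (fun y => r_ y) := csm_rcoord eps U.

Lemma dr_rX k y : C y -> cpd (i_r n) (fun y => r_ y ^+ k) y = k%:R * r_ y ^+ k.-1.
Proof.
elim: k y => [|k IH] y Cy.
  rewrite mul0r; apply: etrans _ (cpd_cst (i_r n) 1 rC Cy).
  by apply: (cpd_ext _ rC _ Cy) => z _; rewrite expr0.
rewrite (cpd_ext _ rC (v := fun y => r_ y * r_ y ^+ k) _ Cy); last by move=> z _; rewrite exprS.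
rewrite (cpdM _ rC sr (csmX k sr) Cy) (cpd_r_rcoord oU Cy) IH // mul1r /=.
case: k {IH} => [|k]; first by rewrite mul0r mulr0 addr0 mul1r.
by rewrite mulrCA -exprS -[X in X + _]mul1r -mulrDl nat1r.
Qed.

Lemma dx_rX k j y : C y -> cpd (i_x j) (fun y => r_ y ^+ k) y = 0.
Proof.
elim: k y => [|k IH] y Cy.
  apply: etrans _ (cpd_cst (i_x j) 1 rC Cy).
  by apply: (cpd_ext _ rC _ Cy) => z _; rewrite expr0.
rewrite (cpd_ext _ rC (v := fun y => r_ y * r_ y ^+ k) _ Cy); last by move=> z _; rewrite exprS.
by rewrite (cpdM _ rC sr (csmX k sr) Cy) (cpd_x_rcoord oU _ Cy) IH // mul0r mulr0 addr0.
Qed.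

(** On [r^(p+1) w] the tangential terms and the term with [dr sg] have order above [p]. With
    [al = 2 nu - n + 1] and [p = 2J + 1] the factor [p + al] is [2 nu - n + 2J + 2], the last factor
    of [denom J.+1]. *)
Lemma tc_Op_top al be p (w : 'rV[R]_n -> R[i]) x : csm U w -> U x ->
  tc p (Op sg A al be (fun y => r_ y ^+ p.+1 * (w \o @xcoord R n) y)) x =
  p.+1%:R * (p%:R + al) * (sg (pt 0 x) * w x).
Proof.
move=> sw Ux; set wx := w \o @xcoord R n; set u := fun y => _.
have swx : csm C wx := csm_xcoord eps sw.
have sX k := csmX k sr.
have su : csm C u := csmM (sX _) swx.
have sdu := csm_cpd (i_r n) rC su; have sdsg := csm_cpd (i_r n) rC ssg.
have sswx := csmM ssg swx.
have drE y : C y -> cpd (i_r n) u y = p.+1%:R * (r_ y ^+ p * wx y).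
  move=> Cy; rewrite (cpdM _ rC (sX _) swx Cy) dr_rX // cpd_r_xcoord mulr0 addr0.
  by rewrite mulrA.
have t1 k : (k <= p)%N -> tc k (fun y => sg y * cpd (i_r n) u y) x =
    if k == p then p.+1%:R * (sg (pt 0 x) * w x) else 0.
  move=> kp; rewrite (tc_ext eps0 oU _ (v := fun y => p.+1%:R * (r_ y ^+ p * (sg y * wx y)))) //; last first.
    by move=> y Cy; rewrite drE //; ring.
  rewrite (tcZ eps0 oU) //; last exact: csmM.
  rewrite (tc_rX eps0 oU) // eqn_leq kp /=; case: ifP => pk; last by rewrite mulr0.
  have -> : (k - p = 0)%N by apply/eqP; rewrite subn_eq0.
  by rewrite tc0 /wx /= xcoord_pt.
have t2 : tc p (fun y => r_ y * \sum_i cpd (i_x i) (flux A u i) y) x = 0.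
  have sf i : csm C (flux A u i) := csm_flux oU sA i su.
  rewrite (tc_r eps0 oU) //; last by apply: csm_sum => i _; exact: csm_cpd.
  case Ep : p => [//|q]; rewrite (tc_sum eps0 oU) //; last by move=> i _; exact: csm_cpd.
  rewrite big1 // => i _; rewrite (tc_dx eps0 oU) //.
  rewrite (cpd_ext _ (open_ropen oU) (v := cst 0) _ Ux) ?(cpd_cst _ _ (open_ropen oU) Ux) //.
  move=> z Uz; rewrite (tc_ext eps0 oU _ (v := fun y => r_ y ^+ p.+1 * flux A wx i y)) //; last first.
    move=> y Cy; rewrite /flux mulr_sumr; apply: eq_bigr => j _.
    by rewrite (cpdM _ rC (sX _) swx Cy) dx_rX // mul0r add0r mulrCA.
  rewrite (tc_rX eps0 oU) //; last exact: (csm_flux oU sA i swx).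
  by rewrite Ep ltnNge leqW.
have t3 : tc p (fun y => cpd (i_r n) sg y * u y) x = 0.
  rewrite (tc_ext eps0 oU _ (v := fun y => r_ y ^+ p.+1 * (cpd (i_r n) sg y * wx y))) //; last first.
    by move=> y _; rewrite mulrCA.
  rewrite (tc_rX eps0 oU) //; last exact: csmM.
  by rewrite ltnn.
have ssd := csmM ssg sdu.
have sd1 : csm C (fun y => r_ y * cpd (i_r n) (fun y => sg y * cpd (i_r n) u y) y).
  by apply: csmM => //; exact: csm_cpd.
have sd2 : csm C (fun y => r_ y * \sum_i cpd (i_x i) (flux A u i) y).
  by apply: csmM => //; apply: csm_sum => i _; apply: csm_cpd => //; exact: csm_flux.
have sd3 := csmM sdsg su.
rewrite /Op (tcD eps0 oU) //; first last.
- exact: csmZ.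
- by apply: csmD; [exact: csmD|exact: csmZ].
rewrite (tcD eps0 oU) //; first last.
- exact: csmZ.
- exact: csmD.
rewrite (tcD eps0 oU) // !(tcZ eps0 oU) // t2 t3 (tc_rdr eps0 oU) // t1 // eqxx.
by ring.
Qed.

End TopCoefficient.

(** * Families of functions polynomial in a parameter *)

Section PolynomialFamilies.
Variables (R : realType) (m : nat) (A Z : set 'rV[R]_m) (S : set R[i]).
Implicit Types (F G : R[i] -> 'rV[R]_m -> R[i]) (u : 'rV[R]_m -> R[i]).

(** The set [Z] carries the support condition, so that polynomial dependence and vanishing off [K]
    are propagated together; [Z] is empty where no support is prescribed. *)
Definition good u := csm A u /\ forall y, Z y -> u y = 0.

(** [D] counts coefficients, so the degree is less than [D]. The parameter is confined to [S]
    because the solution operators are controlled only at regular values. *)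
Definition pfam D F := exists2 a : nat -> 'rV[R]_m -> R[i], (forall k, good (a k)) &
  forall z y, S z -> A y -> F z y = \sum_(k < D) z ^+ k * a k y.

Lemma good0 : good (fun=> 0).
Proof. by split=> //; exact: csm_cst. Qed.

Lemma goodD u v : good u -> good v -> good (fun y => u y + v y).
Proof.
move=> [su u0] [sv v0]; split; first exact: csmD.
by move=> y Zy; rewrite u0 // v0 // addr0.
Qed.

Lemma goodZ a u : good u -> good (fun y => a * u y).
Proof.
move=> [su u0]; split; first exact: csmZ.
by move=> y Zy; rewrite u0 // mulr0.
Qed.

Lemma good_sum D (p : nat -> R[i]) (a : nat -> 'rV[R]_m -> R[i]) : (forall k, good (a k)) ->
  good (fun y => \sum_(k < D) p k * a k y).
Proof.
move=> ga; split; first by apply: csm_sum => k _; apply: csmZ; exact: (ga k).1.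
by move=> y Zy; rewrite big1 // => k _; rewrite (ga k).2 // mulr0.
Qed.

Lemma pfam_ext D F G : (forall z y, S z -> A y -> F z y = G z y) -> pfam D F -> pfam D G.
Proof. by move=> E [a ga Ea]; exists a => // z y Sz Ay; rewrite -E // Ea. Qed.

Lemma pfam_cst u : good u -> pfam 1 (fun _ => u).
Proof.
by move=> gu; exists (fun _ => u) => // z y _ _; rewrite big_ord1 expr0 mul1r.
Qed.

Lemma pfamD D F G : pfam D F -> pfam D G -> pfam D (fun z y => F z y + G z y).
Proof.
move=> [a ga Ea] [b gb Eb]; exists (fun k y => a k y + b k y).
  by move=> k; exact: goodD.
move=> z y Sz Ay; rewrite Ea // Eb // -big_split; apply: eq_bigr => k _.
by rewrite mulrDr.
Qed.

Lemma pfamX D F : pfam D F -> pfam D.+1 (fun z y => z * F z y).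
Proof.
move=> [a ga Ea]; exists (fun k => if k is k'.+1 then a k' else fun=> 0).
  by case=> [|k]; [exact: good0|exact: ga].
move=> z y Sz Ay; rewrite Ea // big_ord_recl /= mulr0 add0r mulr_sumr.
by apply: eq_bigr => k _; rewrite /bump /= add1n exprS mulrA.
Qed.

Lemma pfamS D F : pfam D F -> pfam D.+1 F.
Proof.
move=> [a ga Ea]; exists (fun k => if (k < D)%N then a k else fun=> 0).
  by move=> k; case: ifP => _; [exact: ga|exact: good0].
move=> z y Sz Ay; rewrite Ea // big_ord_recr /= ltnn mulr0 addr0.
by apply: eq_bigr => k _; rewrite ltn_ord.
Qed.

Lemma pfam_lin D F (L : ('rV[R]_m -> R[i]) -> 'rV[R]_m -> R[i]) :
  (forall u, good u -> good (L u)) ->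
  (forall u v, (forall y, A y -> u y = v y) -> forall y, A y -> L u y = L v y) ->
  (forall u v y, good u -> good v -> A y -> L (fun y => u y + v y) y = L u y + L v y) ->
  (forall a u y, good u -> A y -> L (fun y => a * u y) y = a * L u y) ->
  pfam D F -> pfam D (fun z => L (F z)).
Proof.
move=> gL eL LD LZ [a ga Ea]; exists (fun k => L (a k)); first by move=> k; exact: gL.
move=> z y Sz Ay; rewrite (eL _ _ (fun y => Ea z y Sz) y Ay).
have H d : L (fun y => \sum_(k < d) z ^+ k * a k y) y = \sum_(k < d) z ^+ k * L (a k) y.
  elim: d => [|d IH].
    rewrite big_ord0 -[RHS](mul0r (L (a 0%N) y)) -LZ //; apply: eL => // w _.
    by rewrite big_ord0 mul0r.
  rewrite big_ord_recr /= -IH -LZ // -LD //.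
  - by apply: eL => // w _; rewrite big_ord_recr.
  - exact: (good_sum d (fun k => z ^+ k)).
  - exact: goodZ.
by rewrite H.
Qed.

End PolynomialFamilies.

Lemma pfam_subset (R : realType) m (A Z : set 'rV[R]_m) S S' D F :
  S' `<=` S -> pfam A Z S D F -> pfam A Z S' D F.
Proof. by move=> sS [a ga Ea]; exists a => // z y /sS; exact: Ea. Qed.

Section PolynomialOp.
Variables (R : realType) (n : nat) (eps : R) (U : set 'rV[R]_n).
Hypothesis oU : open U.
Local Notation C := (cyl eps U).
Variables (sg : 'rV[R]_(1 + n) -> R[i]) (A : 'I_n -> 'I_n -> 'rV[R]_(1 + n) -> R[i]).
Hypotheses (ssg : csm C sg) (sA : forall i j, csm C (A i j)).
Variables (Z : set 'rV[R]_(1 + n)) (S : set R[i]).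
Hypothesis gOp : forall al be u, good C Z u -> good C Z (Op sg A al be u).

(** [Op] is affine in its two parameters: [Op (a + a1 z) (b + b1 z)] equals
    [Op a b + z * (Op a1 b1 - Op 0 0)]. Hence the degree grows by at most one. *)
Lemma pfam_Op (a a1 b b1 : R[i]) D F : pfam C Z S D F ->
  pfam C Z S D.+1 (fun z => Op sg A (a + a1 * z) (b + b1 * z) (F z)).
Proof.
move=> pF; have OpL al be : pfam C Z S D (fun z => Op sg A al be (F z)).
  apply: pfam_lin pF.
  - exact: gOp.
  - by move=> u v E y Cy; rewrite (Op_ext oU _ _ _ _ E Cy).
  - by move=> u v y [su _] [sv _] Cy; rewrite (OpD oU ssg sA _ _ su sv Cy).
  - by move=> k u y [su _] Cy; rewrite (OpZ oU ssg sA _ _ _ su Cy).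
have p1 := pfamS (OpL a b).
have p2 := pfamX (OpL a1 b1).
have [e ge Ee] := OpL 0 0.
have p3 : pfam C Z S D.+1 (fun z y => z * (- Op sg A 0 0 (F z) y)).
  apply: pfamX; exists (fun k y => -1 * e k y); first by move=> k; exact: goodZ.
  move=> z y Sz Cy; rewrite Ee // -sumrN; apply: eq_bigr => k _.
  by rewrite mulN1r mulrN.
apply: pfam_ext (pfamD p1 (pfamD p2 p3)) => z y _ _.
by rewrite /Op; ring.
Qed.

End PolynomialOp.

Section SolutionFamily.
Variables (R : realType) (n : nat) (M : manifold R n) (h : tensor2 M).
Variables (eps : R) (hr : R -> tensor2 M).
Hypothesis hp : poincare hr eps h.
Variable c : chart R n M.
Hypothesis ac : atlas c.
Variable T : operators M.
Hypothesis hT : solution_operators hr T.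
Variable f : M -> R[i].
Hypothesis sf : smoothM f.
Variable K : set 'rV[R]_n.
Hypotheses (cK : compact K) (KU : K `<=` img c).
Hypothesis fK : forall x, img c x -> ~ K x -> f (param c x) = 0.
Local Notation U := (img c).
Local Notation C := (cyl eps (img c)).
Local Notation sgm := (sg (hmx hr c)).
Local Notation Acm := (Ac (hmx hr c)).
Local Notation W := (Wser c T f).
Let e0 := poincare_eps_gt0 hp.
Let oU := open_img ac.

Definition off_cyl : set 'rV[R]_(1 + n) := [set y | C y /\ ~ K (xcoord y)].
Local Notation Z := off_cyl.

Let V := U `&` ~` K.
Let oV : open V.
Proof. by apply: openI => //; rewrite openC; exact: closedK cK. Qed.

Let cylV y : cyl eps V y <-> Z y.
Proof. by split=> [[yr [yU yK]]|[[yr yU] yK]]. Qed.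

Lemma tc_off u k : (forall y, Z y -> u y = 0) -> forall x, U x -> ~ K x -> tc k u x = 0.
Proof.
move=> u0 x Ux nK; have Vx : V x by [].
rewrite (tc_ext e0 oV k (v := cst 0) _ Vx); last by move=> y /cylV; exact: u0.
by rewrite (tc_cst e0 oV) //; case: ifP.
Qed.

Lemma good_Op al be u : good C Z u -> good C Z (Op sgm Acm al be u).
Proof.
move=> [su u0]; split; first exact: (csm_Op oU (csm_sgm hp ac) (csm_Acm hp ac)).
move=> y Zy; have Cy : C y by case: Zy.
(* Over the open set [V] the function [u] is zero; writing zero as [0 * sgm] lets [OpZ] evaluate
   [Op] there. *)
rewrite (@Op_ext _ _ eps V oV sgm Acm al be u (fun y => 0 * sgm y)); last exact/cylV.
  by rewrite (OpZ oU (csm_sgm hp ac) (csm_Acm hp ac) _ _ _ (csm_sgm hp ac)) ?mul0r.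
by move=> z /cylV Zz; rewrite u0 // mul0r.
Qed.

(* A common denominator of the T_2j(nu) with j <= J. *)
Definition denom J (nu : R[i]) : R[i] := \prod_(i < J) (2 * nu - n%:R + i.+1.*2%:R).

Lemma denom_neq0 J nu : regular n J.*2 nu -> denom J nu != 0.
Proof.
move=> rJ; apply/prodf_neq0 => i _; apply/eqP => E.
apply: (rJ i.+1 isT); first by rewrite leq_double.
by rewrite -[2 * nu](subrK n%:R) -[2 * nu - _](addrK i.+1.*2%:R) E sub0r addrC.
Qed.

(* The recursion for T_(2J+2), without the factor 2 nu - n + 2J + 2 by which it
   divides: denom J.+1 contains this factor. *)
Let Lift J (u : 'rV[R]_(1 + n) -> R[i]) (y : 'rV[R]_(1 + n)) : R[i] :=
  (rcoord y)%:C ^+ J.+1.*2 *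
  ((fun x => (- (J.+1.*2%:R * sgm (pt 0 x))^-1) * tc J.*2.+1 u x) \o @xcoord R n) y.

(** Induction on [J]. In [denom J.+1 * W J.+1] the old terms gain the affine factor
    [2 nu - n + 2J + 2], and the new term is [Lift] of [Op], affine in [nu], applied to the previous
    family: either way the degree rises by at most one. *)
Lemma Wser_pfam J : admissible n J.*2 ->
  pfam C Z [set nu | regular n J.*2 nu] J.+1 (fun nu y => denom J nu * W J nu y).
Proof.
elim: J => [|J IH] aJ.
  have gf : good C Z (fun y => f (param c (xcoord y))).
    split; first by apply: (@csm_xcoord _ _ eps _ (fun x => f (param c x))); exact: csm_smoothM.
    by move=> y [[yr yU] yK]; exact: fK.
  apply: (pfam_ext _ (pfam_cst _ gf)) => nu y _ Cy.
  have [T0 _ _ _] := hT.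
  by rewrite /denom big_ord0 mul1r /Wser big_ord1 expr0 mul1r /= /wcoef T0.
have {}IH := IH (admissible_le (leqnSn J) aJ).
have sub : [set nu : R[i] | regular n J.+1.*2 nu] `<=` [set nu | regular n J.*2 nu].
  by move=> nu; apply: regular_le; rewrite leq_double.
set S := [set nu : R[i] | regular n J.+1.*2 nu] in sub *.
have {}IH := pfam_subset sub IH.
set F := fun nu y => _ in IH.
have ss := csm_sgm hp ac; have sA := csm_Acm hp ac.
have G1 : pfam C Z S J.+2 (fun nu => Op sgm Acm (2 * nu - n%:R + 1) nu (F nu)).
  apply: pfam_ext (pfam_Op oU ss sA good_Op (1 - n%:R) 2 0 1 IH) => z y _ _.
  by rewrite add0r mul1r (_ : 1 - n%:R + 2 * z = 2 * z - n%:R + 1) //; ring.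
have LiftP : pfam C Z S J.+2 (fun nu => Lift J (Op sgm Acm (2 * nu - n%:R + 1) nu (F nu))).
  apply: pfam_lin G1.
  - move=> u [su u0]; split.
      apply: csmM; first by apply: csmX; exact: csm_rcoord.
      apply: csm_xcoord; apply: csmM; last exact: (csm_tc e0 oU).
      have s1 : csm U (fun x => (sgm (pt 0 x))^-1) := csm_trace0 e0 (csm_sgmV hp ac).
      by apply: csm_ext (csmZ (- J.+1.*2%:R^-1) s1) => x _; rewrite invfM mulNr.
    by move=> y [[yr yU] yK]; rewrite /Lift /= (tc_off _ u0 yU yK) !mulr0.
  - move=> u v E y [yr yU]; rewrite /Lift /=; congr (_ * (_ * _)).
    exact: (tc_ext e0 oU).
  - move=> u v y [su _] [sv _] [yr yU]; rewrite /Lift /= (tcD e0 oU) // !mulrDr //.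
  - by move=> a u y [su _] [yr yU]; rewrite /Lift /= (tcZ e0 oU) //; ring.
have D1 nu : denom J.+1 nu = (2 * nu - n%:R + J.+1.*2%:R) * denom J nu.
  by rewrite /denom big_ord_recr /= mulrC.
have p1 := pfamX IH; have p2 := pfamS IH.
have p3 : pfam C Z S J.+2 (fun nu y => 2 * (nu * F nu y) + (J.+1.*2%:R - n%:R) * F nu y).
  have [a1 ga1 E1] := p1; have [a2 ga2 E2] := p2.
  apply: pfamD.
    exists (fun k y => 2 * a1 k y); first by move=> k; exact: goodZ.
    by move=> z y Sz Cy; rewrite E1 // mulr_sumr; apply: eq_bigr => k _; rewrite mulrCA.
  exists (fun k y => (J.+1.*2%:R - n%:R) * a2 k y); first by move=> k; exact: goodZ.
  by move=> z y Sz Cy; rewrite E2 // mulr_sumr; apply: eq_bigr => k _; rewrite mulrCA.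
apply: pfam_ext (pfamD p3 LiftP) => nu y Snu Cy.
have Ux : U (xcoord y) by case: Cy.
have sw : csm U (wcoef c T f nu J.+1) by exact: (csm_wcoef ac hT sf aJ Snu).
have sW : csm C (W J nu).
  by apply: (csm_Wser _ ac hT sf (admissible_le (leqnSn J) aJ)); exact: sub.
have WS z : W J.+1 nu z = W J nu z + (rcoord z)%:C ^+ J.+1.*2 * (wcoef c T f nu J.+1 \o @xcoord R n) z.
  by rewrite /Wser big_ord_recr.
have stop : csm C (fun z => (rcoord z)%:C ^+ J.+1.*2 * (wcoef c T f nu J.+1 \o @xcoord R n) z).
  by apply: csmM; [apply: csmX; exact: csm_rcoord|exact: csm_xcoord].
(* The vanishing of the coefficient of order [2J + 1] is the recursion: after the new term is split
   off, it is solved for that term by [tc_Op_top]. *)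
have Z0 := Wser_Op hp ac hT sf aJ Snu Ux (leqnn _ : J.*2.+2 <= J.+1.*2)%N.
rewrite (tc_ext e0 oU _ (v := fun y => Op sgm Acm (2 * nu - n%:R + 1) nu (W J nu) y +
   Op sgm Acm (2 * nu - n%:R + 1) nu (fun z => (rcoord z)%:C ^+ J.+1.*2 *
     (wcoef c T f nu J.+1 \o @xcoord R n) z) y) _ Ux) in Z0; last first.
  move=> z Cz; rewrite -(OpD oU ss sA _ _ sW stop Cz); apply: (Op_ext oU _ _ _ _ _ Cz) => t _; exact: WS.
rewrite (tcD e0 oU) // in Z0; [|exact: (csm_Op oU)|exact: (csm_Op oU)].
rewrite doubleS (tc_Op_top e0 oU ss sA _ _ _ sw Ux) in Z0.
have TF : tc J.*2.+1 (Op sgm Acm (2 * nu - n%:R + 1) nu (F nu)) (xcoord y) =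
    denom J nu * tc J.*2.+1 (Op sgm Acm (2 * nu - n%:R + 1) nu (W J nu)) (xcoord y).
  rewrite -(tcZ e0 oU) //; last exact: (csm_Op oU).
  by apply: (tc_ext e0 oU _ _ Ux) => z Cz; rewrite -(OpZ oU ss sA _ _ _ sW Cz).
rewrite /Lift /= TF WS D1 /F.
have s0 : sgm (pt 0 (xcoord y)) != 0 by apply: (sgm_neq0 hp ac); exact: cyl0.
have j0 : (J.+1.*2%:R : R[i]) != 0 by rewrite pnatr_eq0.
have -> : tc J.*2.+1 (Op sgm Acm (2 * nu - n%:R + 1) nu (W J nu)) (xcoord y) =
    - (J.*2.+2%:R * (J.*2.+1%:R + (2 * nu - n%:R + 1)) * (sgm (pt 0 (xcoord y)) * wcoef c T f nu J.+1 (xcoord y))).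
  by apply/eqP; rewrite -addr_eq0 Z0.
rewrite doubleS in j0 *.
have -> : (J.*2.+1%:R : R[i]) = J.*2.+2%:R - 1 by rewrite -[in RHS]natr1 addrK.
have -> : (wcoef c T f nu J.+1 \o @xcoord R n) y = wcoef c T f nu J.+1 (xcoord y) by [].
move: (sgm _) s0 (denom J nu) (wcoef _ _ _ _ _ _) (W J nu y) (J.*2.+2%:R : R[i]) j0 ((rcoord y)%:C ^+ _).
move=> s s0 d w w' q q0 r; field.
by rewrite q0 s0.
Qed.

(** All coefficients of the polynomial family vanish off [K], and [denom] is nonzero at regular
    values. This is the locality of the solution operators needed to integrate by parts. *)
Lemma Wser_off J nu : admissible n J.*2 -> regular n J.*2 nu -> forall y, Z y -> W J nu y = 0.
Proof.
move=> aJ rJ y Zy; have [a ga Ea] := Wser_pfam aJ; have Cy : C y by case: Zy.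
have /eqP := Ea nu y rJ Cy; rewrite big1; last by move=> k _; rewrite (ga k).2 // mulr0.
by rewrite mulf_eq0 (negbTE (denom_neq0 rJ)) => /eqP.
Qed.

End SolutionFamily.

(** * The pairing *)

Section Pairing.
Variables (R : realType) (n : nat) (M : manifold R n) (h : tensor2 M).
Variables (eps : R) (hr : R -> tensor2 M).
Hypothesis hp : poincare hr eps h.
Variable c : chart R n M.
Hypothesis ac : atlas c.
Variable T : operators M.
Hypothesis hT : solution_operators hr T.
Variable f : M -> R[i].
Hypothesis sf : smoothM f.
Variable K : set 'rV[R]_n.
Hypotheses (cK : compact K) (KU : K `<=` img c).
Hypothesis fK : forall p, ~ (param c @` K) p -> f p = 0.
Variables (J : nat) (nu : R[i]).
Hypotheses (aJ : admissible n J.*2) (rJ : regular n J.*2 nu).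
Local Notation U := (img c).
Local Notation C := (cyl eps (img c)).
Local Notation sgm := (sg (hmx hr c)).
Local Notation Acm := (Ac (hmx hr c)).
Local Notation W := (Wser c T f J nu).
Local Notation Z := (off_cyl eps c K).
Let e0 := poincare_eps_gt0 hp.
Let oU := open_img ac.
Let ss := csm_sgm hp ac.
Let sA := csm_Acm hp ac.
Let sW : csm C W := csm_Wser eps ac hT sf aJ rJ.

Lemma param_off x : U x -> ~ K x -> f (param c x) = 0.
Proof.
move=> Ux nK; apply: fK => -[z Kz E]; apply: nK.
by have [_ <-] := img_param ac Ux; rewrite -E; have [_ ->] := img_param ac (KU Kz).
Qed.

Let W0 y : Z y -> W y = 0.
Proof. exact: (Wser_off hp ac hT sf cK param_off aJ rJ). Qed.

Lemma test_tc k u : csm C u -> (forall y, Z y -> u y = 0) -> test U K (tc k u).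
Proof.
move=> su u0; split; first exact: (csm_tc e0 oU).
exact: (tc_off hp ac cK k u0).
Qed.

Let flux0 u i y : (forall y, Z y -> u y = 0) -> Z y -> flux Acm u i y = 0.
Proof.
move=> u0 [[yr yU] yK]; have oV : open (U `&` ~` K).
  by apply: openI => //; rewrite openC; exact: closedK cK.
have Cy : cyl eps (U `&` ~` K) y by [].
rewrite (flux_ext oV Acm i (v := cst 0) _ Cy); last by move=> z [zr [zU zK]]; exact: u0.
rewrite /flux big1 // => j _.
by rewrite (cpd_cst (i_x j) 0 (ropen_cyl oV) Cy) mulr0.
Qed.

(** The functional [P_k] of the overview, read in the chart with the truncated series. *)
Definition pairing k psi := icx U (fun x => tc k (fun y => sgm y * (W y * psi y)) x).

Lemma test_pairing k psi : csm C psi -> test U K (tc k (fun y => sgm y * (W y * psi y))).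
Proof.
move=> sp; apply: test_tc; first by apply: csmM => //; exact: csmM.
by move=> y Zy; rewrite W0 // mul0r mulr0.
Qed.

Lemma pairing_shift k psi : csm C psi ->
  (forall m x, (m <= k)%N -> U x -> tc m (Op sgm Acm (2 * nu - n%:R + 1) nu W) x = 0) ->
  pairing k (shift_op hr c (nu + k%:R) psi) =
  - (k.+1%:R * (2 * nu + k%:R - n%:R + 1)) * pairing k.+1 psi.
Proof.
move=> sp zero; set a := - _.
set B := fun i y => W y * flux Acm psi i y - psi y * flux Acm W i y.
have tB k' i : test U K (tc k' (B i)).
  apply: test_tc; first by apply: csmB; apply: csmM => //; exact: (csm_flux oU sA).
  by move=> y Zy; rewrite /B (flux0 i W0 Zy) W0 // mul0r mulr0 subrr.
(* The divergences come with a factor [r], so they contribute their coefficient of order [k - 1],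
   and nothing for [k = 0]. *)
pose D x := if k is k'.+1 then \sum_i cpd (i : 'I_n) (tc k' (B i)) x else 0.
have E x : U x -> tc k (fun y => sgm y * (W y * shift_op hr c (nu + k%:R) psi y)) x =
    a * tc k.+1 (fun y => sgm y * (W y * psi y)) x + D x.
  move=> Ux; rewrite /a /D /B.
  have P := @tc_pairing R n eps U e0 oU sgm Acm ss sA
    (fun i j y Cy => Ac_sym (chart_sym hp ac) i j Cy) nu n%:R k W psi x sW sp Ux
    (fun m mk => zero m x mk Ux).
  apply: etrans _ P.
  apply: (tc_ext e0 oU k _ Ux) => y Cy.
  by rewrite mulrCA (sg_shift_op hp ac _ Cy sp).
have tD : test U K D.
  rewrite /D; case: k {E a zero D} => [|k']; first exact: test0.
  by apply: test_sum => i; exact: (test_cpd oU cK).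
rewrite /pairing (icx_ext E).
have tQ := test_pairing k.+1 sp.
rewrite (icxD oU cK KU (testZ a tQ) tD) (icxZ oU cK KU a tQ).
suff -> : icx U D = 0 by rewrite addr0.
rewrite /D; case: k {E a zero D tD tQ} => [|k']; first exact: icx0.
rewrite (icx_sum oU cK KU) => [|i]; last exact: (test_cpd oU cK).
by rewrite big1 // => i _; rewrite (icx_cpd0 oU cK KU).
Qed.

(** The starting order [k] is general for the induction: removing the outermost operator [S(nu + k)]
    leaves the composition that starts at [nu + k + 1], to be paired at order [k + 1]. *)
Lemma pairing_shiftN k L psi : csm C psi ->
  (forall m x, (m < k + L)%N -> U x -> tc m (Op sgm Acm (2 * nu - n%:R + 1) nu W) x = 0) ->
  pairing k (shift_opN hr c L (nu + k%:R) psi) =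
  (\prod_(i < L) (- ((k + i).+1%:R * (2 * nu + (k + i)%:R - n%:R + 1)))) * pairing (k + L) psi.
Proof.
move=> sp; elim: L k => [|L IH] k zero; first by rewrite big_ord0 mul1r addn0.
rewrite [shift_opN _ _ _ _ _]/= pairing_shift; first last.
- by move=> m x mk; apply: zero; rewrite addnS ltnS (leq_trans mk) // leq_addr.
- exact: (csm_shift_opN hp ac).
have -> : nu + k%:R + 1 = nu + k.+1%:R :> R[i] by rewrite -addrA natr1.
rewrite IH; last by move=> m x mk; apply: zero; rewrite addnS.
rewrite big_ord_recl addn0 mulrA addnS; congr (_ * _ * _).
by apply: eq_bigr => i _; rewrite lift0 addnS.
Qed.

Section Delta.
Variable v : R -> M -> R.
Hypothesis hv : volume_ratio hr eps h v.
Variable Tstar : operators M.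
Hypothesis hTstar : adjoint_operators h T Tstar.
Variable phi : R -> M -> R[i].
Hypothesis sphi : smoothMplus eps phi.
Local Notation s0 := (fun x => sgm (pt 0 x)).

Lemma admissible_doubleS j : (j <= J.*2.+1)%N -> admissible n j.
Proof.
move: aJ; rewrite /admissible odd_double; case: (odd n) => //= Jn; rewrite leq_eqVlt.
case/orP => [/eqP ->|]; first by rewrite /= odd_double.
by rewrite ltnS => jJ; rewrite (leq_trans jJ Jn) orbT.
Qed.

Lemma regular_doubleS j : (j <= J.*2.+1)%N -> regular n j nu.
Proof.
move=> jJ i i0 ij; apply: rJ => //; rewrite leq_double -ltnS -ltn_double doubleS.
exact: leq_ltn_trans (leq_trans ij jJ) (leqnn _).
Qed.

Lemma smoothM_bdry i k : smoothM (fun q => (vcoef v i q)%:C * bdry_der k phi q).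
Proof.
move=> c' ac'; have sp : csm (cyl eps (img c')) (in_chart c' phi) := csm_in_chart ac' sphi.
have s1 := csmM (csm_vcoef hp ac' hv i) (csmZ k`!%:R (csm_tc e0 (open_img ac') k sp)).
by apply: csm_ext s1 => x _; rewrite -bdry_der_tc.
Qed.

Lemma patch_icx (F : M -> R[i]) :
  cx (fun G (_ : unit) => patch_int h c G) F tt = icx U (fun x => F (param c x) * s0 x).
Proof.
have [_ _ _ h0 _] := hp.
have E x : U x -> s0 x = (Num.sqrt (\det (h c x)))%:C.
  by move=> Ux; rewrite /sg /sgR /hmx rcoord_pt xcoord_pt h0.
apply: complexP; rewrite /= /patch_int; congr rvint; apply/funext => x;
  rewrite !patchE; case: ifPn => // /set_mem Ux; rewrite E //.
  by rewrite cReM /= mulr0 subr0.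
by rewrite cImM /= mulr0 add0r.
Qed.

Lemma test_product j i k :
  test U K (fun x => tc i sgm x * tc j W x * tc k (in_chart c phi) x).
Proof.
apply: (test_ext (g := fun x => tc j W x * tc i sgm x * tc k (in_chart c phi) x)).
  by move=> x _; rewrite [tc j W x * _]mulrC.
apply: testM; last exact: (csm_tc e0 oU _ (csm_in_chart ac sphi)).
by apply: testM; [exact: test_tc|exact: (csm_tc e0 oU)].
Qed.

(** The adjoint is moved back to [f], where [T j nu f] is a Taylor coefficient of [W]; [vcoef_sgm]
    absorbs the density, and the factorial relates normal derivatives to Taylor coefficients. *)
Lemma icx_adjoint j i k : (j <= J.*2.+1)%N ->
  icx U (fun x => f (param c x) * s0 x *
     Tstar j nu (fun q => (vcoef v i q)%:C * bdry_der k phi q) (param c x)) =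
  k`!%:R * icx U (fun x => tc i sgm x * tc j W x * tc k (in_chart c phi) x).
Proof.
move=> jJ; pose g q := (vcoef v i q)%:C * bdry_der k phi q.
have [_ A] := hTstar (admissible_doubleS jJ) (regular_doubleS jJ).
have {}A := A c ac f g sf (smoothM_bdry i k).
have pK : exists K' : set M, [/\ compact K', K' `<=` dom c & forall p, ~ K' p -> f p = 0].
  exists (param c @` K); split=> //; last by move=> _ [x /KU Ux <-]; have [] := img_param ac Ux.
  apply: continuous_compact => //; apply: continuous_in_subspaceT => x /set_mem/KU Ux.
  by have [_ _ _ _ cp] := atlas_chart ac; exact: cp.
have {}A := A pK; rewrite !patch_icx in A.
rewrite -(icxZ oU cK KU _ (test_product j i k)).
apply: etrans (etrans (icx_ext _) (esym A)) (icx_ext _).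
  by move=> x Ux; rewrite mulrAC.
move=> x Ux; rewrite (tc_Wser hp ac hT sf aJ rJ Ux jJ) -(vcoef_sgm hp ac hv i Ux) /g.
by rewrite bdry_der_tc; ring.
Qed.

Lemma csm_Tstar j i k : (j <= J.*2.+1)%N ->
  csm U (fun x => Tstar j nu (fun q => (vcoef v i q)%:C * bdry_der k phi q) (param c x)).
Proof.
move=> jJ; have [st _] := hTstar (admissible_doubleS jJ) (regular_doubleS jJ).
exact: (csm_smoothM ac (st _ (smoothM_bdry i k))).
Qed.

Lemma csm_delta L : (L <= J.*2.+1)%N -> csm U (fun x => delta_fam v Tstar L nu phi (param c x)).
Proof.
move=> LJ; apply: csm_sum => j _; apply: csmZ; apply: csm_sum => i _; apply: csm_Tstar.
by rewrite (leq_trans (leq_subr _ _)) // (leq_trans _ LJ) // -ltnS.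
Qed.

Lemma test_f : test U K (fun x => f (param c x) * s0 x).
Proof.
apply: testM; last exact: (csm_trace0 e0 ss).
by split; [exact: (csm_smoothM ac sf)|exact: param_off].
Qed.

(** The triple sum is the Cauchy product of the expansions of [sgm], [W] and [phi], of orders [i],
    [j - i] and [L - j]: these are the indices of the volume coefficient, the adjoint and the normal
    derivative in [delta_fam]. *)
Lemma pairing_delta L : (L <= J.*2.+1)%N ->
  pairing L (in_chart c phi) =
  icx U (fun x => f (param c x) * s0 x * delta_fam v Tstar L nu phi (param c x)).
Proof.
move=> LJ; have sp := csm_in_chart ac sphi.
have jJ (j : 'I_L.+1) (i : 'I_j.+1) : (j - i <= J.*2.+1)%N.
  by rewrite (leq_trans (leq_subr _ _)) // (leq_trans _ LJ) // -ltnS.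
have tT := test_product.
have tS (j : 'I_L.+1) : test U K (fun x => \sum_(i < j.+1)
    tc i sgm x * tc (j - i) W x * tc (L - j) (in_chart c phi) x).
  by apply: test_sum => i.
transitivity (\sum_(j < L.+1) \sum_(i < j.+1)
    icx U (fun x => tc i sgm x * tc (j - i) W x * tc (L - j) (in_chart c phi) x)).
  under eq_bigr => j _ do rewrite -(icx_sum oU cK KU) //.
  rewrite -(icx_sum oU cK KU) //; apply: icx_ext => x Ux.
  rewrite (tc_ext e0 oU L (v := fun y => sgm y * W y * in_chart c phi y) _ Ux); last first.
    by move=> y _; rewrite mulrA.
  rewrite (tcM e0 oU _ (csmM ss sW) sp Ux); apply: eq_bigr => j _.
  by rewrite (tcM e0 oU _ ss sW Ux) mulr_suml.
have tD j i k : (j <= J.*2.+1)%N -> test U K (fun x => f (param c x) * s0 x *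
    Tstar j nu (fun q => (vcoef v i q)%:C * bdry_der k phi q) (param c x)).
  by move=> jL; apply: testM; [exact: test_f|exact: csm_Tstar].
have tDS (j : 'I_L.+1) : test U K (fun x => \sum_(i < j.+1) (f (param c x) * s0 x *
    Tstar (j - i)%N nu (fun q => (vcoef v i q)%:C * bdry_der (L - j) phi q) (param c x))).
  by apply: test_sum => i; exact: tD.
transitivity (icx U (fun x => \sum_(j < L.+1) (L - j)`!%:R^-1 * \sum_(i < j.+1)
    (f (param c x) * s0 x *
     Tstar (j - i)%N nu (fun q => (vcoef v i q)%:C * bdry_der (L - j) phi q) (param c x)))); last first.
  apply: icx_ext => x _; rewrite /delta_fam mulr_sumr; apply: eq_bigr => j _.
  by rewrite mulrCA; congr (_ * _); rewrite mulr_sumr.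
rewrite (icx_sum oU cK KU) => [|j]; last exact: testZ.
apply: eq_bigr => j _; rewrite (icxZ oU cK KU) // (icx_sum oU cK KU) => [|i]; last exact: tD.
rewrite mulr_sumr; apply: eq_bigr => i _; rewrite icx_adjoint // mulKf //.
Qed.

Lemma shift_delta L : (L <= J.*2.+1)%N ->
  icx U (fun x => f (param c x) * s0 x * shift_opN hr c L nu (in_chart c phi) (pt 0 x)) =
  (\prod_(i < L) (- (i.+1%:R * (2 * nu + i%:R - n%:R + 1)))) *
  icx U (fun x => f (param c x) * s0 x * delta_fam v Tstar L nu phi (param c x)).
Proof.
move=> LJ; have sp := csm_in_chart ac sphi.
have [T0 _ _ _] := hT.
rewrite -(pairing_delta LJ) -[in RHS](add0n L).
have -> : \prod_(i < L) (- (i.+1%:R * (2 * nu + i%:R - n%:R + 1))) =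
   \prod_(i < L) (- ((0 + i).+1%:R * (2 * nu + (0 + i)%:R - n%:R + 1))) :> R[i] by [].
rewrite -(pairing_shiftN sp) ?addr0.
  apply: icx_ext => x Ux; rewrite tc0.
  rewrite -[W (pt 0 x)](tc0 (Wser c T f J nu)) (tc_Wser hp ac hT sf aJ rJ Ux) // T0.
  by rewrite mulrA [_ * s0 x]mulrC.
move=> m x; rewrite add0n => mL Ux; have := leq_trans mL LJ.
(* Order [m = 2J], reached only when [L = 2J + 1], is settled by parity; the lower orders follow
   from the decay of the truncated equation. *)
rewrite ltnS leq_eqVlt => /orP[/eqP ->|mJ]; last exact: (Wser_Op hp ac hT sf aJ rJ Ux).
by apply: (Wser_Op_even hp ac hT sf aJ rJ Ux); rewrite odd_double.
Qed.

End Delta.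

End Pairing.

(** * Residue families *)

Section FactorIdentities.
Variable R : realType.
Implicit Types (lam : R[i]) (N n : nat).

Lemma rising_ffact (k m : nat) : (m <= k)%N ->
  rising (- k%:R : R[i]) m = (-1) ^+ m * (k ^_ m)%:R.
Proof.
elim: m => [|m IH] mk; first by rewrite /rising big_ord0 expr0 ffactn0 mul1r.
rewrite /rising big_ord_recr /= -[\prod_(i < m) _]/(rising (- k%:R) m) IH; last exact: ltnW.
by rewrite ffactnSr natrM natrB ?(ltnW mk) // exprS; ring.
Qed.

Lemma prod_double (F : nat -> R[i]) N :
  \prod_(k < N.*2) F k = \prod_(i < N) (F i.*2 * F i.*2.+1).
Proof.
elim: N => [|N IH]; first by rewrite !big_ord0.
by rewrite doubleS !big_ord_recr /= IH mulrA.
Qed.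

Lemma prod_natS L : \prod_(k < L) (k.+1%:R : R[i]) = L`!%:R.
Proof. by elim: L => [|L IH]; [rewrite big_ord0|rewrite big_ord_recr /= IH factS natrM mulrC]. Qed.

(** Read backwards, the factors of [rising a N] are the negatives of those of [rising b N]. *)
Lemma rising_rev (a b : R[i]) N : a + b = (1 - N%:R) -> rising a N = (-1) ^+ N * rising b N.
Proof.
move=> ab; rewrite /rising (reindex_inj rev_ord_inj) /=.
rewrite -[N in X in X * _]card_ord -prodr_const -big_split /=; apply: eq_bigr => i _.
rewrite natrB // -natr1 -[a](addrK b) ab; ring.
Qed.

(** Even indices on the right give twice the factors of the first [lam]-dependent rising factorial,
    odd indices twice those of the reversed factorial from [D^res]. The integers [i.+1] multiply to
    [(2N)!], which is [N!] times the falling factorial in [(-2N)_N]; the signs cancel. *)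
Lemma even_factor n N lam :
  rising (- N.*2%:R) N * rising (lam + (n%:R + 1) / 2 - N.*2%:R) N *
    (2 ^+ N.*2 * N`!%:R * rising (- (n%:R / 2) - lam + N%:R) N) =
  \prod_(i < N.*2) (- (i.+1%:R * (2 * (lam + n%:R - N.*2%:R) + i%:R - n%:R + 1))).
Proof.
have le : (N <= N.*2)%N by rewrite -addnn leq_addr.
rewrite rising_ffact // (@rising_rev (- (n%:R / 2) - lam + N%:R) (lam + n%:R / 2 - N.*2%:R + 1)); last first.
  by rewrite -addnn natrD; ring.
under [in RHS]eq_bigr => i _ do rewrite -mulNr.
rewrite big_split /= prodrN card_ord prod_natS -(ffact_fact le).
have -> : (N.*2 - N)%N = N by rewrite -addnn addnK.
rewrite (prod_double (fun i => 2 * (lam + n%:R - N.*2%:R) + i%:R - n%:R + 1)) natrM.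
rewrite (eq_bigr (fun i : 'I_N => (2 * (lam + (n%:R + 1) / 2 - N.*2%:R + i%:R)) *
   (2 * (lam + n%:R / 2 - N.*2%:R + 1 + i%:R)))) => [|i _]; last first.
  by rewrite -[i.*2.+1%:R]natr1 -!muln2 !natrM; field.
rewrite big_split /= !big_split /= !prodr_const !card_ord -/(rising _ _) /rising.
by rewrite -addnn !exprD; ring.
Qed.

(** As in [even_factor], with one more even index, [2N]: it accounts for the length [N + 1] of the
    rising factorials and for the extra factor 2. *)
Lemma odd_factor n N lam :
  2 * rising (- N.*2%:R - 1) N.+1 * rising (lam + n%:R / 2 - N.*2%:R - 2^-1) N.+1 *
    (2 ^+ N.*2 * N`!%:R * rising (- (n%:R / 2) - lam + N%:R + 1) N) =
  \prod_(i < N.*2.+1) (- (i.+1%:R * (2 * (lam + n%:R - N.*2%:R - 1) + i%:R - n%:R + 1))).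
Proof.
have le : (N.+1 <= N.*2.+1)%N by rewrite ltnS -addnn leq_addr.
have -> : - N.*2%:R - 1 = - N.*2.+1%:R :> R[i] by rewrite -[in RHS]natr1 opprD.
rewrite rising_ffact // (@rising_rev (- (n%:R / 2) - lam + N%:R + 1) (lam + n%:R / 2 - N.*2%:R)); last first.
  by rewrite -addnn natrD; ring.
under [in RHS]eq_bigr => i _ do rewrite -mulNr.
rewrite big_split /= prodrN card_ord prod_natS -(ffact_fact le).
have -> : (N.*2.+1 - N.+1)%N = N by rewrite subSS -addnn addnK.
rewrite big_ord_recr /=.
rewrite (prod_double (fun i => 2 * (lam + n%:R - N.*2%:R - 1) + i%:R - n%:R + 1)) natrM.
rewrite (eq_bigr (fun i : 'I_N => (2 * (lam + n%:R / 2 - N.*2%:R - 2^-1 + i%:R)) *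
   (2 * (lam + n%:R / 2 - N.*2%:R + i%:R)))) => [|i _]; last first.
  by rewrite -[i.*2.+1%:R]natr1 -!muln2 !natrM; field.
rewrite big_split /= !big_split /= !prodr_const !card_ord /rising [in LHS]big_ord_recr /=.
have -> : 2 * (lam + n%:R - N.*2%:R - 1) + N.*2%:R - n%:R + 1 =
    2 * (lam + n%:R / 2 - N.*2%:R - 2^-1 + N%:R) by rewrite -addnn natrD; field.
rewrite -addnn !exprS !exprD.
by field.
Qed.

(** Reversed, the rising factorial has the factors [nu - n / 2 + i], [0 < i <= J], which are half of
    those of [denom]. *)
Lemma denom_rising n J (nu : R[i]) :
  2 ^+ J * rising (n%:R / 2 - nu - J%:R) J = (-1) ^+ J * denom n J nu.
Proof.
rewrite (@rising_rev _ (nu - n%:R / 2 + 1)); last by ring.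
rewrite mulrCA; congr (_ * _); rewrite /rising /denom -[J in X in X * _]card_ord -prodr_const -big_split /=.
by apply: eq_bigr => i _; rewrite -muln2 natrM -[i.+1%:R]natr1; field.
Qed.

End FactorIdentities.

Section Polynomials.
Variable R : realType.

Lemma poly_eq_natS (p q : {poly R[i]}) (b : R[i]) :
  (forall k : nat, p.[k%:R + b] = q.[k%:R + b]) -> p = q.
Proof.
move=> E; apply/eqP; rewrite -subr_eq0; apply/eqP.
apply: (@roots_geq_poly_eq0 _ _ [seq (k%:R + b) | k <- iota 0 (size (p - q))]).
- by apply/allP => _ /mapP[k _ ->]; rewrite rootE hornerD hornerN E subrr.
- rewrite map_inj_uniq ?iota_uniq // => i j /addIr /eqP; rewrite eqr_nat => /eqP //.
- by rewrite size_map size_iota.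
Qed.

(** A failure would force [n + 2k + 2i = 0] with [i > 0]. This provides infinitely many regular
    values, for interpolation and for comparing polynomials. *)
Lemma regular_nat n J (k : nat) : regular n J ((n + k)%:R : R[i]).
Proof.
move=> i i0 _ /eqP; rewrite eq_sym subr_eq -natrM -natrD eqr_nat => /eqP E.
by move: i0 E; rewrite -muln2; lia.
Qed.

Lemma poly_extP (A : set R[i]) F z : (exists p : {poly R[i]}, forall y, A y -> p.[y] = F y) ->
  A z -> (poly_ext A F).[z] = F z.
Proof.
move=> ex; have := xgetPex 0 (P := [set p : {poly R[i]} | forall y, A y -> p.[y] = F y]).
by apply; case: ex => p Ep; exists p.
Qed.

End Polynomials.

(** * From tested identities to pointwise ones *)

Section PointwiseIdentity.
Variables (R : realType) (n : nat) (M : manifold R n) (h : tensor2 M).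
Variables (eps : R) (hr : R -> tensor2 M).
Hypothesis hp : poincare hr eps h.
Variables (v : R -> M -> R) (T Tstar : operators M).
Hypothesis hv : volume_ratio hr eps h v.
Hypothesis hT : solution_operators hr T.
Hypothesis hTstar : adjoint_operators h T Tstar.
Variable phi : R -> M -> R[i].
Hypothesis sphi : smoothMplus eps phi.
Variable c : chart R n M.
Hypothesis ac : atlas c.
Local Notation U := (img c).
Local Notation C := (cyl eps (img c)).
Local Notation sgm := (sg (hmx hr c)).
Local Notation Acm := (Ac (hmx hr c)).
Local Notation s0 := (fun x => sgm (pt 0 x)).
Let e0 := poincare_eps_gt0 hp.
Let oU := open_img ac.
Let ss := csm_sgm hp ac.
Let sp : csm C (in_chart c phi) := csm_in_chart ac sphi.
Variables (N L : nat).
Hypotheses (aN : admissible n N.*2) (LN : (L <= N.*2.+1)%N).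
Local Notation delta nu x := (delta_fam v Tstar L nu phi (param c x)).

Lemma weak_zero_density (G : 'rV[R]_n -> R[i]) : csm U G ->
  (forall x0 d, box x0 d `<=` U ->
    icx U (fun x => bumpM c x0 d (param c x) * s0 x * G x) = 0) ->
  forall x, U x -> G x = 0.
Proof.
move=> sG wG x Ux; have s0n : s0 x != 0 by apply: (sgm_neq0 hp ac); exact: cyl0.
have /eqP : s0 x * G x = 0.
  apply: (weak_zero ac (G := fun x => s0 x * G x) _ _ Ux).
    by apply: csmM => //; exact: (csm_trace0 e0 ss).
  by move=> x0 d bU; rewrite -(wG x0 d bU); apply: icx_ext => z _; rewrite mulrA.
by rewrite mulf_eq0 (negbTE s0n) => /eqP.
Qed.

Lemma shift_delta_pt nu x : regular n N.*2 nu -> U x ->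
  shift_opN hr c L nu (in_chart c phi) (pt 0 x) =
  (\prod_(i < L) (- (i.+1%:R * (2 * nu + i%:R - n%:R + 1)))) * delta nu x.
Proof.
move=> rN Ux; apply/eqP; rewrite -subr_eq0; apply/eqP; set P := \prod_(i < L) _.
have sS := csm_trace0 e0 (csm_shift_opN hp ac L nu sp).
have sD := csm_delta hp ac aN rN hv hTstar sphi LN.
apply: (weak_zero_density (G := fun x => shift_opN hr c L nu (in_chart c phi) (pt 0 x) - P * delta nu x)) Ux.
  by apply: csmB => //; exact: csmZ.
move=> x0 d bU; have cb := @compact_box _ _ x0 d.
have sb := smoothM_bumpM ac bU; have b0 := @bumpM_off _ _ _ _ ac x0 d.
have tf : test U (box x0 d) (fun x => bumpM c x0 d (param c x) * s0 x).
  exact: (test_f hp ac sb bU b0).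
have E := shift_delta hp ac hT sb cb bU b0 aN rN hv hTstar sphi LN.
transitivity (icx U (fun x => bumpM c x0 d (param c x) * s0 x * shift_opN hr c L nu (in_chart c phi) (pt 0 x) +
    - P * (bumpM c x0 d (param c x) * s0 x * delta nu x))).
  by apply: icx_ext => z _; ring.
have t1 := testM tf sS; have t2 := testM tf sD.
rewrite (icxD oU cb bU t1 (testZ (- P) t2)) (icxZ oU cb bU (- P) t2).
by rewrite E mulNr subrr.
Qed.

(** By [pairing_delta] the adjoints disappear and only [W] is left, to which [Wser_pfam] applies.
    The size bound does not depend on [f], so the same [N + 1] nodes interpolate for all test
    functions. *)
Lemma weak_delta_poly (f : M -> R[i]) (K : set 'rV[R]_n) : smoothM f -> compact K -> K `<=` U ->
  (forall p, ~ (param c @` K) p -> f p = 0) ->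
  exists2 q : {poly R[i]}, (size q <= N.+1)%N & forall nu, regular n N.*2 nu ->
    denom n N nu * icx U (fun x => f (param c x) * s0 x * delta nu x) = q.[nu].
Proof.
move=> sf cK KU fK; have fK' := @param_off _ _ _ _ ac f K KU fK.
have [a ga Ea] := Wser_pfam hp ac hT sf cK fK' aN.
have sa k : csm C (fun y => sgm y * (a k y * in_chart c phi y)).
  by apply: csmM => //; apply: csmM => //; exact: (ga k).1.
have ta k : test U K (tc L (fun y => sgm y * (a k y * in_chart c phi y))).
  apply: (test_tc hp ac cK) => // y Zy.
  by rewrite (ga k).2 // mul0r mulr0.
exists (\poly_(k < N.+1) icx U (tc L (fun y => sgm y * (a k y * in_chart c phi y)))).
  exact: size_poly.
move=> nu rN; rewrite -(pairing_delta hp ac hT sf cK KU fK aN rN hv hTstar sphi LN).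
have sW := csm_Wser eps ac hT sf aN rN.
have tP := test_pairing hp ac hT sf cK KU fK aN rN L sp.
rewrite /pairing -(icxZ oU cK KU _ tP) horner_poly.
transitivity (icx U (fun x => \sum_(k < N.+1) nu ^+ k * tc L (fun y => sgm y * (a k y * in_chart c phi y)) x)).
  apply: icx_ext => x Ux.
  have st : csm C (fun y => sgm y * (Wser c T f N nu y * in_chart c phi y)).
    by apply: csmM => //; exact: csmM.
  rewrite -(tcZ e0 oU) //.
  rewrite (tc_ext e0 oU L (v := fun y => \sum_(k < N.+1) nu ^+ k * (sgm y * (a k y * in_chart c phi y))) _ Ux).
    rewrite (tc_sum e0 oU) //; last by move=> k _; exact: csmZ.
    by apply: eq_bigr => k _; rewrite (tcZ e0 oU).
  move=> y Cy; rewrite mulrCA [denom n N nu * _]mulrA; have /= E := Ea nu y rN Cy.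
  rewrite E mulr_suml mulr_sumr; apply: eq_bigr => k _.
  by rewrite -!mulrA mulrCA.
rewrite (icx_sum oU cK KU) => [|k]; last exact: testZ.
by apply: eq_bigr => k _; rewrite (icxZ oU cK KU) // mulrC.
Qed.

(* After integration against a test function the left side is a polynomial of
   size at most N.+1 in nu, hence equal to its Lagrange interpolation at N.+1
   nodes.  As the interpolation coefficients do not depend on the test function,
   the interpolation formula also holds pointwise. *)
Lemma delta_poly x : U x ->
  exists q : {poly R[i]}, forall nu, regular n N.*2 nu -> denom n N nu * delta nu x = q.[nu].
Proof.
move=> Ux; pose z (k : nat) : R[i] := (n + k)%:R.
have zI : injective z by move=> i j /eqP; rewrite eqr_nat eqn_add2l => /eqP.
have rz k : regular n N.*2 (z k) := @regular_nat R n N.*2 k.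
pose l (k : 'I_N.+1) : {poly R[i]} := tnth (lagrange N.+1 z) k.
exists (\sum_(k < N.+1) (denom n N (z k) * delta (z k) x)%:P * l k) => nu rN.
rewrite horner_sum.
under eq_bigr => k _ do rewrite hornerM hornerC.
apply/eqP; rewrite -subr_eq0; apply/eqP.
pose S x := \sum_(k < N.+1) (l k).[nu] * (denom n N (z k) * delta (z k) x).
have sD nu' : regular n N.*2 nu' -> csm U (fun x => delta nu' x).
  by move=> rn; exact: (csm_delta hp ac aN rn hv hTstar sphi LN).
have sS : csm U S by apply: csm_sum => k _; apply: csmZ; apply: csmZ; exact: sD.
have SE y : S y = \sum_(k < N.+1) denom n N (z k) * delta (z k) y * (l k).[nu].
  by apply: eq_bigr => k _; rewrite mulrC.
rewrite -SE.
apply: (weak_zero_density (G := fun x => denom n N nu * delta nu x - S x)) Ux.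
  by apply: csmB => //; apply: csmZ; exact: sD.
move=> x0 d bU; have cb := @compact_box _ _ x0 d.
have sb := smoothM_bumpM ac bU; have b0 := @bumpM_off _ _ _ _ ac x0 d.
set w := fun x => bumpM c x0 d (param c x) * s0 x.
have tf : test U (box x0 d) w by exact: (test_f hp ac sb bU b0).
have [q sq Eq] := weak_delta_poly sb cb bU b0.
have tD nu' : regular n N.*2 nu' -> test U (box x0 d) (fun x => w x * delta nu' x).
  by move=> rn; apply: testM => //; exact: sD.
transitivity (icx U (fun x => denom n N nu * (w x * delta nu x) +
   -1 * \sum_(k < N.+1) (l k).[nu] * (denom n N (z k) * (w x * delta (z k) x)))).
  apply: icx_ext => y _; rewrite mulrBr mulN1r [w y * (_ * _)]mulrCA; congr (_ - _).
  by rewrite /S mulr_sumr; apply: eq_bigr => k _; rewrite mulrCA; congr (_ * _); rewrite mulrCA.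
have tk (k : 'I_N.+1) : test U (box x0 d) (fun x => (l k).[nu] * (denom n N (z k) * (w x * delta (z k) x))).
  by apply: testZ; apply: testZ; exact: tD.
have tS := test_sum (index_enum 'I_N.+1) tk.
rewrite (icxD oU cb bU (testZ _ (tD _ rN)) (testZ _ tS)) !(icxZ oU cb bU) //; last exact: tD.
rewrite (icx_sum oU cb bU) // Eq // [in X in X + _](lagrange_gen (ltn0Sn N) zI sq).
rewrite horner_sum mulN1r; apply/eqP; rewrite subr_eq0; apply/eqP; apply: eq_bigr => k _.
rewrite hornerM hornerC !(icxZ oU cb bU) ?Eq //; [exact: mulrC|exact: tD|].
by apply: testZ; exact: tD.
Qed.

End PointwiseIdentity.

Lemma rising_poly (R : realType) (a : R[i]) N :
  exists q : {poly R[i]}, forall lam, rising (lam + a) N = q.[lam].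
Proof.
exists (\prod_(i < N) ('X + (a + i%:R)%:P)) => lam.
by rewrite horner_prod; apply: eq_bigr => i _; rewrite hornerD hornerX hornerC addrA.
Qed.

(** * Comparison of the two polynomials in the spectral parameter *)

Section ResidueFamily.
Variables (R : realType) (n : nat) (M : manifold R n) (h : tensor2 M).
Variables (eps : R) (hr : R -> tensor2 M).
Hypothesis hp : poincare hr eps h.
Variable c : chart R n M.
Hypothesis ac : atlas c.
Local Notation C := (cyl eps (img c)).
Local Notation sgm := (sg (hmx hr c)).
Local Notation Acm := (Ac (hmx hr c)).
Let oU := open_img ac.
Let ss := csm_sgm hp ac.
Let sA := csm_Acm hp ac.

(** By [shift_opE], each factor is [1 / sgm] times an [Op] affine in [lam] with slopes -2 and -1, so
    every factor raises the degree by at most one. *)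
Lemma shift_pfam L s u : csm C u ->
  pfam C set0 setT L.+1 (fun lam => shift_opN hr c L (lam + s) u).
Proof.
move=> su; elim: L s => [|L IH] s; first by apply: pfam_cst.
have gOp al be w : good C set0 w -> good C set0 (Op sgm Acm al be w).
  by move=> [sw _]; split; [exact: (csm_Op oU)|].
have pO := pfam_Op oU ss sA gOp (- (2 * s - n%:R + 1)) (-2) (- (s - n%:R + 1)) (-1) (IH (s + 1)).
have gV w : good C set0 w -> good C set0 (fun y => (sgm y)^-1 * w y).
  by move=> [sw _]; split=> //; apply: csmM => //; exact: (csm_sgmV hp ac).
have [a ga Ea] := pO; exists (fun k y => (sgm y)^-1 * a k y); first by move=> k; exact: gV.
move=> lam y _ Cy; rewrite [shift_opN _ _ _ _ _]/=.
rewrite (shift_opE hp ac _ Cy); last exact: (csm_shift_opN hp ac).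
have /= E := Ea lam y I Cy; rewrite -[lam + s + 1]addrA.
have -> : - (2 * (lam + s) - n%:R + 1) = - (2 * s - n%:R + 1) + -2 * lam by ring.
have -> : - (lam + s - n%:R + 1) = - (s - n%:R + 1) + -1 * lam by ring.
by rewrite E mulr_sumr; apply: eq_bigr => k _; rewrite mulrCA.
Qed.

Lemma shift_poly L s u x : csm C u -> img c x ->
  exists q : {poly R[i]}, forall lam, shift_opN hr c L (lam + s) u (pt 0 x) = q.[lam].
Proof.
move=> su Ux; have [a _ Ea] := shift_pfam L s su.
exists (\poly_(k < L.+1) a k (pt 0 x)) => lam.
rewrite horner_poly Ea //; last exact: (cyl0 (poincare_eps_gt0 hp)).
by apply: eq_bigr => k _; rewrite mulrC.
Qed.

Variables (v : R -> M -> R) (T Tstar : operators M).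
Hypothesis hv : volume_ratio hr eps h v.
Hypothesis hT : solution_operators hr T.
Hypothesis hTstar : adjoint_operators h T Tstar.
Variable phi : R -> M -> R[i].
Hypothesis sphi : smoothMplus eps phi.

(** Common to both parities, [L = 2J] and [L = 2J + 1]. The factor [F] is a constant multiple of
    [denom], so by [delta_poly] it clears the poles of [delta_fam] and [poly_ext] is a genuine
    continuation. Both sides are then polynomials, and [shift_delta_pt] gives their equality at
    infinitely many points. *)
Lemma residue_shift (J L : nat) (Q : {poly R[i]}) (F : R[i] -> R[i]) (k : R[i]) x lam :
  admissible n J.*2 -> (J.*2 <= L <= J.*2.+1)%N -> img c x ->
  (forall nu, F nu = k * denom n J (nu + n%:R - L%:R)) ->
  (forall nu, Q.[nu] * F nu =
    \prod_(i < L) (- (i.+1%:R * (2 * (nu + n%:R - L%:R) + i%:R - n%:R + 1)))) ->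
  Q.[lam] * (poly_ext [set nu | regular n L (nu + n%:R - L%:R)]
    (fun nu => F nu * delta_fam v Tstar L (nu + n%:R - L%:R) phi (param c x))).[lam] =
  shift_opN hr c L (lam + n%:R - L%:R) (in_chart c phi) (pt 0 x).
Proof.
move=> aJ /andP[JL LJ] Ux EF EQ; set A := [set nu | _]; set G := fun nu => _.
have [S ES] := shift_poly L (n%:R - L%:R) (csm_in_chart ac sphi) Ux.
have exG : exists p : {poly R[i]}, forall y, A y -> p.[y] = G y.
  have [q Eq] := delta_poly hp hv hT hTstar sphi ac aJ LJ Ux.
  exists (k *: (q \Po ('X + (n%:R - L%:R)%:P))) => nu /(regular_le JL) Anu.
  by rewrite hornerZ horner_comp hornerD hornerX hornerC addrA -Eq // /G EF mulrA.
have -> : lam + n%:R - L%:R = lam + (n%:R - L%:R) by rewrite addrA.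
rewrite ES -hornerM; congr (_.[_]).
(* At [j + L] the shifted parameter is the integer [n + j], which is regular. *)
apply: (@poly_eq_natS _ _ _ L%:R) => j.
have E : j%:R + L%:R + n%:R - L%:R = (n + j)%:R :> R[i] by rewrite natrD; ring.
have Aj : A (j%:R + L%:R) by rewrite /A /= E; exact: regular_nat.
rewrite hornerM (poly_extP exG Aj) -ES addrA (shift_delta_pt hp hv hT hTstar sphi ac aJ LJ _ Ux).
  by rewrite /G mulrA EQ.
exact: (regular_le JL Aj).
Qed.

End ResidueFamily.

Theorem theorem2 (R : realType) (n : nat) (hn : (3 <= n)%N)
  (M : manifold R n) (h : tensor2 M) (hh : riemannian h)
  (N : nat) (hN : (0 < N)%N) (hNn : ~~ odd n -> (N.*2 <= n)%N)
  (eps : R) (hr : R -> tensor2 M) (hp : poincare hr eps h)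
  (v : R -> M -> R) (hv : volume_ratio hr eps h v)
  (T Tstar : operators M) (hT : solution_operators hr T)
  (hTstar : adjoint_operators h T Tstar)
  (phi : R -> M -> R[i]) (hphi : smoothMplus eps phi)
  (c : chart R n M) (hc : atlas c) (x : 'rV[R]_n) (hx : img c x)
  (lam : R[i]) :
  rising (- N.*2%:R) N * rising (lam + (n%:R + 1) / 2 - N.*2%:R) N *
    Dres_even v Tstar N lam phi (param c x)
  = shift_opN hr c N.*2 (lam + n%:R - N.*2%:R) (in_chart c phi) (pt 0 x)
  /\
  2 * rising (- N.*2%:R - 1) N.+1 *
    rising (lam + n%:R / 2 - N.*2%:R - 2^-1) N.+1 *
    Dres_odd v Tstar N lam phi (param c x)
  = shift_opN hr c N.*2.+1 (lam + n%:R - N.*2%:R - 1) (in_chart c phi) (pt 0 x).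
Proof.
have aN : admissible n N.*2.
  by rewrite /admissible; case: (boolP (odd n)) => //= /hNn ->; rewrite orbT.
(* In terms of the shifted parameter [nu], which is [lam + n - 2N] or [lam + n - 2N - 1], the
   arguments of both rising factors in the residue families are [n / 2 - nu - N], so one identity
   covers both. *)
have factor_denom (nu : R[i]) a : a = n%:R / 2 - nu - N%:R ->
    2 ^+ N.*2 * N`!%:R * rising a N = 2 ^+ N * N`!%:R * (-1) ^+ N * denom n N nu.
  move=> ->; rewrite -[RHS]mulrA -denom_rising -addnn exprD; ring.
split.
  have [q Eq] := rising_poly ((n%:R + 1) / 2 - N.*2%:R : R[i]) N.
  have EQ (nu : R[i]) : (rising (- N.*2%:R) N *: q).[nu] =
      rising (- N.*2%:R) N * rising (nu + (n%:R + 1) / 2 - N.*2%:R) N.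
    by rewrite hornerZ -Eq addrA.
  rewrite -EQ; apply: (residue_shift hp hc hv hT hTstar hphi _ aN _ hx
    (F := fun nu => 2 ^+ N.*2 * N`!%:R * rising (- (n%:R / 2) - nu + N%:R) N)) => [|nu|nu].
  - by rewrite leqnn leqnSn.
  - by apply: factor_denom; rewrite -addnn natrD; field.
  - by rewrite EQ even_factor.
have [q Eq] := rising_poly (n%:R / 2 - N.*2%:R - 2^-1 : R[i]) N.+1.
have EQ (nu : R[i]) : ((2 * rising (- N.*2%:R - 1) N.+1) *: q).[nu] =
    2 * rising (- N.*2%:R - 1) N.+1 * rising (nu + n%:R / 2 - N.*2%:R - 2^-1) N.+1.
  by rewrite hornerZ -Eq !addrA.
have sE (nu : R[i]) : nu + n%:R - N.*2.+1%:R = nu + n%:R - N.*2%:R - 1.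
  by rewrite -[N.*2.+1%:R]natr1 opprD addrA.
rewrite -EQ -sE; apply: (residue_shift hp hc hv hT hTstar hphi _ aN _ hx
  (F := fun nu => 2 ^+ N.*2 * N`!%:R * rising (- (n%:R / 2) - nu + N%:R + 1) N)) => [|nu|nu].
- by rewrite leqnn leqnSn.
- by apply: factor_denom; rewrite -[N.*2.+1%:R]natr1 -addnn natrD; field.
- by rewrite EQ sE odd_factor.
Qed.
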